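(* Let $(G,\Omega_G)$, $(F,\Omega_F)$ be two finite holomorphic IFS on $\mathbb{C}$ satisfying the strong separation condition, where $G=\{g_i\}_{i\in\Lambda}$ and $F=\{f_j\}_{j\in\tilde\Lambda}$, with attractors $A_G$, $A_F$. The following conditions (I)-(III) are equivalent: (I) $A_G=A_F$. (II) There exist $k_0\in\mathbb{N}$, a finite collection of words $\mathbf{w}^k\in\Lambda^*$, $\mathbf{v}^k\in\tilde\Lambda^*$, $k=1,\dots,k_0$, and $m_0\in\mathbb{N}$ such that both of the following hold: (G) for some ball $B_G\subset\Omega_G$, for every $m\ge m_0$ and every $\mathbf{w}\in\Lambda^m$ there exist $\mathbf{v}\in\tilde\Lambda^*$ and $k\in\{1,\dots,k_0\}$ such that $$f_{\mathbf{v}}\circ f_{\mathbf{v}^k}^{-1}=g_{\mathbf{w}}\circ g_{\mathbf{w}^k}^{-1}\quad\text{on } g_{\mathbf{w}^k}(B_G),$$ both sides being well-defined there; (F) for some ball $B_F\subset\Omega_F$, for every $m\ge m_0$ and every $\mathbf{v}\in\tilde\Lambda^m$ there exist $\mathbf{w}\in\Lambda^*$ and $k\in\{1,\dots,k_0\}$ such that $$g_{\mathbf{w}}\circ g_{\mathbf{w}^k}^{-1}=f_{\mathbf{v}}\circ f_{\mathbf{v}^k}^{-1}\quad\text{on } f_{\mathbf{v}^k}(B_F),$$ both sides being well-defined there. (III) There exist box-like restrictions $(G,V_G)$ and $(F,V_F)$ of $(G,\Omega_G)$ and $(F,\Omega_F)$ respectively, a number $K\in\mathbb{N}$, a finite collection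 of words $\mathbf{t}^k\in\Lambda^*$, $\mathbf{u}^k\in\tilde\Lambda^*$, $k=1,\dots,K$, and $M\in\mathbb{N}$ such that, with $M_*=\max\{|\mathbf{t}^k|,|\mathbf{u}^k|:k=1,\dots,K\}$, one has $M\ge M_*+1$ and both of the following hold: ($G_{fin}$) for every component $D$ of $V_G$ and every $\mathbf{t}\in\Lambda^M$ there exist a word $\mathbf{u}\in\tilde\Lambda^*$ with $|\mathbf{u}|\ge M_*+1$ and $k\in\{1,\dots,K\}$ such that $g_{\mathbf{t}^k}(D\cap A_G)\subset f_{\mathbf{u}^k}(V_F)$ and $$f_{\mathbf{u}}\circ f_{\mathbf{u}^k}^{-1}=g_{\mathbf{t}}\circ g_{\mathbf{t}^k}^{-1}\quad\text{on } g_{\mathbf{t}^k}(D\cap A_G);$$ ($F_{fin}$) for every component $D$ of $V_F$ and every $\mathbf{u}\in\tilde\Lambda^M$ there exist a word $\mathbf{t}\in\Lambda^*$ with $|\mathbf{t}|\ge M_*+1$ and $k\in\{1,\dots,K\}$ such that $f_{\mathbf{u}^k}(D\cap A_F)\subset g_{\mathbf{t}^k}(V_G)$ and $$g_{\mathbf{t}}\circ g_{\mathbf{t}^k}^{-1}=f_{\mathbf{u}}\circ f_{\mathbf{u}^k}^{-1}\quad\text{on } f_{\mathbf{u}^k}(D\cap A_F).$$ Moreover, if $A=A_G=A_F$, then in (II) one can choose $B_G=B_F$ to be a neighborhood of a point of $A$.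
   Context: A holomorphic IFS is a pair $(G,\Omega)$ where $\Omega$ is a bounded domain in $\mathbb{C}$ and $G=\{g_i:\Omega\to\Omega\}_{i\in\Lambda}$ is a finite collection of univalent (holomorphic injective) maps with $\overline{g_i(\Omega)}\subset\Omega$ for all $i$. (Each $g_i$ is then a strict contraction of $\Omega$ in its hyperbolic metric.) Its attractor $A_G$ is the unique non-empty compact set $A\subset\Omega$ with $A=\bigcup_{i\in\Lambda}g_i(A)$; it is always assumed that $\#A_G\ge2$. The strong separation condition (SSC) means $g_i(A_G)\cap g_j(A_G)=\emptyset$ for all $i\neq j$. Words: for a finite set $\Lambda$, $\Lambda^k$ is the set of words $\mathbf{w}=(i_1,\dots,i_k)$ of length $|\mathbf{w}|=k$ with letters in $\Lambda$, and $\Lambda^*=\bigcup_{k\ge1}\Lambda^k$. For $\mathbf{w}=(i_1,\dots,i_k)\in\Lambda^*$, $g_{\mathbf{w}}=g_{i_1}\circ\dots\circ g_{i_k}:\Omega\to\Omega$, and $g_{\mathbf{w}}^{-1}:g_{\mathbf{w}}(\Omega)\to\Omega$ is its inverse. Similarly for $F$. A box-like restriction of a holomorphic IFS $(G,\Omega)$, $G=\{g_i\}_{i\in\Lambda}$, is a pair $(G,V)$ where $V\subset\Omega$ is an (open) neighborhood of the attractor $A_G$ such that the sets $\overline{g_i(V)}$, $i\in\Lambda$, are pairwise disjoint and contained in $V$. *)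

(* Defs.v *)
From HB Require Import structures.
From mathcomp Require Import all_boot all_order all_algebra.
From mathcomp Require Import complex.
From mathcomp Require Import all_classical all_reals topology normedtype derive.

Set Implicit Arguments.
Unset Strict Implicit.
Unset Printing Implicit Defensive.

Import Order.TTheory GRing.Theory Num.Theory numFieldNormedType.Exports.

Local Open Scope classical_set_scope.
Local Open Scope ring_scope.

(* [R[i]] packaged as a numClosedFieldType: this is the type from which the
   canonical topology and the normed space structure over itself are inferred,
   so that [derivable f z 1] is complex differentiability of [f] at [z]. *)
Definition Cplx (R : realType) : numClosedFieldType := R[i].

Section HolomorphicIFS.
Variable R : realType.
Local Notation C := (Cplx R).

Definition domain (Om : set C) : Prop :=
  [/\ Om !=set0, open Om & connected Om].

Definition holomorphic_on (Om : set C) (g : C -> C) : Prop :=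
  forall z, Om z -> derivable g z 1.

Definition univalent_on (Om : set C) (g : C -> C) : Prop :=
  holomorphic_on Om g /\ set_inj Om g.

(* A map [Om -> Om] is a total function on [C]; only its values on [Om]
   matter. *)
Definition holomorphic_ifs (L : finType) (Om : set C) (g : L -> C -> C) :
    Prop :=
  [/\ domain Om, bounded_set Om &
      forall i, [/\ set_fun Om Om (g i), univalent_on Om (g i) &
                    closure (g i @` Om) `<=` Om]].

Definition is_attractor (L : finType) (Om : set C) (g : L -> C -> C)
    (A : set C) : Prop :=
  [/\ A !=set0, compact A, A `<=` Om & A = \bigcup_i (g i @` A)].

Definition strong_separation (L : finType) (g : L -> C -> C) (A : set C) :
    Prop :=
  trivIset [set: L] (fun i => g i @` A).

(* The empty sequence, whose [word_map] is the identity, is not a word. *)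
Definition is_word (L : finType) (w : seq L) : Prop := (0 < size w)%N.

(* [word_map g [:: i1; ..; ik]] is g_{i1} \o .. \o g_{ik}. *)
Definition word_map (L : finType) (g : L -> C -> C) (w : seq L) : C -> C :=
  foldr (fun i h => g i \o h) id w.

(* g_w \o g_u^-1, to be considered only on g_u(Om): [pinv Om h]
   sends a point of [h @` Om] to a preimage in [Om] and is meaningless
   elsewhere. *)
Definition transition (L : finType) (Om : set C) (g : L -> C -> C)
    (w u : seq L) : C -> C :=
  word_map g w \o pinv Om (word_map g u).

Definition transition_dom (L : finType) (Om : set C) (g : L -> C -> C)
    (u : seq L) : set C :=
  word_map g u @` Om.

Definition box_like (L : finType) (Om : set C) (g : L -> C -> C)
    (A V : set C) : Prop :=
  [/\ open V, A `<=` V, V `<=` Om,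
      trivIset [set: L] (fun i => closure (g i @` V)) &
      forall i, closure (g i @` V) `<=` V].

Definition is_component (V D : set C) : Prop :=
  exists2 x, V x & D = connected_component V x.

(* For every long enough word w in the letters of g there are v and k with
   f_v \o f_{v^k}^-1 = g_w \o g_{w^k}^-1 on g_{w^k}(B), the first two clauses
   saying that both sides are well-defined there. The mirror condition is the
   same predicate with the two systems exchanged. *)
Definition word_matching (L L' : finType) (Om Om' : set C)
    (g : L -> C -> C) (f : L' -> C -> C) (k0 : nat)
    (w_ : 'I_k0 -> seq L) (v_ : 'I_k0 -> seq L') (m0 : nat) (B : set C) :
    Prop :=
  forall m, (m0 <= m)%N -> forall w : seq L, size w = m ->
  exists v : seq L', is_word v /\
  exists k : 'I_k0,
    let S := word_map g (w_ k) @` B in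
    [/\ S `<=` transition_dom Om' f (v_ k),
        S `<=` transition_dom Om g (w_ k) &
        {in S, transition Om' f v (v_ k) =1 transition Om g w (w_ k)}].

(* [A] is the attractor of [g]; [V] and [V'] are the box-like neighborhoods for
   [g] and [f]; [Mstar] is the maximal length of the words [t_ k] and [u_ k].
   As [V'] is contained in [Om'], the inclusion of [S] in f_{u^k}(V') makes the
   left-hand side of the equation well-defined on [S]. *)
Definition finite_word_matching (L L' : finType) (Om Om' : set C)
    (g : L -> C -> C) (f : L' -> C -> C) (A V V' : set C) (K : nat)
    (t_ : 'I_K -> seq L) (u_ : 'I_K -> seq L') (M Mstar : nat) : Prop :=
  forall D, is_component V D -> forall t : seq L, size t = M ->
  exists u : seq L', [/\ is_word u, (Mstar.+1 <= size u)%N &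
  exists k : 'I_K,
    let S := word_map g (t_ k) @` (D `&` A) in
    S `<=` word_map f (u_ k) @` V' /\
    {in S, transition Om' f u (u_ k) =1 transition Om g t (t_ k)}].

Section TwoSystems.
Variables (LG LF : finType) (OmG OmF : set C).
Variables (g : LG -> C -> C) (f : LF -> C -> C).

(* [P] is an additional requirement on the pair of balls. The radii live in
   [C]; [0 < r] in [C] means that r is real and positive. *)
Definition matching_on_balls_with (P : set C -> set C -> Prop) : Prop :=
  exists (k0 : nat) (w_ : 'I_k0 -> seq LG) (v_ : 'I_k0 -> seq LF) (m0 : nat),
  [/\ (0 < k0)%N, (0 < m0)%N, (forall k, is_word (w_ k)),
      (forall k, is_word (v_ k)) &
  exists (bG rG bF rF : C),
    let BG := ball bG rG in let BF := ball bF rF in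
    [/\ 0 < rG /\ BG `<=` OmG, 0 < rF /\ BF `<=` OmF,
        word_matching OmG OmF g f w_ v_ m0 BG,
        word_matching OmF OmG f g v_ w_ m0 BF & P BG BF]].

Definition matching_on_balls : Prop := matching_on_balls_with (fun _ _ => True).

Definition finite_matching (AG AF : set C) : Prop :=
  exists (VG VF : set C) (K : nat)
    (t_ : 'I_K -> seq LG) (u_ : 'I_K -> seq LF) (M : nat),
  let Mstar := (\max_(k < K) maxn (size (t_ k)) (size (u_ k)))%N in
  [/\ box_like OmG g AG VG /\ box_like OmF f AF VF,
      (0 < K)%N,
      (forall k, is_word (t_ k)) /\ (forall k, is_word (u_ k)),
      (Mstar.+1 <= M)%N &
      finite_word_matching OmG OmF g f AG VG VF t_ u_ M Mstar /\
      finite_word_matching OmF OmG f g AF VF VG u_ t_ M Mstar].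

End TwoSystems.
End HolomorphicIFS.

(* Main.v *)
(** If the attractors coincide, choose for every word [w] a word [v] of maximal
    length with g_w(A) contained in f_v(A). By bounded distortion
    h = f_v^-1 g_w : A -> A has derivative bounded away from 0 and infinity. Two
    such maps that are close in value and derivative on a finite net of [A] are
    equal: h' - h is small with small Lipschitz constant, and at the first scale at
    which h' fails to map a piece g_u(A) into h(g_u(A)), the map h' h^-1 is a
    near-translation of the bounded parent piece into itself. So only finitely many
    maps h occur; the identity theorem extends equality from [A] to a ball.
    Conversely, matching words force every point of one attractor to be a limit of
    points f_v(y) with |v| tending to infinity.

    Function theory is based on a discrete Goursat lemma, where contour integrals
    are replaced by dyadic trapezoidal sums: it yields a maximum principle with
    removable points, and the rest (Cauchy estimates, open mapping, identity
    theorem, non-vanishing derivative of univalent maps) follows by applying that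
    principle to difference quotients. *)

Require Import Defs.
From mathcomp Require Import all_boot all_order all_algebra.
From mathcomp Require Import complex.
From mathcomp Require Import all_classical all_reals topology normedtype derive sequences.
From mathcomp Require Import ring lra zify.
Import Order.TTheory GRing.Theory Num.Theory numFieldNormedType.Exports.
Local Open Scope classical_set_scope.
Local Open Scope ring_scope.
Set Implicit Arguments.
Unset Strict Implicit.
Unset Printing Implicit Defensive.

(** * The modulus of a complex number *)

(** A map h is studied on A alone; a neighbourhood common to all h is sought only after finiteness
    is known, when a minimum over finitely many radii suffices. Inclusion of g_w(A) in f_v(A) bounds
    |h'| from above. Maximality of |v| bounds it from below: if h(A) lay in one piece f_j(A), then v
    could be prolonged by j. When (w,v) and a representative (w^k,v^k) give the same h on A, then
    f_v f_{v^k}^-1 = g_w g_{w^k}^-1 on g_{w^k}(A); so the representatives of the finitely many maps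
    are the words asked for. They fix M_* before M is chosen, and |v| tends to infinity with |w|,
    which leaves room for M and |u| to exceed M_*. In the converse, the obstacle is to see that the
    matching words are long. For (II), two points of the ball are followed: g_w brings them
    together, while short words f_v keep their finitely many partners apart. For (III), codes in a
    box-like neighbourhood are unique, and |u| > M_* >= |u^k| makes the code of a point grow at each
    application. The radii h, 2h, 3h and the fractions h/4, h/48, h/96 all come from applying the
    maximum principle with bounds on an annulus h <= |x-c| <= 2h. *)

Section Modulus.
Variable R : realType.
Local Notation C := (Cplx R).

(* The norm of [Cplx R] takes its values in [Cplx R] itself; [cabs] is its real-valued
   counterpart. *)
Definition cabs (z : C) : R := ComplexField.Normc.normc z.
Definition rc (x : R) : C := x%:C%C.
Definition ic : C := Complex 0 1.

Lemma normE (z : C) : `|z| = rc (cabs z).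
Proof. by rewrite normc_def /cabs; case: z. Qed.
Lemma cabs0 : cabs 0 = 0. Proof. exact: ComplexField.Normc.normc0. Qed.
Lemma cabs1 : cabs 1 = 1. Proof. exact: ComplexField.Normc.normc1. Qed.
Lemma cabs_eq0 z : (cabs z == 0) = (z == 0).
Proof.
apply/eqP/eqP => [|->]; last exact: cabs0.
exact: ComplexField.Normc.eq0_normc.
Qed.
Lemma cabs_ge0 z : 0 <= cabs z.
Proof. by rewrite /cabs; case: z => a b; exact: sqrtr_ge0. Qed.
Lemma cabs_gt0 z : (0 < cabs z) = (z != 0).
Proof. by rewrite lt_def cabs_ge0 andbT cabs_eq0. Qed.
Lemma cabsM x y : cabs (x * y) = cabs x * cabs y.
Proof. exact: ComplexField.Normc.normcM. Qed.
Lemma cabsV x : cabs x^-1 = (cabs x)^-1.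
Proof. exact: ComplexField.Normc.normcV. Qed.
Lemma cabsN x : cabs (- x) = cabs x.
Proof. by rewrite /cabs; case: x => a b /=; rewrite !sqrrN. Qed.
Lemma cabsD x y : cabs (x + y) <= cabs x + cabs y.
Proof.
have := ler_normD x y.
by rewrite !normE /rc -rmorphD/= lecR.
Qed.
Lemma cabsB x y : cabs (x - y) <= cabs x + cabs y.
Proof. by rewrite -(cabsN y); exact: cabsD. Qed.
Lemma cabs_dist x y : cabs (x - y) = cabs (y - x).
Proof. by rewrite -cabsN opprB. Qed.
Lemma cabs_tri y x z : cabs (x - z) <= cabs (x - y) + cabs (y - z).
Proof. by rewrite -(subrKA y x); exact: cabsD. Qed.
Lemma cabsX x n : cabs (x ^+ n) = cabs x ^+ n.
Proof. by elim: n => [|n IH]; rewrite ?expr0 ?cabs1// !exprS cabsM IH. Qed.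
Lemma cabs_rc x : cabs (rc x) = `|x|.
Proof. by rewrite /cabs /rc /= expr0n /= addr0 sqrtr_sqr. Qed.
Lemma cabs_ic : cabs ic = 1.
Proof. by rewrite /cabs /ic /= expr0n /= add0r expr1n sqrtr1. Qed.
Lemma ic2 : ic * ic = -1.
Proof. by rewrite -expr2; exact: sqr_i. Qed.
Lemma rcD x y : rc (x + y) = rc x + rc y. Proof. exact: rmorphD. Qed.
Lemma rcM x y : rc (x * y) = rc x * rc y. Proof. exact: rmorphM. Qed.
Lemma rcB x y : rc (x - y) = rc x - rc y. Proof. exact: rmorphB. Qed.
Lemma rc1 : rc 1 = 1. Proof. by []. Qed.
Lemma rc0 : rc 0 = 0. Proof. by []. Qed.
Lemma cabs_nat n : cabs (n%:R) = n%:R.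
Proof. by rewrite -[n%:R]/(n%:R : C) -(rmorph_nat (real_complex R)) cabs_rc ger0_norm. Qed.
Lemma rc_lt x y : (rc x < rc y) = (x < y). Proof. exact: ltcR. Qed.
Lemma rc_le x y : (rc x <= rc y) = (x <= y). Proof. exact: lecR. Qed.

Lemma ReE_le z : `|complex.Re z| <= cabs z.
Proof.
case: z => a b /=; rewrite /cabs /= -sqrtr_sqr ler_wsqrtr// lerDl; exact: sqr_ge0.
Qed.
Lemma ImE_le z : `|complex.Im z| <= cabs z.
Proof.
case: z => a b /=; rewrite /cabs /= -sqrtr_sqr ler_wsqrtr// lerDr; exact: sqr_ge0.
Qed.
Lemma cabs_le_ReIm z : cabs z <= `|complex.Re z| + `|complex.Im z|.
Proof.
case: z => a b; rewrite /cabs /=.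
have ab0 : 0 <= `|a| + `|b| by rewrite addr_ge0.
rewrite -[leRHS](ger0_norm ab0) -(sqrtr_sqr (_ + _)) ler_wsqrtr// sqrrD !real_normK ?num_real//.
by have := mulr_ge0 (normr_ge0 a) (normr_ge0 b); lra.
Qed.
End Modulus.
Arguments ic {R}.

(** * Topology and complex differentiation with real epsilons *)

Section Topology.
Variable R : realType.
Local Notation C := (Cplx R).

Lemma pos_rc (e : C) : 0 < e -> exists2 r : R, 0 < r & e = rc r.
Proof.
move=> e0; exists (complex.Re e).
  by move: e0; rewrite ltcE /= => /andP[_].
by rewrite /rc RRe_real// gtr0_real.
Qed.

Lemma nbhs_cabs (z : C) (U : set C) :
  nbhs z U <-> exists2 r : R, 0 < r & forall y, cabs (y - z) < r -> U y.
Proof.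
split.
  move/nbhs_ballP => [e /= /pos_rc[r r0 ->] sub]; exists r => // y yr.
  by apply: sub; rewrite -ball_normE /= normE rc_lt cabs_dist.
move=> [r r0 sub]; apply/nbhs_ballP; exists (rc r); rewrite /= ?ltcR//.
move=> y; rewrite -ball_normE /= normE rc_lt cabs_dist => ?; exact: sub.
Qed.

Lemma ball_cabs (z y : C) (r : R) : ball z (rc r) y <-> cabs (y - z) < r.
Proof. by rewrite -ball_normE /= normE rc_lt cabs_dist. Qed.

Lemma open_cabs (U : set C) :
  open U <-> forall z, U z -> exists2 r : R, 0 < r & forall y, cabs (y - z) < r -> U y.
Proof.
rewrite openE; split => [h z /h /nbhs_cabs//|h z /h ?].
exact/nbhs_cabs.
Qed.

Lemma closure_cabs (U : set C) z :
  closure U z <-> forall r : R, 0 < r -> exists2 y, U y & cabs (y - z) < r.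
Proof.
split.
  move=> cl r r0.
  have /cl [y [Uy hy]] : nbhs z [set y | cabs (y - z) < r].
    by apply/nbhs_cabs; exists r.
  by exists y.
move=> h B /nbhs_cabs[r r0 sub]; have [y Uy yr] := h r r0.
by exists y; split => //; exact: sub.
Qed.

Definition ccont (f : C -> C) z :=
  forall e : R, 0 < e -> exists2 d : R, 0 < d &
    forall x, cabs (x - z) < d -> cabs (f x - f z) < e.

Lemma ccontP f z : ccont f z <-> {for z, continuous f}.
Proof.
split.
  move=> h B /nbhs_cabs[r r0 sub]; have [d d0 hd] := h r r0.
  by apply/nbhs_cabs; exists d => // y yd; apply: sub; exact: hd.
move=> h e e0.
have /h : nbhs (f z) [set y | cabs (y - f z) < e] by apply/nbhs_cabs; exists e.
by move=> /nbhs_cabs[d d0 hd]; exists d.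
Qed.

(** The first-order expansion, with a real error and without division: the point x = z needs no
    exclusion, and the calculus rules become norm estimates. *)
Definition cdiff (f : C -> C) (z d : C) :=
  forall e : R, 0 < e -> exists2 r : R, 0 < r &
    forall x, cabs (x - z) < r ->
      cabs (f x - f z - d * (x - z)) <= e * cabs (x - z).

Lemma derivable_cdiff (f : C -> C) z : derivable f z 1 <-> exists d, cdiff f z d.
Proof.
split.
  move=> /cvg_ex[d hd]; pose d' : C := d; exists d' => e e0.
  have : nbhs d' [set y | cabs (y - d') < e] by apply/nbhs_cabs; exists e.
  move=> /hd; rewrite /nbhs/= /dnbhs /within/= => /nbhs_cabs[r r0 hr].
  exists r => // x xr; have [->|xz] := eqVneq x z.
    by rewrite !subrr mulr0 subrr cabs0 mulr0.
  have xz0 : x - z != 0 by rewrite subr_eq0.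
  have := hr (x - z); rewrite subr0 => /(_ xr xz0).
  rewrite /shift /comp [_ *: 1]mulr1 subrK => /ltW h.
  have -> : f x - f z - d' * (x - z) = ((x - z)^-1 *: (f x - f z) - d') * (x - z).
    by rewrite /GRing.scale /=; field.
  by rewrite cabsM ler_wpM2r// cabs_ge0.
move=> [d hd]; apply/cvg_ex; exists d => B /nbhs_cabs[e e0 sub].
have e2 : 0 < e / 2 by lra.
have [r r0 hr] := hd _ e2.
rewrite /nbhs/= /dnbhs /within/=; apply/nbhs_cabs; exists r => // y.
rewrite subr0 => yr y0; apply: sub.
have := hr (y + z); rewrite addrK => /(_ yr) h.
have -> : y^-1 *: ((f \o shift z) (y *: 1) - f z) - d =
   y^-1 * (f (y + z) - f z - d * y).
  rewrite /shift /comp [_ *: 1]mulr1 /GRing.scale /=; field. exact: y0.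
rewrite cabsM cabsV mulrC ltr_pdivrMr ?cabs_gt0//.
apply: le_lt_trans h _; rewrite ltr_pM2r ?cabs_gt0//; lra.
Qed.

Lemma cdiff_lip f z d : cdiff f z d -> exists2 r : R, 0 < r &
  forall x, cabs (x - z) < r -> cabs (f x - f z) <= (cabs d + 1) * cabs (x - z).
Proof.
move=> /(_ _ ltr01)[r r0 h]; exists r => // x /h {}h.
have -> : f x - f z = d * (x - z) + (f x - f z - d * (x - z)) by ring.
apply: le_trans (cabsD _ _) _; rewrite cabsM; lra.
Qed.

Lemma cdiff_ccont f z d : cdiff f z d -> ccont f z.
Proof.
move=> /cdiff_lip[r r0 h] e e0; have d0 := cabs_ge0 d.
have d1 : 0 < cabs d + 1 by lra.
exists (Num.min r (e / (cabs d + 1))); first by rewrite lt_min r0 divr_gt0.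
move=> x; rewrite lt_min => /andP[/h xr]; rewrite ltr_pdivlMr// mulrC.
exact: le_lt_trans.
Qed.

Lemma cdiff_cst a z : cdiff (fun=> a) z 0.
Proof.
move=> e e0; exists 1 => // x _; rewrite subrr mul0r subrr cabs0.
by rewrite mulr_ge0 ?cabs_ge0// ltW.
Qed.

Lemma cdiff_id z : cdiff id z 1.
Proof.
move=> e e0; exists 1 => // x _; rewrite mul1r subrr cabs0.
by rewrite mulr_ge0 ?cabs_ge0// ltW.
Qed.

Lemma cdiffD f g z a b : cdiff f z a -> cdiff g z b ->
  cdiff (fun x => f x + g x) z (a + b).
Proof.
move=> hf hg e e0; have e2 : 0 < e / 2 by lra.
have [r r0 hr] := hf _ e2; have [s s0 hs] := hg _ e2.
exists (Num.min r s); first by rewrite lt_min r0.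
move=> x; rewrite lt_min => /andP[/hr {}hr /hs {}hs].
have -> : f x + g x - (f z + g z) - (a + b) * (x - z) =
  (f x - f z - a * (x - z)) + (g x - g z - b * (x - z)) by ring.
by apply: le_trans (cabsD _ _) _; lra.
Qed.

Lemma cdiff_mull c f z a : cdiff f z a -> cdiff (fun x => c * f x) z (c * a).
Proof.
move=> hf e e0; have c0 := cabs_ge0 c.
have c1 : 0 < cabs c + 1 by lra.
have [r r0 hr] := hf (e / (cabs c + 1)) (divr_gt0 e0 c1).
exists r => // x /hr {}hr.
have -> : c * f x - c * f z - c * a * (x - z) = c * (f x - f z - a * (x - z)) by ring.
rewrite cabsM; apply: le_trans (ler_wpM2l c0 hr) _.
rewrite mulrA; apply: ler_wpM2r; first exact: cabs_ge0.
rewrite mulrA ler_pdivrMr//; nra.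
Qed.

Lemma cdiffB f g z a b : cdiff f z a -> cdiff g z b ->
  cdiff (fun x => f x - g x) z (a - b).
Proof.
move=> hf hg; have := cdiffD hf (cdiff_mull (-1) hg); rewrite mulN1r.
by under eq_fun do rewrite mulN1r.
Qed.

Lemma cdiff_comp f g z a b : cdiff g z b -> cdiff f (g z) a ->
  cdiff (f \o g) z (a * b).
Proof.
move=> hg hf e e0; have a0 := cabs_ge0 a; have b0 := cabs_ge0 b.
have a1 : 0 < cabs a + 1 by lra.
have b1 : 0 < cabs b + 1 by lra.
have e1 : 0 < e / (cabs b + 1) / 2 by rewrite !divr_gt0//.
have e2 : 0 < e / (cabs a + 1) / 2 by rewrite !divr_gt0//.
have [r r0 hr] := hf _ e1; have [s s0 hs] := hg _ e2.
have [t t0 ht] := cdiff_lip hg.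
have [u u0 hu] := cdiff_ccont hg r0.
exists (Num.min s (Num.min t u)); first by rewrite !lt_min s0 t0.
move=> x; rewrite !lt_min => /and3P[/hs {}hs /ht {}ht /hu/hr {}hr].
have -> : (f \o g) x - (f \o g) z - a * b * (x - z) =
  (f (g x) - f (g z) - a * (g x - g z)) + a * (g x - g z - b * (x - z)).
  by rewrite /=; ring.
apply: le_trans (cabsD _ _) _; rewrite cabsM.
have x0 := cabs_ge0 (x - z).
have h1 : e / (cabs b + 1) / 2 * cabs (g x - g z) <= e / 2 * cabs (x - z).
  apply: le_trans (ler_wpM2l (ltW e1) ht) _.
  by rewrite le_eqVlt; apply/orP; left; apply/eqP; field; lra.
have h2 : cabs a * cabs (g x - g z - b * (x - z)) <= e / 2 * cabs (x - z).
  have /ler_wpM2l/(_ _ _ hs) : 0 <= cabs a + 1 by lra.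
  have -> : (cabs a + 1) * (e / (cabs a + 1) / 2 * cabs (x - z)) = e / 2 * cabs (x - z).
    by field; lra.
  have := cabs_ge0 (g x - g z - b * (x - z)); lra.
lra.
Qed.

Lemma cdiff_ext f g z a r : 0 < r -> (forall x, cabs (x - z) < r -> f x = g x) ->
  cdiff f z a -> cdiff g z a.
Proof.
move=> r0 fg hf e e0; have [s s0 hs] := hf _ e0.
exists (Num.min r s); first by rewrite lt_min r0.
move=> x; rewrite lt_min => /andP[xr /hs].
by rewrite !fg ?subrr ?cabs0.
Qed.

Lemma cdiff_sqr z : cdiff (fun x => x * x) z (2 * z).
Proof.
move=> e e0; exists e => // x xe.
have -> : x * x - z * z - 2 * z * (x - z) = (x - z) * (x - z) by ring.
by rewrite cabsM; apply: ler_wpM2r; rewrite ?cabs_ge0// ltW.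
Qed.

(* Polarisation reduces products to squares. *)
Lemma cdiffM f g z a b : cdiff f z a -> cdiff g z b ->
  cdiff (fun x => f x * g x) z (a * g z + f z * b).
Proof.
move=> hf hg.
have h1 := cdiff_comp (cdiffD hf hg) (@cdiff_sqr _).
have h2 := cdiff_comp (cdiffB hf hg) (@cdiff_sqr _).
have := cdiff_mull (4^-1) (cdiffB h1 h2).
set d := (X in cdiff _ _ X); have -> : d = a * g z + f z * b by rewrite /d; field.
by apply: (cdiff_ext ltr01) => x _ /=; field.
Qed.

Lemma cdiff_inv z : z != 0 -> cdiff (fun x => x^-1) z (- (z^-1 * z^-1)).
Proof.
move=> z0 e e0; have nz : 0 < cabs z by rewrite cabs_gt0.
(* The first bound keeps |x| above |z|/2; the second then makes the remainder (x-z)^2 / (x z^2) at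
   most e|x-z|. *)
exists (Num.min (cabs z / 2) (e * cabs z ^+ 3 / 2)).
  by rewrite lt_min !divr_gt0// mulr_gt0// exprn_gt0.
move=> x; rewrite lt_min => /andP[x1 x2].
have hx : cabs z / 2 < cabs x.
  by have := cabs_tri x z 0; rewrite !subr0 cabs_dist; lra.
have x0 : x != 0 by rewrite -cabs_gt0; lra.
have -> : x^-1 - z^-1 - (- (z^-1 * z^-1)) * (x - z) =
   (x - z) * ((x - z) / (x * z ^+ 2)) by field; rewrite ?x0 ?z0.
rewrite cabsM mulrC; apply: ler_wpM2r; first exact: cabs_ge0.
rewrite cabsM cabsV cabsM cabsX ler_pdivrMr; last first.
  by rewrite mulr_gt0 ?exprn_gt0//; lra.
apply: le_trans (ltW x2) _.
have -> : e * cabs z ^+ 3 / 2 = e * (cabs z / 2 * cabs z ^+ 2) by field.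
apply: ler_wpM2l; first exact: ltW.
by apply: ler_wpM2r; [rewrite exprn_ge0 ?cabs_ge0|exact: ltW].
Qed.

Lemma cdiffV f z a : cdiff f z a -> f z != 0 ->
  exists d, cdiff (fun x => (f x)^-1) z d.
Proof. move=> hf fz0; eexists; exact: (cdiff_comp hf (cdiff_inv fz0)). Qed.

Lemma cdiffX f z a n : cdiff f z a -> exists d, cdiff (fun x => f x ^+ n) z d.
Proof.
move=> hf; elim: n => [|n [d IH]]; first by exists 0; exact: cdiff_cst.
eexists; have := cdiffM hf IH; apply: (cdiff_ext ltr01) => x _.
by rewrite exprS.
Qed.

Lemma cdiff_uniq f z a b : cdiff f z a -> cdiff f z b -> a = b.
Proof.
move=> ha hb; apply/eqP; rewrite -subr_eq0 -cabs_eq0; apply/negPn/negP => ab.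
have ab0 : 0 < cabs (a - b) by rewrite lt_def ab cabs_ge0.
have e0 : 0 < cabs (a - b) / 3 by lra.
have [r r0 hr] := ha _ e0; have [s s0 hs] := hb _ e0.
pose t := Num.min r s / 2.
have t0 : 0 < t by rewrite divr_gt0// lt_min r0.
have [tr ts] : t < r /\ t < s.
  by rewrite /t; split; case: (leP r s) => ?; lra.
have E : cabs (z + rc t - z) = t by rewrite addrC addKr cabs_rc gtr0_norm.
have {}hr := hr (z + rc t); have {}hs := hs (z + rc t).
move: hr hs; rewrite E => /(_ tr) hr /(_ ts) hs.
have : cabs ((b - a) * (z + rc t - z)) <= 2 * (cabs (a - b) / 3 * t).
  rewrite (_ : (b - a) * _ = (f (z + rc t) - f z - a * (z + rc t - z)) -
    (f (z + rc t) - f z - b * (z + rc t - z))); last by ring.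
  by apply: le_trans (cabsB _ _) _; lra.
rewrite cabsM E cabs_dist; nra.
Qed.

End Topology.

(** * Compactness *)

Section Compactness.
Variable R : realType.
Local Notation C := (Cplx R).

(** The side [s] is complex: the square has sides [s] and [ic * s], so that replacing [s] by
    [ic * s] rotates it by a quarter turn about its corner [a]. *)
Definition sqpt (a s : C) (p : R * R) : C := a + s * (rc p.1 + ic * rc p.2).
Definition unitsq : set (R * R) := `[0, 1]%classic `*` `[0, 1]%classic.
Definition square (a s : C) : set C := sqpt a s @` unitsq.

Lemma sqpt_cont (a s : C) : continuous (sqpt a s).
Proof.
move=> [u v] U /nbhs_cabs[r r0 sub].
have s1 : 0 < cabs s + 1 by have := cabs_ge0 s; lra.
have e0 : 0 < r / (cabs s + 1) / 2 by rewrite !divr_gt0.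
exists (ball u (r / (cabs s + 1) / 2), ball v (r / (cabs s + 1) / 2)) => /=.
  by split; exact: nbhsx_ballx.
move=> [x y] [/= hx hy]; apply: sub; rewrite /sqpt /=.
move: hx hy; rewrite -!ball_normE /= => hx hy.
have -> : a + s * (rc x + ic * rc y) - (a + s * (rc u + ic * rc v)) =
  s * (rc (x - u) + ic * rc (y - v)) by rewrite !rcB; ring.
rewrite cabsM.
have : cabs (rc (x - u) + ic * rc (y - v)) < r / (cabs s + 1).
  apply: le_lt_trans (cabsD _ _) _; rewrite cabsM cabs_ic mul1r !cabs_rc.
  by rewrite distrC (distrC y); lra.
rewrite ltr_pdivlMr// => h; apply: le_lt_trans h.
by rewrite mulrC; apply: ler_wpM2l; rewrite ?cabs_ge0//; lra.
Qed.

Lemma square_compact (a s : C) : compact (square a s).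
Proof.
apply: continuous_compact; last by apply: compact_setX; exact: segment_compact.
by apply: continuous_subspaceT => x; exact: sqpt_cont.
Qed.

(** A bounded set lies in a square, and a square is compact as a continuous image of [0,1]^2. *)
Lemma closed_bounded_compact (K : set C) (M : R) :
  closed K -> (forall z, K z -> cabs z <= M) -> compact K.
Proof.
move=> cK bK; pose M1 := `|M| + 1.
have M0 : 0 < M1 by rewrite /M1; have := normr_ge0 M; lra.
have sc := @square_compact (- (rc M1 + ic * rc M1)) (rc (2 * M1)).
apply: (subclosed_compact cK sc).
move=> z /bK zM.
have zM1 : cabs z <= M1 by have := ler_norm M; rewrite /M1; lra.
have := ReE_le z; have := ImE_le z; rewrite !ler_norml => /andP[i1 i2] /andP[r1 r2].
exists ((complex.Re z + M1) / (2 * M1), (complex.Im z + M1) / (2 * M1)).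
  split; rewrite /= in_itv /=; apply/andP; split.
  - by apply: divr_ge0; lra.
  - by rewrite ler_pdivrMr; lra.
  - by apply: divr_ge0; lra.
  - by rewrite ler_pdivrMr; lra.
have zE : z = rc (complex.Re z) + ic * rc (complex.Im z) by exact: complexE.
have M2 : 0 < 2 * M1 by lra.
rewrite [RHS]zE /sqpt /= mulrDr.
rewrite [rc (2 * M1) * (ic * _)]mulrCA -!rcM !(mulrC (2 * M1)) !divfK ?gt_eqF//.
by rewrite !rcD; ring.
Qed.

(** The form in which compactness is used throughout: a locally uniform constant, stable under
    shrinking, becomes uniform. The covering property is applied to the right neighbourhoods of 0,
    with no explicit finite subcover. *)
Lemma compact_uniform (K : set C) (P : C -> R -> Prop) : compact K ->
  (forall z r s, 0 < s -> s <= r -> P z r -> P z s) ->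
  (forall z, K z -> exists r s : R, [/\ 0 < r, 0 < s &
     forall x, cabs (x - z) < s -> P x r]) ->
  exists2 r : R, 0 < r & forall z, K z -> P z r.
Proof.
move=> /compact_near_coveringP cK mono loc.
have [|d /= d0 hd] := cK R 0^'+ (fun r x => P x r) _ _.
  move=> z Kz; have [r [s [r0 s0 h]]] := loc z Kz.
  exists ([set x | cabs (x - z) < s], [set t | 0 < t <= r]) => /=.
    split; first by apply/nbhs_cabs; exists s.
    exists r => //= t /=; rewrite sub0r normrN => tr t0; rewrite t0 /=.
    by apply: ltW; move: tr; rewrite gtr0_norm.
  by move=> [x t] [/= /h hx /andP[t0 tr]]; exact: mono hx.
exists (d / 2); first by lra.
move=> z Kz; apply: (hd (d / 2)) => //=; last by lra.
by rewrite /= sub0r normrN gtr0_norm; lra.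
Qed.

Lemma compact_lebesgue (K U : set C) : compact K -> open U -> K `<=` U ->
  exists2 r : R, 0 < r & forall z, K z -> forall x, cabs (x - z) < r -> U x.
Proof.
move=> cK /open_cabs oU KU.
apply: (@compact_uniform K (fun z r => forall x, cabs (x - z) < r -> U x)) => //.
  by move=> z r s s0 sr h x xs; apply: h; exact: lt_le_trans sr.
move=> z /KU/oU[r r0 hr]; exists (r / 2), (r / 2); split; [lra|lra|].
move=> x xz y yx; apply: hr; have := cabs_tri x y z; lra.
Qed.

Lemma compact_closed (K : set C) : compact K -> closed K.
Proof. by apply: compact_closed; exact: norm_hausdorff. Qed.

Lemma ccont_min (K : set C) (f : C -> C) : compact K ->
  (forall z, K z -> ccont f z) -> (forall z, K z -> f z != 0) ->
  exists2 r : R, 0 < r & forall z, K z -> r <= cabs (f z).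
Proof.
move=> cK cf f0.
have [||r r0 h] := @compact_uniform K (fun z r => r <= cabs (f z)) cK.
- by move=> z r s _ sr h; exact: le_trans h.
- move=> z Kz; have fz0 : 0 < cabs (f z) by rewrite cabs_gt0 f0.
  have e0 : 0 < cabs (f z) / 2 by lra.
  have [d d0 hd] := cf z Kz _ e0.
  exists (cabs (f z) / 2), d; split=> // x /hd.
  by have := cabs_tri (f x) (f z) 0; rewrite !subr0 cabs_dist; lra.
by exists r.
Qed.

Lemma ccont_bound (K : set C) (f : C -> C) : compact K ->
  (forall z, K z -> ccont f z) ->
  exists2 M : R, 0 < M & forall z, K z -> cabs (f z) <= M.
Proof.
move=> cK cf.
(* An upper bound is written as [r^-1] because [compact_uniform] shrinks its constant; the same
   device recurs for all uniform upper bounds. *)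
have [||r r0 h] := @compact_uniform K (fun z r => cabs (f z) <= r^-1) cK.
- move=> z r s s0 sr h; apply: (le_trans h).
  by rewrite lef_pV2// posrE; exact: lt_le_trans sr.
- move=> z Kz; have fz0 : 0 < cabs (f z) + 1 by have := cabs_ge0 (f z); lra.
  have [d d0 hd] := cf z Kz _ ltr01.
  exists ((cabs (f z) + 1)^-1), d; split=> //; first by rewrite invr_gt0.
  move=> x /hd; rewrite invrK.
  by have := cabs_tri (f z) (f x) 0; rewrite !subr0; lra.
by exists r^-1; rewrite ?invr_gt0.
Qed.

Lemma annulus_compact (c : C) (h1 h2 : R) :
  compact [set z | h1 <= cabs (z - c) <= h2].
Proof.
apply: (@closed_bounded_compact _ (h2 + cabs c)); last first.
  by move=> z /= /andP[_]; have := cabs_tri c z 0; rewrite !subr0; lra.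
move=> z /closure_cabs cl /=; apply/andP; split; apply/ler_addgt0Pr => e e0.
  have [y /= /andP[y1 y2] ye] := cl _ e0; have := cabs_tri z y c; lra.
have [y /= /andP[y1 y2] ye] := cl _ e0; have := cabs_tri y z c.
by rewrite (cabs_dist z y); lra.
Qed.

Lemma geometric_small (l c e : R) : 0 <= l < 1 -> 0 < e ->
  exists n0 : nat, forall n, (n0 <= n)%N -> c * l ^+ n < e.
Proof.
move=> /andP[l0 l1] e0; have c1 : 0 < `|c| + 1 by have := normr_ge0 c; lra.
have /cvg_expr/cvgrPdist_lt/(_ (e / (`|c| + 1)) (divr_gt0 e0 c1)) : `|l| < 1.
  by rewrite ger0_norm.
move=> [n0 _ h]; exists n0 => n /h /=.
rewrite sub0r normrN ger0_norm ?exprn_ge0// ltr_pdivlMr// => {}h.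
have := ler_norm c; have := exprn_ge0 n l0; nra.
Qed.

End Compactness.

(** * Goursat's lemma for trapezoidal sums *)

Section Goursat.
Variable R : realType.
Local Notation C := (Cplx R).
Implicit Types (f g : C -> C) (a b s : C).

(** The trapezoidal sum of f over 2^k equal pieces of [a,b]. Bisection is built into the definition,
    so that cutting a segment in halves is an exact identity and no limit is ever taken. *)
Fixpoint trap (k : nat) f a b : C :=
  if k is k'.+1 then trap k' f a ((a + b) / 2) + trap k' f ((a + b) / 2) b
  else (f a + f b) / 2 * (b - a).

Lemma trap_rev k f a b : trap k f b a = - trap k f a b.
Proof.
elim: k a b => [|k IH] a b /=; first by field.
by rewrite (addrC b a) (IH ((a + b) / 2) b) (IH a ((a + b) / 2)) opprD addrC.
Qed.

Lemma trapB k f g a b : trap k (fun x => f x - g x) a b = trap k f a b - trap k g a b.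
Proof. by elim: k a b => [|k IH] a b /=; [field | rewrite !IH; ring]. Qed.

Lemma trap_mull k f c a b : trap k (fun x => c * f x) a b = c * trap k f a b.
Proof. by elim: k a b => [|k IH] a b /=; [field | rewrite !IH; ring]. Qed.

(** The trapezoidal rule is exact on affine functions; this stands in for their primitive and makes
    their closed contour sums vanish. *)
Lemma trap_affine k p q a b :
  trap k (fun x => p + q * x) a b = p * (b - a) + q * (b * b - a * a) / 2.
Proof. by elim: k a b => [|k IH] a b /=; [field | rewrite !IH; field]. Qed.

Definition segt a b : set C := [set x | exists2 t : R, 0 <= t <= 1 & x = a + rc t * (b - a)].

Lemma rc_half : rc (2^-1 : R) = 2^-1 :> C.
Proof. by rewrite /rc fmorphV rmorph_nat. Qed.

Lemma segt_left a b x : segt a ((a + b) / 2) x -> segt a b x.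
Proof.
move=> [t /andP[t0 t1] ->]; exists (t * 2^-1); first by apply/andP; split; lra.
by rewrite rcM rc_half; field.
Qed.

Lemma segt_right a b x : segt ((a + b) / 2) b x -> segt a b x.
Proof.
move=> [t /andP[t0 t1] ->]; exists (2^-1 + t * 2^-1); first by apply/andP; split; lra.
by rewrite rcD rcM rc_half; field.
Qed.

Lemma segtl a b : segt a b a.
Proof. by exists 0; [rewrite lexx ler01|rewrite rc0; ring]. Qed.

Lemma segtr a b : segt a b b.
Proof. by exists 1; [rewrite lexx ler01|rewrite rc1; ring]. Qed.

Lemma cabs2 : cabs (2 : C) = 2. Proof. exact: cabs_nat. Qed.

Lemma trap_bound k f a b (M : R) : (forall x, segt a b x -> cabs (f x) <= M) ->
  cabs (trap k f a b) <= M * cabs (b - a).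
Proof.
elim: k a b => [|k IH] a b hM /=.
  rewrite cabsM; apply: ler_wpM2r; first exact: cabs_ge0.
  rewrite cabsM cabsV cabs2 ler_pdivrMr//.
  apply: le_trans (cabsD _ _) _.
  have := hM _ (segtl a b); have := hM _ (segtr a b); lra.
apply: le_trans (cabsD _ _) _.
have h1 := IH a ((a + b) / 2) (fun x hx => hM x (segt_left hx)).
have h2 := IH ((a + b) / 2) b (fun x hx => hM x (segt_right hx)).
have e1 : cabs ((a + b) / 2 - a) = cabs (b - a) / 2.
  by rewrite (_ : _ - a = (b - a) / 2) ?cabsM ?cabsV ?cabs2//; field.
have e2 : cabs (b - (a + b) / 2) = cabs (b - a) / 2.
  by rewrite (_ : b - _ = (b - a) / 2) ?cabsM ?cabsV ?cabs2//; field.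
move: h1 h2; rewrite e1 e2; lra.
Qed.

Lemma trap_ext k f g a b : (forall x, segt a b x -> f x = g x) ->
  trap k f a b = trap k g a b.
Proof.
move=> fg; apply/eqP; rewrite -subr_eq0 -trapB -cabs_eq0 eq_le cabs_ge0 andbT.
rewrite -[leRHS](mul0r (cabs (b - a))); apply: trap_bound => x /fg ->.
by rewrite subrr cabs0.
Qed.

Definition contour k f a s : C :=
  trap k f a (a + s) + trap k f (a + s) (a + s + ic * s) +
  trap k f (a + s + ic * s) (a + ic * s) + trap k f (a + ic * s) a.

Lemma contourB k f g a s :
  contour k (fun x => f x - g x) a s = contour k f a s - contour k g a s.
Proof. by rewrite /contour !trapB; ring. Qed.

Lemma contour_affine k p q a s : contour k (fun x => p + q * x) a s = 0.
Proof. by rewrite /contour !trap_affine; field. Qed.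

(** Each inner side is run through twice, in opposite directions, and cancels by [trap_rev]; the
    halved outer sides account for the index [k.+1]. *)
Lemma contour_split k f a s : contour k.+1 f a s =
  contour k f a (s / 2) + contour k f (a + s / 2) (s / 2) +
  contour k f (a + ic * s / 2) (s / 2) + contour k f (a + s / 2 + ic * s / 2) (s / 2).
Proof.
rewrite /contour /=.
have -> : (a + (a + s)) / 2 = a + s / 2 by field.
have -> : (a + s + (a + s + ic * s)) / 2 = a + s + ic * s / 2 by field.
have -> : (a + s + ic * s + (a + ic * s)) / 2 = a + s / 2 + ic * s by field.
have -> : (a + ic * s + a) / 2 = a + ic * s / 2 by field.
have -> : ic * (s / 2) = ic * s / 2 by field.
have -> : a + s / 2 + s / 2 = a + s by field.
have -> : a + ic * s / 2 + s / 2 = a + s / 2 + ic * s / 2 by ring.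
have -> : a + s / 2 + ic * s / 2 + s / 2 = a + s + ic * s / 2 by field.
have -> : a + s / 2 + ic * s / 2 + ic * s / 2 = a + s / 2 + ic * s by field.
have -> : a + s + ic * s / 2 + ic * s / 2 = a + s + ic * s by field.
have -> : a + ic * s / 2 + ic * s / 2 = a + ic * s by field.
rewrite (trap_rev k f (a + s / 2) (a + s / 2 + ic * s / 2)).
rewrite (trap_rev k f (a + s / 2 + ic * s / 2) (a + ic * s / 2)).
rewrite (trap_rev k f (a + s + ic * s / 2) (a + s / 2 + ic * s / 2)).
rewrite (trap_rev k f (a + s / 2 + ic * s / 2) (a + s / 2 + ic * s)).
ring.
Qed.

Lemma square_cornerP a s x : square a s x <->
  exists u v : R, [/\ 0 <= u <= 1, 0 <= v <= 1 & x = a + s * (rc u + ic * rc v)].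
Proof.
split; first by move=> [[u v] [/=]]; rewrite !in_itv /= => hu hv <-; exists u, v.
by move=> [u [v [hu hv ->]]]; exists (u, v).
Qed.

Lemma contour_segt a s :
  [/\ segt a (a + s) `<=` square a s,
      segt (a + s) (a + s + ic * s) `<=` square a s,
      segt (a + s + ic * s) (a + ic * s) `<=` square a s &
      segt (a + ic * s) a `<=` square a s].
Proof.
split=> x [t /andP[t0 t1] ->]; apply/square_cornerP.
- exists t, 0; rewrite rc0 lexx ler01 t0 t1; split=> //; ring.
- exists 1, t; rewrite rc1 lexx ler01 t0 t1; split=> //; ring.
- exists (1 - t), 1; rewrite rcB !rc1 lexx ler01; split=> //; last by ring.
  by apply/andP; split; lra.
- exists 0, (1 - t); rewrite rcB rc1 rc0 lexx ler01; split=> //; last by ring.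
  by apply/andP; split; lra.
Qed.

Lemma contour_bound k f a s (M : R) : (forall x, square a s x -> cabs (f x) <= M) ->
  cabs (contour k f a s) <= 4 * M * cabs s.
Proof.
move=> hM; have [h1 h2 h3 h4] := contour_segt a s.
have b1 := trap_bound k (fun x hx => hM x (h1 x hx)).
have b2 := trap_bound k (fun x hx => hM x (h2 x hx)).
have b3 := trap_bound k (fun x hx => hM x (h3 x hx)).
have b4 := trap_bound k (fun x hx => hM x (h4 x hx)).
have e1 : cabs (a + s - a) = cabs s by congr cabs; ring.
have e2 : cabs (a + s + ic * s - (a + s)) = cabs s.
  by rewrite (_ : _ - _ = ic * s) ?cabsM ?cabs_ic ?mul1r//; ring.
have e3 : cabs (a + ic * s - (a + s + ic * s)) = cabs s.
  by rewrite -cabsN; congr cabs; ring.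
have e4 : cabs (a - (a + ic * s)) = cabs s.
  by rewrite -cabsN (_ : - _ = ic * s) ?cabsM ?cabs_ic ?mul1r//; ring.
move: b1 b2 b3 b4; rewrite e1 e2 e3 e4 /contour => b1 b2 b3 b4.
apply: le_trans (cabsD _ _) _; rewrite [leRHS](_ : _ = 3 * (M * cabs s) + M * cabs s); last by ring.
apply: lerD => //; apply: le_trans (cabsD _ _) _.
rewrite [leRHS](_ : _ = 2 * (M * cabs s) + M * cabs s); last by ring.
apply: lerD => //; apply: le_trans (cabsD _ _) _; lra.
Qed.

Lemma square_dist a s x y : square a s x -> square a s y -> cabs (x - y) <= 2 * cabs s.
Proof.
move=> /square_cornerP[u [v [/andP[u0 u1] /andP[v0 v1] ->]]].
move=> /square_cornerP[u' [v' [/andP[u0' u1'] /andP[v0' v1'] ->]]].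
rewrite (_ : _ - _ = s * (rc (u - u') + ic * rc (v - v'))); last by rewrite !rcB; ring.
rewrite cabsM mulrC; apply: ler_wpM2r; first exact: cabs_ge0.
apply: le_trans (cabsD _ _) _; rewrite cabsM cabs_ic mul1r !cabs_rc.
have : `|u - u'| <= 1 by rewrite ler_norml; apply/andP; split; lra.
have : `|v - v'| <= 1 by rewrite ler_norml; apply/andP; split; lra.
lra.
Qed.

Lemma square_corner a s : square a s a.
Proof. by apply/square_cornerP; exists 0, 0; rewrite rc0 lexx ler01; split=> //; ring. Qed.

Lemma square_child a s (i j : R) : 0 <= i <= 1 -> 0 <= j <= 1 ->
  square (a + rc i * s / 2 + rc j * (ic * s / 2)) (s / 2) `<=` square a s.
Proof.
move=> /andP[i0 i1] /andP[j0 j1] x /square_cornerP[u [v [/andP[u0 u1] /andP[v0 v1] ->]]].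
apply/square_cornerP; exists (2^-1 * (i + u)), (2^-1 * (j + v)); split.
- by apply/andP; split; lra.
- by apply/andP; split; lra.
by rewrite !rcM !rcD rc_half; field.
Qed.

Lemma children_sub a s :
  [/\ square a (s / 2) `<=` square a s,
      square (a + s / 2) (s / 2) `<=` square a s,
      square (a + ic * s / 2) (s / 2) `<=` square a s &
      square (a + s / 2 + ic * s / 2) (s / 2) `<=` square a s].
Proof.
have i0 : (0 : R) <= 0 <= (1 : R) by apply/andP; split; lra.
have i1 : (0 : R) <= 1 <= (1 : R) by apply/andP; split; lra.
split; [have := @square_child a s _ _ i0 i0|have := @square_child a s _ _ i1 i0|
  have := @square_child a s _ _ i0 i1|have := @square_child a s _ _ i1 i1];
  by rewrite ?rc0 ?rc1 ?mul0r ?mul1r ?addr0 ?mul0r ?addr0.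
Qed.

Lemma cabs_half s : cabs (s / 2) = cabs s / 2.
Proof. by rewrite cabsM cabsV cabs2. Qed.

(** If the four quarters satisfy the bound, so does the square, since 4 e (|s|/2)^2 = e |s|^2. A bad
    square thus yields nested bad squares shrinking to a point z, where subtracting the affine
    expansion at z leaves too small a sum. *)
Lemma goursat f a s : (forall x, square a s x -> exists d, cdiff f x d) ->
  forall e : R, 0 < e -> exists k0 : nat, forall k, (k0 <= k)%N ->
    cabs (contour k f a s) <= e * cabs s ^+ 2.
Proof.
move=> df e e0; apply: contrapT => bad_as.
pose bad (p : C * C) := ~ exists k0 : nat, forall k, (k0 <= k)%N ->
  cabs (contour k f p.1 p.2) <= e * cabs p.2 ^+ 2.
have step (p : C * C) : {q : C * C | bad p ->
   [/\ bad q, q.2 = p.2 / 2 & square q.1 q.2 `<=` square p.1 p.2]}.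
  apply: cid; case: p => b t.
  have [bp|] := pselect (bad (b, t)); last by exists (b, t).
  have [c1 c2 c3 c4] := children_sub b t.
  apply: contrapT => nq; apply: bp => /=.
  have good c : square c (t / 2) `<=` square b t ->
    exists k0 : nat, forall k, (k0 <= k)%N ->
    cabs (contour k f c (t / 2)) <= e * cabs (t / 2) ^+ 2.
    move=> cs; apply: contrapT => bc; apply: nq; exists (c, t / 2) => _.
    by split.
  have [k1 h1] := good _ c1; have [k2 h2] := good _ c2.
  have [k3 h3] := good _ c3; have [k4 h4] := good _ c4.
  exists (maxn (maxn k1 k2) (maxn k3 k4)).+1 => -[//|k]; rewrite ltnS !geq_max.
  move=> /andP[/andP[/h1 {}h1 /h2 {}h2] /andP[/h3 {}h3 /h4 {}h4]].
  rewrite contour_split; move: h1 h2 h3 h4; rewrite cabs_half => h1 h2 h3 h4.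
  apply: le_trans (cabsD _ _) _; rewrite [leRHS](_ : _ = 3 * (e * (cabs t / 2) ^+ 2) +
    e * (cabs t / 2) ^+ 2); last by field.
  apply: lerD => //; apply: le_trans (cabsD _ _) _.
  rewrite [leRHS](_ : _ = 2 * (e * (cabs t / 2) ^+ 2) +
    e * (cabs t / 2) ^+ 2); last by field.
  by apply: lerD => //; apply: le_trans (cabsD _ _) _; lra.
pose u n := iter n (fun p => sval (step p)) (a, s).
have u0 : u 0%N = (a, s) by [].
have hu n : bad (u n) -> [/\ bad (u n.+1), (u n.+1).2 = (u n).2 / 2 &
  square (u n.+1).1 (u n.+1).2 `<=` square (u n).1 (u n).2] := svalP (step (u n)).
have ubad n : bad (u n).
  by elim: n => [|n /hu[]//]; rewrite u0.
have usz n : cabs (u n).2 = cabs s / 2 ^+ n.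
  elim: n => [|n IH]; first by rewrite u0 expr0 divr1.
  have [_ -> _] := hu _ (ubad n).
  by rewrite cabs_half IH exprS invfM; ring.
have usub n m : (n <= m)%N -> square (u m).1 (u m).2 `<=` square (u n).1 (u n).2.
  elim: m => [|m IH]; first by rewrite leqn0 => /eqP->.
  rewrite leq_eqVlt ltnS => /orP[/eqP->//|/IH{}IH].
  by have [_ _ h] := hu _ (ubad m); exact: subset_trans IH.
have [|z [_ cz]] := @square_compact _ a s ((fun n => (u n).1) @ \oo) _.
  exists 0%N => // n _ /=; have := usub 0%N n (leq0n _); rewrite u0 /=.
  by apply; exact: square_corner.
have zu n : square (u n).1 (u n).2 z.
  have /closure_id -> := compact_closed (@square_compact _ (u n).1 (u n).2).
  move=> B Bz; apply: cz => //; exists n => // m /= nm.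
  by apply: (usub _ _ nm); exact: square_corner.
(* With side t, the remainder is at most (e/16)(2|t|) on the square and the perimeter is 4|t|, which
   gives e|t|^2/2. *)
have [d /(_ (e / 16))[|r r0 hr]] : exists d, cdiff f z d.
- by apply: df; have := zu 0%N; rewrite u0.
- by lra.
have [n hn] : exists n, 2 * (cabs s / 2 ^+ n) < r.
  have [||n hn] := @geometric_small R 2^-1 (2 * cabs s) r; [by lra|by []|].
  by exists n; have := hn n (leqnn n); rewrite exprVn mulrA.
apply: (ubad n); exists 0%N => k _.
set b := (u n).1; set t := (u n).2; have ct : cabs t = _ := usz n.
rewrite (_ : contour k f b t = contour k (fun x => f x - ((f z - d * z) + d * x)) b t); last first.
  by rewrite contourB contour_affine subr0.
apply: le_trans (@contour_bound _ _ _ _ (e / 16 * (2 * cabs t)) _) _; last first.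
  by rewrite expr2; have := cabs_ge0 t; nra.
move=> x bx.
have xz := square_dist bx (zu n); rewrite -/t in xz.
have {hr} := hr x; rewrite (_ : _ - (_ + _) = f x - f z - d * (x - z)); last by ring.
move=> /(_ _) hr; apply: (le_trans (hr _)); last by apply: ler_wpM2l => //; lra.
by apply: (le_lt_trans xz); rewrite ct.
Qed.
End Goursat.

(** * The maximum principle *)

Section MaximumPrinciple.
Variable R : realType.
Local Notation C := (Cplx R).
Implicit Types (f F : C -> C) (a b c s : C).

Lemma Im_add (x y : C) : complex.Im (x + y) = complex.Im x + complex.Im y.
Proof. by case: x => ? ?; case: y. Qed.
Lemma Im_rcM (x : R) (z : C) : complex.Im (rc x * z) = x * complex.Im z.
Proof. by case: z => ? ? /=; rewrite mul0r addr0. Qed.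
Lemma Re_cart (u v : R) : complex.Re (rc u + ic * rc v : C) = u.
Proof. by rewrite /= !(mul0r, mulr0, mul1r, subr0, addr0). Qed.
Lemma Im_cart (u v : R) : complex.Im (rc u + ic * rc v : C) = v.
Proof. by rewrite /= !(mul0r, mulr0, mul1r, add0r, addr0). Qed.

Lemma cart_neq0 (u v : R) : u != 0 \/ v != 0 -> rc u + ic * rc v != 0 :> C.
Proof.
move=> uv; apply/eqP => E.
have u0 : u = 0 by rewrite -(Re_cart u v) E.
have v0 : v = 0 by rewrite -(Im_cart u v) E.
by case: uv; rewrite ?u0 ?v0 eqxx.
Qed.

Lemma trap_Im k f a b (m : R) :
  (forall x, segt a b x -> m <= complex.Im (f x * (b - a))) ->
  m <= complex.Im (trap k f a b).
Proof.
elim: k a b m => [|k IH] a b m hm /=.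
  rewrite (_ : _ * _ = rc 2^-1 * (f a * (b - a)) + rc 2^-1 * (f b * (b - a))); last first.
    by rewrite rc_half; field.
  rewrite Im_add !Im_rcM.
  have := hm _ (segtl a b); have := hm _ (segtr a b); lra.
rewrite Im_add.
have h1 : m / 2 <= complex.Im (trap k f a ((a + b) / 2)).
  apply: IH => x /segt_left/hm.
  rewrite (_ : (a + b) / 2 - a = rc 2^-1 * (b - a)); last by rewrite rc_half; field.
  by rewrite mulrCA Im_rcM; lra.
have h2 : m / 2 <= complex.Im (trap k f ((a + b) / 2) b).
  apply: IH => x /segt_right/hm.
  rewrite (_ : b - (a + b) / 2 = rc 2^-1 * (b - a)); last by rewrite rc_half; field.
  by rewrite mulrCA Im_rcM; lra.
lra.
Qed.

(** Subdivide towards the bad corner: [goursat] covers the three quarters away from it, and after n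
    steps the corner square contributes at most 4M|s|/2^n. *)
Lemma contour_corner f a s (M : R) :
  (forall x, square a s x -> cabs (f x) <= M) ->
  (forall x, square a s x -> x != a -> exists d, cdiff f x d) ->
  forall e : R, 0 < e -> exists k0 : nat, forall k, (k0 <= k)%N ->
    cabs (contour k f a s) <= e.
Proof.
move=> hM df e e0.
have M0 : 0 <= M by apply: le_trans (hM _ (square_corner a s)); exact: cabs_ge0.
have [->|s0] := eqVneq s 0.
  by exists 0%N => k _; apply: le_trans (@contour_bound _ k f a 0 M _) _;
    rewrite ?cabs0 ?mulr0 ?ltW// => x /square_cornerP[u [v [_ _ ->]]];
    rewrite mul0r addr0; apply: hM; exact: square_corner.
have main n : forall s e, s != 0 -> 0 < e ->
    (forall x, square a s x -> cabs (f x) <= M) ->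
    (forall x, square a s x -> x != a -> exists d, cdiff f x d) ->
    exists k0 : nat, forall k, (k0 <= k)%N ->
    cabs (contour k f a s) <= e + 4 * M * cabs s * 2^-1 ^+ n.
  elim: n => [|n IH] {}s {}e {}s0 {}e0 {}hM {}df.
    exists 0%N => k _; rewrite expr0 mulr1; apply: le_trans (contour_bound _ hM) _; lra.
  have [c1 c2 c3 c4] := children_sub a s.
  have s2 : s / 2 != 0 by rewrite mulf_neq0// invr_eq0 pnatr_eq0.
  have e4 : 0 < e / 4 by lra.
  have [k1 h1] := IH (s / 2) (e / 4) s2 e4 (fun x h => hM x (c1 x h)) (fun x h => df x (c1 x h)).
  have cs0 : 0 < cabs (s / 2) by rewrite cabs_gt0.
  have es0 : 0 < e / 4 / cabs (s / 2) ^+ 2 by rewrite !divr_gt0 ?exprn_gt0.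
  have [k2 h2] : exists k0 : nat, forall k, (k0 <= k)%N ->
    cabs (contour k f (a + s / 2) (s / 2)) <= e / 4 / cabs (s / 2) ^+ 2 * cabs (s / 2) ^+ 2.
    apply: goursat => // x xs; apply: df; first exact: c2.
    case/square_cornerP: xs => u [v [/andP[u0 u1] _ ->]].
    rewrite -subr_eq0 (_ : _ - a = s / 2 * (rc (1 + u) + ic * rc v)); last first.
      by rewrite rcD rc1; ring.
    by apply: mulf_neq0 => //; apply: cart_neq0; left; rewrite gt_eqF//; lra.
  have [k3 h3] : exists k0 : nat, forall k, (k0 <= k)%N ->
    cabs (contour k f (a + ic * s / 2) (s / 2)) <= e / 4 / cabs (s / 2) ^+ 2 * cabs (s / 2) ^+ 2.
    apply: goursat => // x xs; apply: df; first exact: c3.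
    case/square_cornerP: xs => u [v [_ /andP[v0 v1] ->]].
    rewrite -subr_eq0 (_ : _ - a = s / 2 * (rc u + ic * rc (1 + v))); last first.
      by rewrite rcD rc1; ring.
    by apply: mulf_neq0 => //; apply: cart_neq0; right; rewrite gt_eqF//; lra.
  have [k4 h4] : exists k0 : nat, forall k, (k0 <= k)%N ->
    cabs (contour k f (a + s / 2 + ic * s / 2) (s / 2)) <= e / 4 / cabs (s / 2) ^+ 2 * cabs (s / 2) ^+ 2.
    apply: goursat => // x xs; apply: df; first exact: c4.
    case/square_cornerP: xs => u [v [/andP[u0 u1] _ ->]].
    rewrite -subr_eq0 (_ : _ - a = s / 2 * (rc (1 + u) + ic * rc (1 + v))); last first.
      by rewrite !rcD rc1; ring.
    by apply: mulf_neq0 => //; apply: cart_neq0; left; rewrite gt_eqF//; lra.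
  exists (maxn (maxn k1 k2) (maxn k3 k4)).+1 => -[//|k]; rewrite ltnS !geq_max.
  move=> /andP[/andP[/h1 {}h1 /h2 {}h2] /andP[/h3 {}h3 /h4 {}h4]].
  move: h2 h3 h4; rewrite divfK ?gt_eqF ?exprn_gt0// => h2 h3 h4.
  rewrite contour_split.
  apply: le_trans (cabsD _ _) _; apply: le_trans (lerD (cabsD _ _) h4) _.
  apply: le_trans (lerD (lerD (cabsD _ _) (lexx _)) (lexx _)) _.
  move: h1; rewrite cabs_half exprS.
  rewrite (_ : 4 * M * (cabs s / 2) * 2^-1 ^+ n = 4 * M * cabs s * (2^-1 * 2^-1 ^+ n)); last by ring.
  lra.
have e2 : 0 < e / 2 by lra.
have [|n hn] := @geometric_small R 2^-1 (4 * M * cabs s) (e / 2) _ e2.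
  by lra.
have [k0 h0] := main n s (e / 2) s0 e2 hM df.
exists k0 => k /h0; have := hn n (leqnn n); lra.
Qed.

(** The two sides that avoid the corner [c]. Four squares rotated about [c] form a large square
    centred at [c], whose boundary consists of their outer sides; this is [outerE]. *)
Definition outer k f c s : C :=
  trap k f (c + s) (c + s + ic * s) + trap k f (c + s + ic * s) (c + ic * s).

Lemma outerE k f c s : outer k f c s + outer k f c (ic * s) +
    outer k f c (- s) + outer k f c (- (ic * s)) =
  contour k f c s + contour k f c (ic * s) + contour k f c (- s) + contour k f c (- (ic * s)).
Proof.
rewrite /contour /outer.
have -> : ic * (ic * s) = - s by rewrite mulrA ic2 mulN1r.
have -> : ic * (- (ic * s)) = s by rewrite mulrN mulrA ic2 mulN1r opprK.
have -> : ic * (- s) = - (ic * s) by rewrite mulrN.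
rewrite (trap_rev k f c (c + s)) (trap_rev k f c (c + ic * s)).
rewrite (trap_rev k f c (c - s)) (trap_rev k f c (c - ic * s)).
ring.
Qed.

(** Scale invariance of dx/(x-c), exact for the discrete sums; hence the four quarter boundaries
    give the same value. *)
Lemma trap_inv k c s p q : s != 0 ->
  trap k (fun x => (x - c)^-1) (c + s * p) (c + s * q) = trap k (fun x => x^-1) p q.
Proof.
move=> s0; elim: k p q => [|k IH] p q /=.
  have E x : c + s * x - c = s * x by ring.
  rewrite !E !invfM; move: (p^-1) (q^-1) => ip iq; field; exact: s0.
have -> : (c + s * p + (c + s * q)) / 2 = c + s * ((p + q) / 2) by field.
by rewrite !IH.
Qed.

Lemma outer_inv k c s : s != 0 -> outer k (fun x => (x - c)^-1) c s =
  trap k (fun x => x^-1) 1 (1 + ic) + trap k (fun x => x^-1) (1 + ic) ic.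
Proof.
move=> s0; rewrite /outer.
have -> : c + s + ic * s = c + s * (1 + ic) by ring.
have -> : c + ic * s = c + s * ic by ring.
have -> : c + s = c + s * 1 by ring.
by rewrite !trap_inv.
Qed.

Lemma Im_div_cart (u v : R) : (u != 0 \/ v != 0) -> forall z : C,
  complex.Im ((rc u + ic * rc v : C)^-1 * z) =
  (u * complex.Im z - v * complex.Re z) / (u ^+ 2 + v ^+ 2).
Proof.
move=> uv z; have d0 : u ^+ 2 + v ^+ 2 != 0.
  by apply: contraT => /negPn; rewrite paddr_eq0 ?sqr_ge0// !sqrf_eq0; case: uv => /negPf->; rewrite ?andbF.
have -> : (rc u + ic * rc v : C)^-1 * z = rc (u ^+ 2 + v ^+ 2)^-1 * ((rc u - ic * rc v) * z).
  have E : rc (u ^+ 2 + v ^+ 2)^-1 = ((rc u + ic * rc v) * (rc u - ic * rc v))^-1.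
    rewrite (_ : (rc u + ic * rc v) * (rc u - ic * rc v) = rc u ^+ 2 - (ic * ic) * rc v ^+ 2); last by ring.
    by rewrite ic2 mulN1r opprK /rc fmorphV rmorphD !rmorphXn.
  rewrite E; field; apply/andP; split; last exact: cart_neq0.
  rewrite -mulrN -rmorphN; apply: cart_neq0; rewrite oppr_eq0; exact: uv.
rewrite Im_rcM mulrC; congr (_ / _).
by case: z => x y /=; ring.
Qed.

(** A discrete substitute for the quarter turn of dx/x, whose integral is i pi/2. On each of the two
    sides the imaginary part of the integrand is 1/(1+t^2) or the like, hence at least 1/2. *)
Lemma trap_inv_unit k : 1 <= complex.Im
  (trap k (fun x : C => x^-1) 1 (1 + ic) + trap k (fun x => x^-1) (1 + ic) ic).
Proof.
rewrite Im_add.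
have b1 : 2^-1 <= complex.Im (trap k (fun x : C => x^-1) 1 (1 + ic)).
  apply: trap_Im => x [t /andP[t0 t1] ->].
  have -> : 1 + rc t * (1 + ic - 1) = rc 1 + ic * rc t :> C by rewrite rc1; ring.
  have -> : 1 + ic - 1 = rc 0 + ic * rc 1 :> C by rewrite rc0 rc1; ring.
  rewrite Im_div_cart; last by left; rewrite oner_eq0.
  rewrite Re_cart Im_cart mulr1 mulr0 subr0 ler_pdivlMr; last by nra.
  by rewrite expr1n; nra.
have b2 : 2^-1 <= complex.Im (trap k (fun x : C => x^-1) (1 + ic) ic).
  apply: trap_Im => x [t /andP[t0 t1] ->].
  have -> : 1 + ic + rc t * (ic - (1 + ic)) = rc (1 - t) + ic * rc 1 :> C.
    by rewrite rcB rc1; ring.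
  have -> : ic - (1 + ic) = rc (- 1) + ic * rc 0 :> C.
    by rewrite rc0 /rc rmorphN1; ring.
  rewrite Im_div_cart; last by right; rewrite oner_eq0.
  rewrite Re_cart Im_cart mulr0 sub0r mulrN1 opprK ler_pdivlMr; last by nra.
  by rewrite expr1n; nra.
lra.
Qed.
End MaximumPrinciple.

Section MaximumPrinciple2.
Variable R : realType.
Local Notation C := (Cplx R).
Implicit Types (f F : C -> C) (a b c s : C).

Lemma cdiff_sub_cst f z d a : cdiff f z d -> cdiff (fun x => f x - a) z d.
Proof. by move=> hf; have := cdiffB hf (cdiff_cst a z); rewrite subr0. Qed.

Lemma cdiff_subr z a : cdiff (fun x : C => x - a) z 1.
Proof. exact: cdiff_sub_cst (@cdiff_id _ z). Qed.

Lemma cdiff_quot F z d a : cdiff F z d -> z != a ->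
  exists d', cdiff (fun x => (F x - F a) / (x - a)) z d'.
Proof.
move=> hF za; have z0 : z - a != 0 by rewrite subr_eq0.
have [d' hd'] := cdiffV (cdiff_subr z a) z0.
by eexists; exact: (cdiffM (cdiff_sub_cst (F a) hF) hd').
Qed.

(* Cauchy's formula with the wrong constant, by comparing the boundary sums of
   [(F x - F c) / (x - c)], which tend to 0, with those of [(x - c)^-1]. *)
Lemma cauchy_rough F c (h M : R) : 0 < h ->
  (forall x, cabs (x - c) <= 2 * h -> exists d, cdiff F x d) ->
  (forall x, h <= cabs (x - c) <= 2 * h -> cabs (F x) <= M) ->
  cabs (F c) <= 2 * M.
Proof.
move=> h0 dF hM.
pose s : C := rc h; have cs : cabs s = h by rewrite cabs_rc gtr0_norm.
have s0 : s != 0 by rewrite -cabs_gt0 cs.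
pose q x := (F x - F c) / (x - c).
have near_c (s' : C) : cabs s' = h -> forall x, square c s' x -> cabs (x - c) <= 2 * h.
  by move=> <- x xs; exact: square_dist xs (square_corner c s').
have [d0 hd0] : exists d, cdiff F c d by apply: dF; rewrite subrr cabs0; lra.
(* Near c the quotient is bounded by differentiability, elsewhere by compactness; at c itself
   division by 0 gives the value 0. *)
have [B hB] : exists B, forall x, cabs (x - c) <= 2 * h -> cabs (q x) <= B.
  have [r r0 hr] := cdiff_lip hd0.
  have [B B0 hB] := @ccont_bound R [set x | 0 <= cabs (x - c) <= 2 * h] (fun x => F x - F c)
    (@annulus_compact _ _ _ _)
    (fun z hz => cdiff_ccont (cdiff_sub_cst (F c) (svalP (cid (dF z (andP hz).2))))).
  exists (cabs d0 + 1 + B / r) => x xh.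
  have := cabs_ge0 d0; have := divr_ge0 (ltW B0) (ltW r0) => Br d00.
  have [->|xc] := eqVneq x c; first by rewrite /q !subrr mul0r cabs0; lra.
  have xc0 : 0 < cabs (x - c) by rewrite cabs_gt0 subr_eq0.
  rewrite /q cabsM cabsV ler_pdivrMr//.
  have [xr|rx] := ltP (cabs (x - c)) r.
    by have := hr x xr; nra.
  have := hB x; rewrite /= cabs_ge0 xh => /(_ isT) FB.
  rewrite mulrDl; apply: (le_trans FB).
  have : B <= B / r * cabs (x - c) by rewrite mulrAC ler_pdivlMr//; nra.
  by nra.
have small (s' : C) : cabs s' = h -> forall e : R, 0 < e -> exists k0 : nat,
    forall k, (k0 <= k)%N -> cabs (contour k q c s') <= e.
  move=> hs'; apply: (@contour_corner _ q c s' B) => x /(near_c _ hs') xc.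
    exact: hB.
  by move=> xc'; have [d hd] := dF x xc; exact: cdiff_quot hd xc'.
have cs2 : cabs (ic * s) = h by rewrite cabsM cabs_ic mul1r.
have cs3 : cabs (- s) = h by rewrite cabsN.
have cs4 : cabs (- (ic * s)) = h by rewrite cabsN.
apply/ler_addgt0Pr => e e0.
have [k1 h1] := small _ cs _ e0; have [k2 h2] := small _ cs2 _ e0.
have [k3 h3] := small _ cs3 _ e0; have [k4 h4] := small _ cs4 _ e0.
pose k := maxn (maxn k1 k2) (maxn k3 k4).
have {h1}h1 : cabs (contour k q c s) <= e by apply: h1; rewrite /k; lia.
have {h2}h2 : cabs (contour k q c (ic * s)) <= e by apply: h2; rewrite /k; lia.
have {h3}h3 : cabs (contour k q c (- s)) <= e by apply: h3; rewrite /k; lia.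
have {h4}h4 : cabs (contour k q c (- (ic * s))) <= e by apply: h4; rewrite /k; lia.
have outerq (s' : C) : s' != 0 -> outer k q c s' = outer k (fun x => F x / (x - c)) c s' -
    F c * (trap k (fun x => x^-1) 1 (1 + ic) + trap k (fun x => x^-1) (1 + ic) ic).
  move=> s'0; rewrite -(outer_inv k c s'0) /outer mulrDr -!trap_mull opprD addrACA -!trapB.
  by congr (_ + _); apply: trap_ext => x _; rewrite /q mulrBl.
have outer_le (s' : C) : cabs s' = h -> cabs (outer k (fun x => F x / (x - c)) c s') <= 2 * M.
  move=> hs'; have s'0 : s' != 0 by rewrite -cabs_gt0 hs'.
  have bnd x (u v : R) : (1 <= `|u|) || (1 <= `|v|) -> `|u| <= 1 -> `|v| <= 1 ->
      x - c = s' * (rc u + ic * rc v) -> cabs (F x / (x - c)) <= M / h.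
    move=> uv1 u1 v1 E.
    have n1 : 1 <= cabs (rc u + ic * rc v : C).
      case/orP: uv1 => w1; apply: (le_trans w1).
        by rewrite -[X in `|X|](@Re_cart R u v); exact: ReE_le.
      by rewrite -[X in `|X|](@Im_cart R u v); exact: ImE_le.
    have n2 : cabs (rc u + ic * rc v : C) <= 2.
      by apply: le_trans (cabsD _ _) _; rewrite cabsM cabs_ic mul1r !cabs_rc; lra.
    have xc : cabs (x - c) = h * cabs (rc u + ic * rc v) by rewrite E cabsM hs'.
    have FM : cabs (F x) <= M by apply: hM; rewrite xc; apply/andP; split; nra.
    have hx : h <= cabs (x - c) by rewrite xc; nra.
    rewrite cabsM cabsV ler_pM ?cabs_ge0 ?invr_ge0 ?cabs_ge0// lef_pV2// posrE//.
    exact: lt_le_trans hx.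
  rewrite /outer; apply: le_trans (cabsD _ _) _.
  have b1 : cabs (trap k (fun x => F x / (x - c)) (c + s') (c + s' + ic * s')) <= M.
    apply: le_trans (@trap_bound _ _ _ _ _ (M / h) _) _.
      move=> x [t /andP[t0 t1] ->]; apply: (bnd _ 1 t).
      - by rewrite normr1 lexx.
      - by rewrite normr1.
      - by rewrite ger0_norm.
      by rewrite rc1; ring.
    rewrite (_ : c + s' + ic * s' - (c + s') = ic * s'); last by ring.
    by rewrite cabsM cabs_ic mul1r hs' divfK ?gt_eqF.
  have b2 : cabs (trap k (fun x => F x / (x - c)) (c + s' + ic * s') (c + ic * s')) <= M.
    apply: le_trans (@trap_bound _ _ _ _ _ (M / h) _) _.
      move=> x [t /andP[t0 t1] ->]; apply: (bnd _ (1 - t) 1).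
      - by rewrite normr1 lexx orbT.
      - by rewrite ger0_norm; lra.
      - by rewrite normr1.
      by rewrite rcB rc1; ring.
    rewrite (_ : c + ic * s' - (c + s' + ic * s') = - s'); last by ring.
    by rewrite cabsN hs' divfK ?gt_eqF.
  lra.
pose T : C := trap k (fun x => x^-1) 1 (1 + ic) + trap k (fun x => x^-1) (1 + ic) ic.
have T1 : 1 <= cabs T.
  by apply: le_trans (trap_inv_unit _ k) _; apply: le_trans (ler_norm _) _; exact: ImE_le.
have ne (s' : C) : cabs s' = h -> s' != 0 by move=> hs'; rewrite -cabs_gt0 hs'.
have E := outerE k q c s.
rewrite !outerq ?ne// -/T in E.
pose G := fun x => F x / (x - c).
have E' : 4 * F c * T = outer k G c s + outer k G c (ic * s) + outer k G c (- s) +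
  outer k G c (- (ic * s)) - (contour k q c s + contour k q c (ic * s) +
  contour k q c (- s) + contour k q c (- (ic * s))).
  by rewrite -E /G; ring.
(* Each of the four quarters has two outer sides of length h, on which |G| <= M/h; the four contours
   of [q] contribute at most e each. *)
have : cabs (4 * F c * T) <= 8 * M + 4 * e.
  rewrite E'; apply: le_trans (cabsB _ _) _.
  have := outer_le _ cs; have := outer_le _ cs2.
  have := outer_le _ cs3; have := outer_le _ cs4; rewrite -/G => o4 o3 o2 o1.
  have := cabsD (outer k G c s + outer k G c (ic * s) + outer k G c (- s)) (outer k G c (- (ic * s))).
  have := cabsD (outer k G c s + outer k G c (ic * s)) (outer k G c (- s)).
  have := cabsD (outer k G c s) (outer k G c (ic * s)).
  have := cabsD (contour k q c s + contour k q c (ic * s) + contour k q c (- s)) (contour k q c (- (ic * s))).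
  have := cabsD (contour k q c s + contour k q c (ic * s)) (contour k q c (- s)).
  have := cabsD (contour k q c s) (contour k q c (ic * s)).
  lra.
rewrite !cabsM cabs_nat; have := cabs_ge0 (F c); nra.
Qed.

Definition node (P : seq C) (x : C) : C := \prod_(p <- P) (x - p).

Lemma node_eq0 P x : (node P x == 0) = (x \in P).
Proof.
rewrite /node prodf_seq_eq0; apply/hasP/idP => [[p pP /=]|xP].
  by rewrite subr_eq0 => /eqP->.
by exists x => //=; rewrite subrr.
Qed.

Lemma cdiff_node P z : exists d, cdiff (node P) z d.
Proof.
elim: P => [|p P [d IH]].
  by exists 0; apply: (cdiff_ext ltr01) (cdiff_cst 1 z) => x _; rewrite /node big_nil.
eexists; have := cdiffM (cdiff_subr z p) IH.
by apply: (cdiff_ext ltr01) => x _; rewrite /node big_cons.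
Qed.

(* The finitely many exceptional points are removable: multiplying by the squares
   of [x - p] makes the function differentiable there. The constant in
   [cauchy_rough] disappears by applying it to powers of [F]. *)
Lemma max_principle (P : seq C) F c (h M : R) : 0 < h -> 0 <= M ->
  (forall x, cabs (x - c) <= 2 * h -> x \notin P -> exists d, cdiff F x d) ->
  (forall p, p \in P -> cabs (p - c) <= 2 * h -> exists B r : R, 0 < r /\
     forall x, cabs (x - p) < r -> x != p -> cabs (F x) <= B) ->
  (forall x, h <= cabs (x - c) <= 2 * h -> x \notin P -> cabs (F x) <= M) ->
  c \notin P -> cabs (F c) <= M.
Proof.
move=> h0 M0 dF bF hM cP; rewrite leNgt; apply/negP => Fc.
have nc : 0 < cabs (node P c ^+ 2).
  by rewrite cabs_gt0 expf_neq0// node_eq0.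
have [W W0 hW] := @ccont_bound R [set x | h <= cabs (x - c) <= 2 * h] (fun x => node P x ^+ 2)
    (@annulus_compact _ _ _ _)
    (fun z _ => cdiff_ccont (svalP (cid (cdiffX 2 (svalP (cid (cdiff_node P z))))))).
have Fc0 : 0 < cabs (F c) by exact: le_lt_trans Fc.
have key n : cabs (node P c ^+ 2) * cabs (F c) ^+ n.+1 <= 2 * (W * M ^+ n.+1).
  rewrite -cabsX -cabsM.
  apply: (@cauchy_rough (fun x => node P x ^+ 2 * F x ^+ n.+1) c h _ h0).
    move=> x xh; have [xP|xP] := boolP (x \in P); last first.
      have [d hd] := dF x xh xP; have [d1 hd1] := cdiff_node P x.
      have [d2 hd2] := cdiffX 2 hd1; have [d3 hd3] := cdiffX n.+1 hd.
      by eexists; exact: cdiffM hd2 hd3.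
    exists 0 => e e0; have [B [r [r0 hB]]] := bF x xP xh.
    have nx : node P x = 0 by apply/eqP; rewrite node_eq0.
    have [d hd] := cdiff_node P x; have [r1 r10 hr1] := cdiff_lip hd.
    rewrite nx in hr1.
    pose L := cabs d + 1; have L0 : 0 < L by rewrite /L; have := cabs_ge0 d; lra.
    pose B1 := `|B| + 1; have B10 : 0 < B1 by rewrite /B1; have := normr_ge0 B; lra.
    have K0 : 0 < L ^+ 2 * B1 ^+ n.+1 by rewrite mulr_gt0// exprn_gt0.
    exists (Num.min r (Num.min r1 (e / (L ^+ 2 * B1 ^+ n.+1)))).
      by rewrite !lt_min r0 r10 divr_gt0.
    move=> y; rewrite !lt_min => /and3P[yr yr1]; rewrite ltr_pdivlMr// => ye.
    have [->|yx] := eqVneq y x.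
      by rewrite !subrr mulr0 subrr cabs0 mulr0.
    rewrite nx expr0n /= mul0r mul0r !subr0 cabsM !cabsX.
    have := hr1 y yr1; rewrite subr0 -/L => ny.
    have FB : cabs (F y) <= B1.
      by apply: le_trans (hB y yr yx) _; have := ler_norm B; rewrite /B1; lra.
    have a0 := cabs_ge0 (y - x).
    have t1 : cabs (node P y) ^+ 2 <= (L * cabs (y - x)) ^+ 2.
      by rewrite ler_pXn2r ?nnegrE ?cabs_ge0// mulr_ge0// ltW.
    have t2 : cabs (F y) ^+ n.+1 <= B1 ^+ n.+1.
      by rewrite ler_pXn2r ?nnegrE ?cabs_ge0// ltW.
    apply: le_trans (ler_pM _ _ t1 t2) _; rewrite ?exprn_ge0 ?cabs_ge0//.
    rewrite (_ : (L * cabs (y - x)) ^+ 2 * B1 ^+ n.+1 =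
      cabs (y - x) * (L ^+ 2 * B1 ^+ n.+1) * cabs (y - x)); last by ring.
    by apply: ler_wpM2r => //; exact: ltW.
  move=> x xh; have [xP|xP] := boolP (x \in P).
    have -> : node P x = 0 by apply/eqP; rewrite node_eq0.
    by rewrite expr0n /= mul0r cabs0 mulr_ge0 ?exprn_ge0// ltW.
  rewrite cabsM; apply: ler_pM; rewrite ?cabs_ge0//; first exact: hW.
  by rewrite cabsX ler_pXn2r ?nnegrE ?cabs_ge0//; exact: hM.
have [|n hn] := @geometric_small R (M / cabs (F c)) (2 * W) (cabs (node P c ^+ 2)) _ nc.
  by apply/andP; split; [rewrite divr_ge0// ltW|rewrite ltr_pdivrMr// mul1r].
have := hn n.+1 (leqnSn n); rewrite expr_div_n mulrA ltr_pdivrMr ?exprn_gt0//.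
have := key n; rewrite mulrA; lra.
Qed.

End MaximumPrinciple2.

(** * Cauchy estimates *)

Section CauchyEstimates.
Variable R : realType.
Local Notation C := (Cplx R).
Implicit Types (f F g : C -> C) (a b c s : C).

Definition hol (U : set C) F := forall z, U z -> exists d, cdiff F z d.
Definition disc c (r : R) : set C := [set x | cabs (x - c) < r].

Lemma disc_center c r : 0 < r -> disc c r c.
Proof. by rewrite /disc /= subrr cabs0. Qed.

(** The maximum principle applied to the quotient (F y - F z)/(y - z) around x: on the annulus the
    numerator is at most 2M and the denominator at least h/2. The exceptional set is kept so that
    the lemma also applies to difference quotients and to F/(x-c)^n. *)
Lemma lipschitz_of_bounded (P : seq C) F c (h M : R) : 0 < h -> 0 <= M ->
  (forall x, disc c (3 * h) x -> x \notin P -> exists d, cdiff F x d) ->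
  (forall x, disc c (3 * h) x -> x \notin P -> cabs (F x) <= M) ->
  forall x z, cabs (x - c) <= h / 4 -> cabs (z - c) <= h / 4 -> x \notin P -> z \notin P ->
  cabs (F x - F z) <= 4 * M / h * cabs (x - z).
Proof.
move=> h0 M0 dF bF x z xc zc xP zP.
have [->|xz] := eqVneq x z; first by rewrite !subrr cabs0 mulr0.
have xz0 : 0 < cabs (x - z) by rewrite cabs_gt0 subr_eq0.
have xz2 : cabs (x - z) <= h / 2 by have := cabs_tri c x z; rewrite (cabs_dist c z); lra.
have inD y : cabs (y - x) <= 2 * h -> disc c (3 * h) y.
  by move=> yx; rewrite /disc /=; have := cabs_tri x y c; lra.
have hM0 : 0 <= 4 * M / h by rewrite divr_ge0// ?mulr_ge0// ltW.
suff : cabs ((F x - F z) / (x - z)) <= 4 * M / h.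
  by rewrite cabsM cabsV ler_pdivrMr.
apply: (@max_principle _ (z :: P) (fun y => (F y - F z) / (y - z)) x h _ h0 hM0).
- move=> y yx; rewrite inE negb_or => /andP[yz yP].
  have [d hd] := dF y (inD y yx) yP; exact: cdiff_quot hd yz.
- move=> p; rewrite inE => pzP px.
  have [pz|pz] := eqVneq p z.
    have [d hd] : exists d, cdiff F z d.
      by apply: dF => //; rewrite /disc /=; lra.
    have [r r0 hr] := cdiff_lip hd; exists (cabs d + 1), r; split=> // y.
    rewrite pz => yr yz; have yz0 : 0 < cabs (y - z) by rewrite cabs_gt0 subr_eq0.
    by rewrite cabsM cabsV ler_pdivrMr//; exact: hr.
  have pP : p \in P by move: pzP; rewrite (negPf pz).
  have pz0 : 0 < cabs (p - z) by rewrite cabs_gt0 subr_eq0.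
  have [r [r0 hr]] : exists r : R, 0 < r /\ forall y, cabs (y - p) < r -> y != p -> y \notin P /\ disc c (3 * h) y.
    have [r1 r10 hr1] : exists2 r : R, 0 < r & forall y, cabs (y - p) < r -> y != p -> y \notin P.
      elim: (P) => [|q Q [r r0 hr]]; first by exists 1.
      have [->|qp] := eqVneq q p.
        by exists r => // y yr yp; rewrite inE negb_or yp hr.
      have qp0 : 0 < cabs (q - p) by rewrite cabs_gt0 subr_eq0.
      exists (Num.min r (cabs (q - p))); first by rewrite lt_min r0.
      move=> y; rewrite lt_min => /andP[yr yq] yp; rewrite inE negb_or hr// andbT.
      by apply: contraTneq yq => ->; rewrite ltxx.
    have e0 : 0 < 3 * h - cabs (p - c) by have := cabs_tri x p c; lra.
    exists (Num.min r1 (3 * h - cabs (p - c))); split; first by rewrite lt_min r10.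
    move=> y; rewrite lt_min => /andP[yr yp'] yp; split; first exact: hr1.
    by rewrite /disc /=; have := cabs_tri p y c; lra.
  exists (2 * M / (cabs (p - z) / 2)), (Num.min r (cabs (p - z) / 2)); split.
    by rewrite lt_min r0 divr_gt0.
  move=> y; rewrite lt_min => /andP[yr yp] ynp; have [yP yD] := hr y yr ynp.
  have yz : cabs (p - z) / 2 <= cabs (y - z).
    by have := cabs_tri y p z; rewrite (cabs_dist p y); lra.
  have FM : cabs (F y - F z) <= 2 * M.
    apply: le_trans (cabsB _ _) _; have := bF y yD yP.
    have := bF z; rewrite /disc /= => /(_ _ zP) => hz.
    have : cabs (F z) <= M by apply: hz; lra.
    lra.
  rewrite cabsM cabsV; apply: ler_pM; rewrite ?cabs_ge0 ?invr_ge0 ?cabs_ge0//.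
  by rewrite lef_pV2// posrE; lra.
- move=> y /andP[y1 y2]; rewrite inE negb_or => /andP[yz yP].
  have hyz : h / 2 <= cabs (y - z).
    by have := cabs_tri z y x; rewrite (cabs_dist z x); lra.
  have FM : cabs (F y - F z) <= 2 * M.
    apply: le_trans (cabsB _ _) _; have := bF y (inD y y2) yP.
    have : cabs (F z) <= M by apply: bF => //; rewrite /disc /=; lra.
    lra.
  rewrite cabsM cabsV (_ : 4 * M / h = 2 * M * (h / 2)^-1); last by field; rewrite gt_eqF.
  apply: ler_pM; rewrite ?cabs_ge0 ?invr_ge0 ?cabs_ge0//.
  by rewrite lef_pV2// posrE; lra.
- by rewrite inE negb_or xz.
Qed.

Lemma bound_of_lipschitz F c d (L r : R) : 0 < r -> cdiff F c d ->
  (forall x, cabs (x - c) < r -> cabs (F x - F c) <= L * cabs (x - c)) ->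
  cabs d <= L.
Proof.
move=> r0 hd hL; apply/ler_addgt0Pr => e e0.
have [r1 r10 hr1] := hd _ e0.
pose t := Num.min r r1 / 2.
have t0 : 0 < t by rewrite divr_gt0// lt_min r0.
have [tr tr1] : t < r /\ t < r1 by rewrite /t; split; case: (leP r r1) => ?; lra.
have E : cabs (c + rc t - c) = t by rewrite addrC addKr cabs_rc gtr0_norm.
have := hL (c + rc t); have := hr1 (c + rc t); rewrite E => /(_ tr1) a1 /(_ tr) a2.
have : cabs (d * (c + rc t - c)) <= (L + e) * t.
  rewrite (_ : d * _ = (F (c + rc t) - F c) - (F (c + rc t) - F c - d * (c + rc t - c))); last by ring.
  by apply: le_trans (cabsB _ _) _; rewrite mulrDl; lra.
by rewrite cabsM E ler_pM2r.
Qed.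

Lemma cauchy_estimate F c d (h M : R) : 0 < h -> hol (disc c (3 * h)) F ->
  (forall x, disc c (3 * h) x -> cabs (F x) <= M) -> cdiff F c d -> cabs d <= 4 * M / h.
Proof.
move=> h0 dF bF hd.
have M0 : 0 <= M by apply: le_trans (bF c (disc_center _ _)); rewrite ?cabs_ge0//; lra.
apply: (@bound_of_lipschitz F c d _ (h / 4)) hd _; first by lra.
move=> x xc; apply: (@lipschitz_of_bounded [::] F c h M h0 M0) => //.
- by move=> y yD _; exact: dF.
- by move=> y yD _; exact: bF.
- exact: ltW.
- by rewrite subrr cabs0; lra.
Qed.

(** Use of [lipschitz_of_bounded] twice: the quotient q at c is bounded by 4M/h on radius h/4 =
    3(h/12), so it is Lipschitz on radius h/48 with constant 4(4M/h)/(h/12) = 192M/h^2. Then y tends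
    to c in q x - q y. *)
Lemma second_order F c d (h M : R) : 0 < h -> hol (disc c (3 * h)) F ->
  (forall x, disc c (3 * h) x -> cabs (F x) <= M) -> cdiff F c d ->
  forall x, cabs (x - c) <= h / 48 ->
  cabs (F x - F c - d * (x - c)) <= 192 * M / h ^+ 2 * cabs (x - c) ^+ 2.
Proof.
move=> h0 dF bF hd x xc.
have M0 : 0 <= M by apply: le_trans (bF c (disc_center _ _)); rewrite ?cabs_ge0//; lra.
have [->|xnc] := eqVneq x c; first by rewrite !subrr mulr0 subrr cabs0 expr0n /= mulr0.
have xc0 : 0 < cabs (x - c) by rewrite cabs_gt0 subr_eq0.
pose q y := (F y - F c) / (y - c).
have lipF y : cabs (y - c) <= h / 4 -> cabs (F y - F c) <= 4 * M / h * cabs (y - c).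
  move=> yc; apply: (@lipschitz_of_bounded [::] F c h M h0 M0) => //.
  - by move=> z zD _; exact: dF.
  - by move=> z zD _; exact: bF.
  - by rewrite subrr cabs0; lra.
have h1 : 0 < h / 12 by lra.
have M1 : 0 <= 4 * M / h by rewrite divr_ge0 ?mulr_ge0// ltW.
have lipq y : cabs (y - c) <= h / 48 -> y != c ->
    cabs (q x - q y) <= 192 * M / h ^+ 2 * cabs (x - y).
  move=> yc ync.
  rewrite (_ : 192 * M / h ^+ 2 = 4 * (4 * M / h) / (h / 12)); last by field; rewrite gt_eqF.
  apply: (@lipschitz_of_bounded [:: c] q c (h / 12) _ h1 M1); rewrite ?inE//.
  - move=> z; rewrite /disc /= inE => zD zc.
    have [d1 hd1] : exists d, cdiff F z d by apply: dF; rewrite /disc /=; lra.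
    exact: cdiff_quot hd1 zc.
  - move=> z; rewrite /disc /= inE => zD zc.
    have zc0 : 0 < cabs (z - c) by rewrite cabs_gt0 subr_eq0.
    by rewrite /q cabsM cabsV ler_pdivrMr//; apply: lipF; lra.
  - lra.
  - lra.
have K0 : 0 <= 192 * M / h ^+ 2 by rewrite divr_ge0 ?exprn_ge0 ?mulr_ge0// ltW.
suff : cabs (q x - d) <= 192 * M / h ^+ 2 * cabs (x - c).
  move=> qd; rewrite (_ : F x - F c - d * (x - c) = (q x - d) * (x - c)); last first.
    by rewrite /q; field; rewrite subr_eq0.
  by rewrite cabsM expr2 mulrA ler_pM2r.
apply/ler_addgt0Pr => e e0.
set K := 192 * M / h ^+ 2 in K0 lipq *.
have [r r0 hr] := hd (e / 2) ltac:(lra).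
pose t := Num.min (Num.min r (h / 48)) (e / 2 / (K + 1)) / 2.
have K1 : 0 < K + 1 by lra.
have [t0 tr th tK] : [/\ 0 < t, t < r, t <= h / 48 & t < e / 2 / (K + 1)].
  have m0 : 0 < Num.min (Num.min r (h / 48)) (e / 2 / (K + 1)).
    by rewrite !lt_min r0 !divr_gt0.
  have m1 : Num.min (Num.min r (h / 48)) (e / 2 / (K + 1)) <= Num.min r (h / 48).
    by rewrite ge_min lexx.
  have m2 : Num.min (Num.min r (h / 48)) (e / 2 / (K + 1)) <= e / 2 / (K + 1).
    by rewrite ge_min lexx orbT.
  have m3 : Num.min r (h / 48) <= r by rewrite ge_min lexx.
  have m4 : Num.min r (h / 48) <= h / 48 by rewrite ge_min lexx orbT.
  by rewrite /t; split; lra.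
have E : cabs (c + rc t - c) = t by rewrite addrC addKr cabs_rc gtr0_norm.
have ync : c + rc t != c by rewrite -subr_eq0 -cabs_gt0 E.
have := lipq (c + rc t); rewrite E => /(_ th ync) l1.
have l2 : cabs (q (c + rc t) - d) <= e / 2.
  have {hr} := hr (c + rc t); rewrite E => /(_ tr) hr.
  rewrite (_ : q _ - d = (F (c + rc t) - F c - d * (c + rc t - c)) / (c + rc t - c)); last first.
    by rewrite /q; field; rewrite subr_eq0.
  by rewrite cabsM cabsV E ler_pdivrMr.
have l3 : cabs (x - (c + rc t)) <= cabs (x - c) + t.
  by apply: le_trans (cabs_tri c _ _) _; rewrite (cabs_dist c) E.
have l4 : K * t <= e / 2 by move: tK; rewrite ltr_pdivlMr//; nra.
have l5 : K * cabs (x - (c + rc t)) <= K * cabs (x - c) + K * t by rewrite -mulrDr ler_wpM2l.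
have := cabs_tri (q (c + rc t)) (q x) d; lra.
Qed.

(** Expand at y rather than at c, and compare the two derivatives by expanding between y and c in
    both directions; the total costs a factor 3. *)
Lemma second_order2 F c d (h M : R) : 0 < h -> hol (disc c (4 * h)) F ->
  (forall x, disc c (4 * h) x -> cabs (F x) <= M) -> cdiff F c d ->
  forall x y, cabs (x - c) <= h / 96 -> cabs (y - c) <= h / 96 ->
  cabs (F x - F y - d * (x - y)) <=
    576 * M / h ^+ 2 * (cabs (x - c) + cabs (y - c)) * cabs (x - y).
Proof.
move=> h0 dF bF hd x y xc yc.
have sub z : cabs (z - c) <= h / 96 -> disc z (3 * h) `<=` disc c (4 * h).
  by move=> zc w; rewrite /disc /= => wz; have := cabs_tri z w c; lra.
have M0 : 0 <= M by apply: le_trans (bF c (disc_center _ _)); rewrite ?cabs_ge0//; lra.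
have [dy hdy] : exists d, cdiff F y d by apply: dF; rewrite /disc /=; lra.
have so z dz : cabs (z - c) <= h / 96 -> cdiff F z dz -> forall w, cabs (w - z) <= h / 48 ->
  cabs (F w - F z - dz * (w - z)) <= 192 * M / h ^+ 2 * cabs (w - z) ^+ 2.
  move=> zc hdz; apply: second_order => // w wz; first by apply: dF; exact: sub wz.
  by apply: bF; exact: sub wz.
rewrite (_ : 576 * M / h ^+ 2 = 3 * (192 * M / h ^+ 2)); last by field; rewrite gt_eqF.
have cc : cabs (c - c) <= h / 96 by rewrite subrr cabs0; lra.
have s1 := so y dy yc hdy x.
have s2 := so y dy yc hdy c.
have s3 := so c d cc hd y.
have K0 : 0 <= 192 * M / h ^+ 2 by rewrite divr_ge0 ?exprn_ge0 ?mulr_ge0// ltW.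
move: (192 * M / h ^+ 2) K0 s1 s2 s3 => K K0; rewrite (cabs_dist c y) => s1 s2 s3.
have xy : cabs (x - y) <= cabs (x - c) + cabs (y - c).
  by have := cabs_tri c x y; rewrite (cabs_dist c y).
have {}s1 := s1 ltac:(lra); have {}s2 := s2 ltac:(lra); have {}s3 := s3 ltac:(lra).
have dd : cabs (dy - d) <= 2 * K * cabs (y - c).
  have [yc'|yc'] := eqVneq y c.
    by rewrite (cdiff_uniq hd (_ : cdiff F c dy)) -?yc'// !subrr !cabs0 mulr0.
  have yc0 : 0 < cabs (y - c) by rewrite cabs_gt0 subr_eq0.
  rewrite -(ler_pM2r yc0) -cabsM.
  rewrite (_ : (dy - d) * (y - c) = (F c - F y - dy * (c - y)) + (F y - F c - d * (y - c))); last by ring.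
  by apply: le_trans (cabsD _ _) _; rewrite expr2 in s2 s3; lra.
rewrite (_ : F x - F y - d * (x - y) = (F x - F y - dy * (x - y)) + (dy - d) * (x - y)); last by ring.
apply: le_trans (cabsD _ _) _; rewrite cabsM.
have xy0 := cabs_ge0 (x - y).
have t1 : cabs (dy - d) * cabs (x - y) <= 2 * K * cabs (y - c) * cabs (x - y) by rewrite ler_wpM2r.
have t2 : K * cabs (x - y) ^+ 2 <= K * (cabs (x - c) + cabs (y - c)) * cabs (x - y).
  by rewrite expr2 mulrA ler_wpM2r// ler_wpM2l.
have t3 : K * cabs (y - c) * cabs (x - y) <= K * (cabs (x - c) + cabs (y - c)) * cabs (x - y).
  by rewrite ler_wpM2r// ler_wpM2l// lerDr cabs_ge0.
lra.
Qed.

(** Bisection replaces integration along the segment: over 2^n pieces the quadratic errors of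
    [second_order] add up to K|x-y|^2/2^n. *)
Lemma mean_value F c (h M L : R) : 0 < h -> hol (disc c (4 * h)) F ->
  (forall x, disc c (4 * h) x -> cabs (F x) <= M) ->
  (forall x d, disc c (4 * h) x -> cdiff F x d -> cabs d <= L) ->
  forall x y, cabs (x - c) <= h / 96 -> cabs (y - c) <= h / 96 ->
  cabs (F x - F y) <= L * cabs (x - y).
Proof.
move=> h0 dF bF bL x y xc yc.
have sub z : cabs (z - c) <= h / 96 -> disc z (3 * h) `<=` disc c (4 * h).
  by move=> zc w; rewrite /disc /= => wz; have := cabs_tri z w c; lra.
pose K := 192 * M / h ^+ 2.
have main n : forall x y, cabs (x - c) <= h / 96 -> cabs (y - c) <= h / 96 ->
    cabs (F x - F y) <= L * cabs (x - y) + K * cabs (x - y) ^+ 2 * 2^-1 ^+ n.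
  elim: n => [|n IH] {xc yc}{}x {}y xc yc.
    have yD : disc c (4 * h) y by rewrite /disc /=; lra.
    have [d hd] := dF y yD; have dL := bL y d yD hd.
    have xy : cabs (x - y) <= h / 48.
      by have := cabs_tri c x y; rewrite (cabs_dist c y); lra.
    have := @second_order F y d h M h0 (fun z hz => dF z (sub y yc z hz))
      (fun z hz => bF z (sub y yc z hz)) hd x xy.
    rewrite -/K expr0 mulr1 => so.
    have := cabsD (F x - F y - d * (x - y)) (d * (x - y)); rewrite subrK cabsM.
    by have := ler_wpM2r (cabs_ge0 (x - y)) dL; lra.
  pose m := (x + y) / 2.
  have e1 : cabs (x - m) = cabs (x - y) / 2.
    by rewrite -cabs_half; congr cabs; rewrite /m; field.
  have e2 : cabs (m - y) = cabs (x - y) / 2.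
    by rewrite -cabs_half; congr cabs; rewrite /m; field.
  have mc : cabs (m - c) <= h / 96.
    rewrite (_ : m - c = (x - c) / 2 + (y - c) / 2); last by rewrite /m; field.
    by apply: le_trans (cabsD _ _) _; rewrite !cabs_half; lra.
  have := IH x m xc mc; have := IH m y mc yc; rewrite e1 e2 => i1 i2.
  apply: le_trans (cabs_tri (F m) _ _) _.
  rewrite (exprS _ n) (_ : K * cabs (x - y) ^+ 2 * (2^-1 * 2^-1 ^+ n) =
    2 * (K * (cabs (x - y) / 2) ^+ 2 * 2^-1 ^+ n)); last by field.
  lra.
apply/ler_addgt0Pr => e e0.
have [|n hn] := @geometric_small R 2^-1 (K * cabs (x - y) ^+ 2) e _ e0; first by lra.
have := main n x y xc yc; have := hn n (leqnn n); lra.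
Qed.

End CauchyEstimates.

(** * Univalent functions *)

Section Univalent.
Variable R : realType.
Local Notation C := (Cplx R).
Implicit Types (f F g : C -> C) (a b c s : C).

Lemma open_disc (U : set C) z : open U -> U z ->
  exists2 r : R, 0 < r & disc z r `<=` U.
Proof. by move=> /open_cabs oU /oU[r r0 h]; exists r. Qed.

Lemma hol_cont U F z : hol U F -> U z -> ccont F z.
Proof. by move=> hF /hF[d hd]; exact: cdiff_ccont hd. Qed.

(** Accumulating zeros make every F/(x-c)^n bounded near c: the n-th quotient is Lipschitz off c and
    vanishes at zeros arbitrarily close to c, which bounds the next one. With c removable, the
    maximum principle makes |F x| decay geometrically in n. *)
Lemma identity_disc F c (h M : R) : 0 < h -> hol (disc c (3 * h)) F ->
  (forall x, disc c (3 * h) x -> cabs (F x) <= M) ->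
  (forall e : R, 0 < e -> exists y, [/\ cabs (y - c) < e, y != c & F y = 0]) ->
  forall x, cabs (x - c) <= h / 4 -> F x = 0.
Proof.
move=> h0 dF bF zF.
have M0 : 0 <= M by apply: le_trans (bF c (disc_center _ _)); rewrite ?cabs_ge0//; lra.
pose Fn n x := F x / (x - c) ^+ n.
have dFn n x : disc c (3 * h) x -> x \notin [:: c] -> exists d, cdiff (Fn n) x d.
  rewrite inE => xD xc; have [d hd] := dF x xD.
  have [d1 hd1] := cdiffX n (cdiff_subr x c).
  have [|d2 hd2] := cdiffV hd1; first by rewrite expf_neq0// subr_eq0.
  by eexists; exact: cdiffM hd hd2.
have bFn n : exists B r : R, [/\ 0 <= B, 0 < r, r <= h &
    forall x, cabs (x - c) < r -> x != c -> cabs (Fn n x) <= B].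
  elim: n => [|n [B [r [B0 r0 rh hB]]]].
    exists M, h; split=> // x xh _; rewrite /Fn expr0 divr1.
    by apply: bF; rewrite /disc /=; lra.
  have r3 : 0 < r / 3 by lra.
  exists (4 * B / (r / 3)), (r / 12); split; [|lra|lra|].
    by apply: divr_ge0; lra.
  move=> x xr xc; have xc0 : 0 < cabs (x - c) by rewrite cabs_gt0 subr_eq0.
  rewrite (_ : Fn n.+1 x = Fn n x / (x - c)); last first.
    by rewrite /Fn exprSr invfM mulrA.
  rewrite cabsM cabsV ler_pdivrMr//.
  set L := 4 * B / (r / 3).
  have L0 : 0 <= L by apply: divr_ge0; lra.
  apply/ler_addgt0Pr => e e0.
  have L1 : 0 < L + 1 by lra.
  have [|y [ye yc Fy]] := zF (Num.min (r / 12) (e / (L + 1))).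
    by rewrite lt_min !divr_gt0.
  have [yr yL] : cabs (y - c) < r / 12 /\ cabs (y - c) < e / (L + 1).
    by apply/andP; rewrite -lt_min.
  have : cabs (Fn n x - Fn n y) <= L * cabs (x - y).
    apply: (@lipschitz_of_bounded _ [:: c] (Fn n) c (r / 3) B r3 B0); rewrite ?inE//.
    - by move=> z zD zc; apply: dFn => //; move: zD; rewrite /disc /=; lra.
    - by move=> z; rewrite /disc /= inE => zD zc; apply: hB => //; lra.
    - lra.
    - lra.
  rewrite {2}/Fn Fy mul0r subr0 => l1.
  have l2 : cabs (x - y) <= cabs (x - c) + cabs (y - c).
    by have := cabs_tri c x y; rewrite (cabs_dist c y).
  have l3 : L * cabs (x - y) <= L * cabs (x - c) + L * cabs (y - c).
    by rewrite -mulrDr ler_wpM2l.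
  have l4 : L * cabs (y - c) <= e.
    by move: yL; rewrite ltr_pdivlMr//; have := cabs_ge0 (y - c); nra.
  lra.
(* For |x-c| <= h/4, points of the annulus about x are at distance at least 3h/4 from c, so the
   ratio of the geometric decay is at most 1/3. *)
have h34 : 0 < 3 * h / 4 by lra.
have bnd n x : cabs (x - c) <= h / 4 -> x != c ->
    cabs (Fn n x) <= M / (3 * h / 4) ^+ n.
  move=> xh xc; have MB : 0 <= M / (3 * h / 4) ^+ n.
    by rewrite divr_ge0// exprn_ge0// ltW.
  have inD y : cabs (y - x) <= 2 * h -> disc c (3 * h) y.
    by rewrite /disc /=; have := cabs_tri x y c; lra.
  apply: (@max_principle _ [:: c] (Fn n) x h _ h0 MB).
  - by move=> y yx; apply: dFn; exact: inD.
  - move=> p; rewrite inE => /eqP-> _.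
    by have [B [r [B0 r0 _ hB]]] := bFn n; exists B, r.
  - move=> y /andP[y1 y2]; rewrite inE => yc.
    have yh : 3 * h / 4 <= cabs (y - c) by have := cabs_tri c y x; rewrite (cabs_dist c x); lra.
    rewrite /Fn cabsM cabsV cabsX; apply: ler_pM; rewrite ?cabs_ge0 ?invr_ge0 ?exprn_ge0 ?cabs_ge0//.
      by apply: bF; exact: inD.
    rewrite lef_pV2 ?posrE ?exprn_gt0//; last by lra.
    by rewrite lerXn2r ?nnegrE ?cabs_ge0// ltW.
  - by rewrite inE.
have zero_off x : cabs (x - c) <= h / 4 -> x != c -> F x = 0.
  move=> xh xc; apply/eqP; rewrite -cabs_eq0 eq_le cabs_ge0 andbT.
  apply/ler_addgt0Pr => e e0; rewrite add0r.
  have xc0 : 0 < cabs (x - c) by rewrite cabs_gt0 subr_eq0.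
  have [|n hn] := @geometric_small R (cabs (x - c) / (3 * h / 4)) M e _ e0.
    apply/andP; split; first by rewrite divr_ge0 ?cabs_ge0// ltW.
    by rewrite ltr_pdivrMr//; lra.
  have := bnd n x xh xc; rewrite /Fn cabsM cabsV cabsX ler_pdivrMr ?exprn_gt0// => b.
  have := hn n (leqnn n); rewrite expr_div_n.
  rewrite (_ : M * (cabs (x - c) ^+ n / (3 * h / 4) ^+ n) = M / (3 * h / 4) ^+ n * cabs (x - c) ^+ n); last by ring.
  lra.
move=> x xh; have [xc|] := eqVneq x c; last exact: zero_off.
apply/eqP; rewrite -cabs_eq0 eq_le cabs_ge0 andbT xc.
apply/ler_addgt0Pr => e e0; rewrite add0r.
have cD : disc c (3 * h) c by apply: disc_center; lra.
have [r r0 hr] := hol_cont dF cD e0.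
have [y [yr yc Fy]] := zF r r0.
by have := hr y yr; rewrite Fy sub0r cabsN => /ltW.
Qed.

Lemma annulus_gap (U : set C) g z r : open U -> hol U g -> set_inj U g -> U z ->
  0 < r -> exists h m : R, [/\ 0 < h, 2 * h < r, 0 < m, disc z (3 * h) `<=` U &
  forall x, h <= cabs (x - z) <= 2 * h -> m <= cabs (g x - g z)].
Proof.
move=> oU hg ig Uz r0; have [r1 r10 rU] := open_disc oU Uz.
pose h := Num.min r r1 / 4.
have m0 : 0 < Num.min r r1 by rewrite lt_min r0.
have m1 : Num.min r r1 <= r by rewrite ge_min lexx.
have m2 : Num.min r r1 <= r1 by rewrite ge_min lexx orbT.
have h0 : 0 < h by rewrite /h; lra.
have hU : disc z (3 * h) `<=` U.
  by move=> x xz; apply: rU; move: xz; rewrite /disc /= /h; lra.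
have KU x : h <= cabs (x - z) <= 2 * h -> U x.
  by move=> /andP[_ x2]; apply: hU; rewrite /disc /=; lra.
have [|x hx|m mp hm] := @ccont_min R [set x | h <= cabs (x - z) <= 2 * h]
    (fun x => g x - g z) (@annulus_compact R z h (2 * h)).
- by move=> x /KU/hg[d hd]; exact: cdiff_ccont (cdiff_sub_cst (g z) hd).
- rewrite subr_eq0; apply/eqP => E; have xz := ig x z; rewrite !inE in xz.
  by have E2 := xz (KU x hx) Uz E; move: hx; rewrite E2 /= subrr cabs0; lra.
by exists h, m; split=> //; rewrite /h; lra.
Qed.

(** If y were omitted, 1/(g - y) would be holomorphic, at most 2/m on the annulus, yet larger than
    2/m at z. *)
Lemma open_mapping (U : set C) g z r : open U -> hol U g -> set_inj U g -> U z ->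
  0 < r -> exists2 e : R, 0 < e &
  forall y, cabs (y - g z) < e -> exists x, [/\ cabs (x - z) < r, U x & g x = y].
Proof.
move=> oU hg ig Uz r0; have [h [m [h0 hr m0 hU hm]]] := annulus_gap oU hg ig Uz r0.
exists (m / 2); first by lra.
move=> y yz; apply: contrapT => no.
have gy x : cabs (x - z) <= 2 * h -> g x != y.
  move=> xz; apply/eqP => E; apply: no; exists x; split=> //; first by lra.
  by apply: hU; rewrite /disc /=; lra.
have zz : cabs (z - z) <= 2 * h by rewrite subrr cabs0; lra.
have M0 : 0 <= (m / 2)^-1 by rewrite invr_ge0; lra.
have : cabs (g z - y)^-1 <= (m / 2)^-1.
  apply: (@max_principle _ [::] (fun x => (g x - y)^-1) z h _ h0 M0) => //.
  - move=> x xz _; have [d hd] := hg x (hU x ltac:(rewrite /disc /=; lra)).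
    by apply: (cdiffV (cdiff_sub_cst y hd)); rewrite subr_eq0 gy.
  - move=> x xz _; have := hm x xz; rewrite cabsV => hx.
    rewrite lef_pV2 ?posrE; [|rewrite cabs_gt0 subr_eq0 gy//|lra].
      by have := cabs_tri y (g x) (g z); lra.
    by case/andP: xz.
rewrite cabsV lef_pV2 ?posrE; [|by rewrite cabs_gt0 subr_eq0 gy|lra].
by rewrite cabs_dist; lra.
Qed.

(** A point y near z has nonzero derivative, otherwise g would be constant by [mean_value]. The
    maximum principle for (x-y)/(g x - g y), with y removable, gives |z-y| <= (6h/m)|g z - g y|; a
    zero derivative at z would make the right side at most |z-y|/2. *)
Lemma univalent_deriv_neq0 (U : set C) g z d : open U -> hol U g -> set_inj U g ->
  U z -> cdiff g z d -> d != 0.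
Proof.
move=> oU hg ig Uz hd; apply/eqP => d0; rewrite d0 in hd.
have [h [m [h0 hr m0 hU hm]]] := annulus_gap oU hg ig Uz ltr01.
have e0 : 0 < m / (12 * h) by rewrite divr_gt0//; lra.
have [r1 r10 hr1] := hd _ e0.
have m2 : 0 < m / 2 by lra.
have [r2 r20 hr2] := hol_cont hg Uz m2.
pose s := Num.min (Num.min r1 r2) h.
have s0 : 0 < s by rewrite /s !lt_min r10 r20.
have [sr1 sr2 sh] : [/\ s <= r1, s <= r2 & s <= h].
  by rewrite /s !ge_min !lexx !orbT.
have [y [ys [d' hd' d'0]]] : exists y, disc z s y /\ exists2 d', cdiff g y d' & d' != 0.
  apply: contrapT => no.
  have s4 : 0 < s / 4 by lra.
  have s44 : 4 * (s / 4) = s by field.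
  have sU x : disc z s x -> U x.
    by move=> xs; apply: hU; move: xs; rewrite /disc /=; lra.
  have := @mean_value R g z (s / 4) (cabs (g z) + m / 2) 0 s4; rewrite s44 => mv.
  have {mv}mv := mv (fun x hx => hg x (sU x hx)).
  have b1 x : disc z s x -> cabs (g x) <= cabs (g z) + m / 2.
    move=> xs; have := hr2 x (lt_le_trans xs sr2).
    by have := cabs_tri (g z) (g x) 0; rewrite !subr0; lra.
  have b2 x dx : disc z s x -> cdiff g x dx -> cabs dx <= 0.
    move=> xs hdx; have [->|dx0] := eqVneq dx 0; first by rewrite cabs0.
    by exfalso; apply: no; exists x; split=> //; exists dx.
  (* The distance s/400 is below (s/4)/96 = s/384, the range of [mean_value]. *)
  pose x := z + rc (s / 400).
  have E : cabs (x - z) = s / 400 by rewrite addrC addKr cabs_rc gtr0_norm//; lra.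
  have := mv b1 b2 x z; rewrite E subrr cabs0 mul0r => /(_ ltac:(lra) ltac:(lra)).
  move=> le0; have gxz : g x = g z.
    by apply/eqP; rewrite -subr_eq0 -cabs_eq0 eq_le le0 cabs_ge0.
  have Ux : U x by apply: sU; rewrite /disc /= E; lra.
  have := ig x z; rewrite !inE => /(_ Ux Uz gxz) xz.
  by move: E; rewrite xz subrr cabs0; lra.
have yU : U y by apply: hU; move: ys; rewrite /disc /=; lra.
have yz : y != z.
  by apply: contra_neq d'0 => yz; apply: (cdiff_uniq hd'); rewrite yz.
have yz0 : 0 < cabs (y - z) by rewrite cabs_gt0 subr_eq0.
have gne x : U x -> x != y -> g x - g y != 0.
  move=> Ux; apply: contra_neq => /eqP; rewrite subr_eq0 => /eqP E.
  by apply: ig => //; rewrite inE.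
have gzy : cabs (g y - g z) <= m / 2 by apply/ltW/hr2; exact: lt_le_trans sr2.
have M0 : 0 <= 6 * h / m by apply: divr_ge0; lra.
have : cabs ((z - y) / (g z - g y)) <= 6 * h / m.
  apply: (@max_principle _ [:: y] (fun x => (x - y) / (g x - g y)) z h _ h0 M0).
  - move=> x xz; rewrite inE => xy; have Ux : U x by apply: hU; rewrite /disc /=; lra.
    have [dx hdx] := hg x Ux; have [d2 hd2] := cdiffV (cdiff_sub_cst (g y) hdx) (gne x Ux xy).
    by eexists; exact: cdiffM (cdiff_subr x y) hd2.
  - move=> p; rewrite inE => /eqP-> _.
    have cd' : 0 < cabs d' by rewrite cabs_gt0.
    have [r3 r30 hr3] := hd' (cabs d' / 2) ltac:(lra).
    exists (2 / cabs d'), r3; split=> // x /hr3 {}hr3 xy.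
    have xy0 : 0 < cabs (x - y) by rewrite cabs_gt0 subr_eq0.
    have lo : cabs d' / 2 * cabs (x - y) <= cabs (g x - g y).
      have := cabsB (g x - g y) (g x - g y - d' * (x - y)); rewrite opprB addrC subrK cabsM; lra.
    have dxy : 0 < cabs d' / 2 * cabs (x - y) by rewrite mulr_gt0//; lra.
    rewrite cabsM cabsV ler_pdivrMr; last exact: lt_le_trans lo.
    have := @ler_wpM2l R (2 / cabs d') (divr_ge0 (ler0n _ 2) (ltW cd')) _ _ lo.
    by apply: le_trans; rewrite le_eqVlt; apply/orP; left; apply/eqP; field; rewrite gt_eqF.
  - move=> x xz; rewrite inE => xy; have [x1 x2] := andP xz.
    have gx := hm x xz.
    have lo : m / 2 <= cabs (g x - g y).
      by have := cabs_tri (g y) (g x) (g z); lra.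
    rewrite cabsM cabsV (_ : 6 * h / m = 3 * h * (m / 2)^-1); last by field; rewrite gt_eqF.
    apply: ler_pM; rewrite ?cabs_ge0 ?invr_ge0 ?cabs_ge0//.
      by have := cabs_tri z x y; move: ys; rewrite /disc /= (cabs_dist z y); lra.
    by rewrite lef_pV2 ?posrE//; lra.
  - by rewrite inE eq_sym.
have gzy0 : 0 < cabs (g z - g y).
  by rewrite cabs_gt0 -oppr_eq0 opprB subr_eq0; apply: contra_neq yz => E; apply: ig; rewrite ?inE.
rewrite cabsM cabsV ler_pdivrMr// => b1.
have := hr1 y (lt_le_trans ys sr1); rewrite mul0r subr0 => b2.
have b3 : 6 * h / m * cabs (g z - g y) <= 6 * h / m * (m / (12 * h) * cabs (y - z)).
  by apply: ler_wpM2l => //; rewrite cabs_dist.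
have b4 : 6 * h / m * (m / (12 * h) * cabs (y - z)) = cabs (y - z) / 2.
  by field; rewrite !gt_eqF.
by move: b1; rewrite (cabs_dist z y); lra.
Qed.

End Univalent.

(** * Contraction of word maps *)

Section FiniteUniform.
Variable R : realType.

Lemma finite_uniform (I : finType) (P : I -> R -> Prop) :
  (forall i r s, 0 < s -> s <= r -> P i r -> P i s) ->
  (forall i, exists2 r : R, 0 < r & P i r) ->
  exists2 r : R, 0 < r & forall i, P i r.
Proof.
move=> mono ex.
suff [r r0 hr] : exists2 r : R, 0 < r & forall i, i \in enum I -> P i r.
  by exists r => // i; apply: hr; rewrite mem_enum.
elim: (enum I) => [|i s [r r0 hr]]; first by exists 1.
have [t t0 ht] := ex i; exists (Num.min r t); first by rewrite lt_min r0.
move=> j; rewrite inE => /orP[/eqP->|/hr {}hr].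
  by apply: mono ht; rewrite ?lt_min ?r0// ge_min lexx orbT.
by apply: mono hr; rewrite ?lt_min ?r0// ge_min lexx.
Qed.

End FiniteUniform.

Section IFS.
Variable R : realType.
Local Notation C := (Cplx R).
Variables (L : finType) (Om : set C) (g : L -> C -> C).
Implicit Types (w u : seq L) (i j : L).

Lemma word_map_cat u w x : word_map g (u ++ w) x = word_map g u (word_map g w x).
Proof. by elim: u => //= i u ->. Qed.

Lemma word_map_rcons w i x : word_map g (rcons w i) x = word_map g w (g i x).
Proof. by rewrite -cats1 word_map_cat. Qed.

(** The default 0 is taken only where [g i] has no derivative, hence nowhere in [Om]. *)
Definition dmap i (z : C) : C := xget 0 [set d | cdiff (g i) z d].

Fixpoint dword w (z : C) : C :=
  if w is i :: w' then dmap i (word_map g w' z) * dword w' z else 1.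

Lemma dword_cat u w z : dword (u ++ w) z = dword u (word_map g w z) * dword w z.
Proof. by elim: u => [|i u IH] /=; rewrite ?mul1r// IH word_map_cat mulrA. Qed.

Section Domain.
Hypothesis hG : holomorphic_ifs Om g.

Lemma ifs_open : open Om. Proof. by case: hG => -[]. Qed.

Lemma ifs_bounded : exists2 M : R, 0 < M & forall z, Om z -> cabs z <= M.
Proof.
have [_ [M0 [M0r hM]] _] := hG.
have [r r0 Mr] : exists2 r : R, 0 < r & M0 < rc r.
  exists (`|complex.Re M0| + 1); first by have := normr_ge0 (complex.Re M0); lra.
  rewrite -(RRe_real M0r) rc_lt /=; have := ler_norm (complex.Re M0); lra.
exists r => // z Oz.
by have /= := hM _ Mr z Oz; rewrite normE rc_le.
Qed.

Lemma ifs_self i z : Om z -> Om (g i z).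
Proof. by move=> Oz; have [_ _ /(_ i)[fs _ _]] := hG; exact: fs. Qed.

Lemma ifs_hol i : hol Om (g i).
Proof. by move=> z Oz; have [_ _ /(_ i)[_ [h _] _]] := hG; apply/derivable_cdiff/h. Qed.

Lemma ifs_inj i : set_inj Om (g i).
Proof. by have [_ _ /(_ i)[_ []]] := hG. Qed.

Lemma dmapP i z : Om z -> cdiff (g i) z (dmap i z).
Proof. by move=> /(@ifs_hol i)[d hd]; rewrite /dmap; case: xgetP => [x ->//|/(_ d)]; exact. Qed.

Lemma word_self w z : Om z -> Om (word_map g w z).
Proof. by move=> Oz; elim: w => //= i w IH; exact: ifs_self. Qed.

Lemma dwordP w z : Om z -> cdiff (word_map g w) z (dword w z).
Proof.
move=> Oz; elim: w => [|i w IH] /=; first exact: cdiff_id.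
by apply: cdiff_comp IH _; apply: dmapP; exact: word_self.
Qed.

Lemma word_hol w : hol Om (word_map g w).
Proof. by move=> z Oz; exists (dword w z); exact: dwordP. Qed.

Lemma word_inj w : set_inj Om (word_map g w).
Proof.
elim: w => [|i w IH] x y; rewrite !inE => Ox Oy //= E.
apply: IH; rewrite ?inE//; apply: (@ifs_inj i) => //; rewrite inE; exact: word_self.
Qed.

Lemma dword_neq0 w z : Om z -> dword w z != 0.
Proof.
move=> Oz; apply: (@univalent_deriv_neq0 _ Om (word_map g w) z _ ifs_open) => //.
- exact: word_hol.
- exact: word_inj.
- exact: dwordP.
Qed.

Lemma closure_compact (S : set C) : S `<=` Om -> compact (closure S).
Proof.
move=> SO; have [M M0 hM] := ifs_bounded.
apply: (@closed_bounded_compact _ _ (M + 1)); first exact: closed_closure.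
move=> z /closure_cabs/(_ _ ltr01)[y /SO/hM yM yz].
by have := cabs_tri y z 0; rewrite !subr0 cabs_dist; lra.
Qed.

Lemma ifs_margin : exists2 e : R, 0 < e &
  forall i z, Om z -> forall y, cabs (y - g i z) < e -> Om y.
Proof.
apply: (@finite_uniform R L (fun i e => forall z, Om z -> forall y, cabs (y - g i z) < e -> Om y)).
  by move=> i r s _ sr h z Oz y ys; apply: (h z) => //; exact: lt_le_trans sr.
move=> i; have [_ _ /(_ i)[_ _ cl]] := hG.
have gO : g i @` Om `<=` Om by move=> _ [x Ox <-]; exact: ifs_self.
have [r r0 hr] := compact_lebesgue (closure_compact gO) ifs_open cl.
by exists r => // z Oz y; apply: hr; apply: subset_closure; exists z.
Qed.

(* Earle-Hamilton: [x |-> g i x + t (g i x - g i z)] still maps [Om] to itself. *)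
Lemma word_expand : exists2 t : R, 0 < t & forall w z, Om z -> exists H : C -> C,
  [/\ hol Om H, forall x, Om x -> Om (H x), H z = word_map g w z &
      cdiff H z (rc (1 + t) ^+ size w * dword w z)].
Proof.
have [M M0 hM] := ifs_bounded; have [e e0 he] := ifs_margin.
have t0 : 0 < e / (3 * M) by rewrite divr_gt0// mulr_gt0.
(* The perturbation t(g_i x - g_i z') has size at most 2Mt = 2e/3, within the margin e of g_i(Om) in
   Om. *)
exists (e / (3 * M)) => // w z Oz; set t := e / (3 * M) in t0 *.
elim: w => [|i w [H [hH OH Hz dH]]] /=.
  exists id; split=> //; first by move=> x _; exists 1; exact: cdiff_id.
  by rewrite expr0 mul1r; exact: cdiff_id.
pose z' := word_map g w z; have Oz' : Om z' by exact: word_self.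
pose gt x := g i x + rc t * (g i x - g i z').
have dgt x : Om x -> cdiff gt x (rc (1 + t) * dmap i x).
  move=> Ox; have h := dmapP i Ox.
  have := cdiffD h (cdiff_mull (rc t) (cdiff_sub_cst (g i z') h)).
  by rewrite rcD rc1 mulrDl mul1r.
exists (gt \o H); split.
- move=> x Ox; have [d hd] := hH x Ox.
  by eexists; exact: cdiff_comp hd (dgt _ (OH x Ox)).
- move=> x Ox /=; rewrite /gt; apply: (he i (H x) (OH x Ox)).
  rewrite addrAC subrr add0r cabsM cabs_rc gtr0_norm//.
  have b1 := hM _ (ifs_self i (OH x Ox)); have b2 := hM _ (ifs_self i Oz').
  have : cabs (g i (H x) - g i z') <= 2 * M by apply: le_trans (cabsB _ _) _; lra.
  move=> /(ler_wpM2l (ltW t0)) /le_lt_trans; apply.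
  rewrite (_ : t * (2 * M) = 2 / 3 * e); last by rewrite /t; field; rewrite gt_eqF.
  by lra.
- by rewrite /= Hz /gt subrr mulr0 addr0.
- have := cdiff_comp dH (dgt (H z) (OH z Oz)); rewrite Hz -/z'.
  by rewrite exprS; set a := (X in cdiff _ _ X -> _); rewrite (_ : a = rc (1 + t) * rc (1 + t) ^+ size w *
    (dmap i z' * dword w z))// /a; ring.
Qed.

(** The Cauchy estimate for the map of [word_expand] bounds (1+t)^|w| |g_w'| by 4M/h. Radius 7h is
    4h for [mean_value] plus 3h for the derivative estimate at each point. *)
Lemma word_contraction : exists l : R, [/\ 0 < l, l < 1 & exists M : R, 0 < M /\
  forall c h w, 0 < h -> disc c (7 * h) `<=` Om ->
    cabs (dword w c) <= 4 * M / h * l ^+ size w /\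
    forall x y, cabs (x - c) <= h / 96 -> cabs (y - c) <= h / 96 ->
    cabs (word_map g w x - word_map g w y) <= 4 * M / h * l ^+ size w * cabs (x - y)].
Proof.
have [M M0 hM] := ifs_bounded; have [t t0 ht] := word_expand.
have t1 : 0 < 1 + t by lra.
exists (1 + t)^-1; split; [by rewrite invr_gt0|by rewrite invf_lt1//; lra|].
exists M; split=> // c h w h0 cO.
have der x : disc x (3 * h) `<=` Om -> cabs (dword w x) <= 4 * M / h * (1 + t)^-1 ^+ size w.
  move=> xO; have Ox : Om x by apply: xO; apply: disc_center; lra.
  have [H [hH OH _ dH]] := ht w x Ox.
  have := cauchy_estimate h0 (fun y hy => hH y (xO y hy)) (fun y hy => hM _ (OH y (xO y hy))) dH.
  rewrite cabsM cabsX cabs_rc gtr0_norm// => est.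
  by rewrite exprVn ler_pdivlMr ?exprn_gt0// mulrC.
have subx x : cabs (x - c) < 4 * h -> disc x (3 * h) `<=` Om.
  by move=> xc y; rewrite /disc /= => yx; apply: cO; have := cabs_tri x y c; rewrite /disc /=; lra.
split; first by apply: der; apply: subx; rewrite subrr cabs0; lra.
have sub4 : disc c (4 * h) `<=` Om.
  by move=> x; rewrite /disc /= => xc; apply: cO; rewrite /disc /=; lra.
apply: (@mean_value R (word_map g w) c h M _ h0).
- by move=> x /sub4 Ox; exists (dword w x); exact: dwordP.
- by move=> x /sub4 Ox; apply: hM; exact: word_self.
- move=> x d xc hd; have Ox := sub4 x xc.
  by rewrite (cdiff_uniq hd (dwordP w Ox)); apply: der; exact: subx.
Qed.

(** The estimate of [word_contraction] is local. The points whose images approach those of z0 at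
    rate l^|w| form an open set with open complement in Om, hence all of Om by connectedness; this
    passes from discs to arbitrary compact sets. *)
Lemma word_contraction_compact : exists l : R, [/\ 0 < l, l < 1 &
  forall K, compact K -> K `<=` Om -> exists2 B : R, 0 < B & forall w x y, K x -> K y ->
    cabs (word_map g w x - word_map g w y) <= B * l ^+ size w].
Proof.
have [l [l0 l1 [M [M0 hM]]]] := word_contraction.
exists l; split=> // K cK KO.
have [[z0 Oz0] oO cO] : domain Om by case: hG.
have loc z : Om z -> exists r B : R, [/\ 0 < r, 0 < B & forall w x,
    cabs (x - z) <= r -> cabs (word_map g w x - word_map g w z) <= B * l ^+ size w].
  move=> Oz; have [r r0 rO] := open_disc oO Oz.
  have h0 : 0 < r / 7 by lra.
  have rr : 7 * (r / 7) = r by field.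
  exists (r / 7 / 96), (4 * M / (r / 7) * (r / 7 / 96)); split; [lra| |].
    by rewrite mulr_gt0// ?divr_gt0// mulr_gt0.
  move=> w x xz; have := hM z (r / 7) w h0; rewrite rr => /(_ rO)[_ /(_ x z xz)].
  rewrite subrr cabs0 => /(_ ltac:(lra)) h; apply: (le_trans h).
  rewrite [leRHS](_ : _ = 4 * M / (r / 7) * l ^+ size w * (r / 7 / 96)); last by ring.
  apply: ler_wpM2l => //; apply: mulr_ge0; last by rewrite exprn_ge0// ltW.
  by apply: divr_ge0; lra.
pose S := [set z | Om z /\ exists B, forall w,
  cabs (word_map g w z - word_map g w z0) <= B * l ^+ size w].
have trans z x (B1 B2 : R) : (forall w, cabs (word_map g w x - word_map g w z) <= B1 * l ^+ size w) ->
    (forall w, cabs (word_map g w z - word_map g w z0) <= B2 * l ^+ size w) ->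
    (forall w, cabs (word_map g w x - word_map g w z0) <= (B1 + B2) * l ^+ size w).
  move=> h1 h2 w; apply: le_trans (cabs_tri (word_map g w z) _ _) _.
  by rewrite mulrDl lerD.
have oS : open S.
  apply/open_cabs => z [Oz [B hB]]; have [r [B1 [r0 B10 h1]]] := loc z Oz.
  have [r2 r20 r2O] := open_disc oO Oz.
  exists (Num.min r r2); first by rewrite lt_min r0.
  move=> x; rewrite lt_min => /andP[xr xr2]; split; first exact: r2O.
  by exists (B1 + B); apply: trans hB => w; apply: h1; exact: ltW.
have oT : open (Om `\` S).
  apply/open_cabs => z [Oz nS]; have [r [B1 [r0 B10 h1]]] := loc z Oz.
  have [r2 r20 r2O] := open_disc oO Oz.
  exists (Num.min r r2); first by rewrite lt_min r0.
  move=> x; rewrite lt_min => /andP[xr xr2]; split; first exact: r2O.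
  move=> [Ox [B hB]]; apply: nS; split=> //; exists (B1 + B).
  by apply: trans hB => w; rewrite cabs_dist; apply: h1; exact: ltW.
have SO : S = Om.
  apply: cO.
  - by exists z0; split=> //; exists 0 => w; rewrite subrr cabs0 mul0r.
  - by exists S => //; apply/seteqP; split=> [z []|z []].
  - exists (~` (Om `\` S)); first exact: open_closedC.
    apply/seteqP; split=> z; first by move=> Sz; split; [case: Sz|move=> []].
    by move=> [Oz nz]; apply: contrapT => nS; exact: nz.
have [||r r0 hr] := @compact_uniform R K (fun z r => forall w,
    cabs (word_map g w z - word_map g w z0) <= r^-1 * l ^+ size w) cK.
- move=> z r s s0 sr h w; apply: (le_trans (h w)).
  apply: ler_wpM2r; first by rewrite exprn_ge0// ltW.
  by rewrite lef_pV2// posrE; exact: lt_le_trans sr.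
- move=> z /KO Oz; have [r [B1 [r0 B10 h1]]] := loc z Oz.
  have [_ [B hB]] : S z by rewrite SO.
  have B20 : 0 < B1 + `|B| by have := normr_ge0 B; lra.
  exists (B1 + `|B|)^-1, r; split=> //; first by rewrite invr_gt0.
  move=> x xz; rewrite invrK; apply: (trans z) => w; first by apply: h1; exact: ltW.
  apply: (le_trans (hB w)); apply: ler_wpM2r; first by rewrite exprn_ge0// ltW.
  exact: ler_norm.
exists (2 * r^-1); first by rewrite mulr_gt0 ?invr_gt0.
move=> w x y Kx Ky; apply: le_trans (cabs_tri (word_map g w z0) _ _) _.
by have := hr x Kx w; have := hr y Ky w; rewrite (cabs_dist _ (word_map g w y)); lra.
Qed.

End Domain.
End IFS.

(** * The attractor *)

Section Attractor.
Variable R : realType.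
Local Notation C := (Cplx R).
Variables (L : finType) (Om : set C) (g : L -> C -> C) (A : set C).
Implicit Types (w u : seq L) (i j : L).

Definition separated_ifs := [/\ holomorphic_ifs Om g, is_attractor Om g A,
  (exists p q, [/\ A p, A q & p != q]) & strong_separation g A].
Hypothesis H : separated_ifs.

Let hG : holomorphic_ifs Om g. Proof. by case: H. Qed.

Lemma attr_compact : compact A. Proof. by case: H => _ []. Qed.
Lemma attr_sub : A `<=` Om. Proof. by case: H => _ []. Qed.

Lemma attr_step i a : A a -> A (g i a).
Proof.
by case: H => _ [_ _ _ AE] _ _ Aa; rewrite AE; exists i => //; exists a.
Qed.

Lemma attr_split a : A a -> exists i a', A a' /\ a = g i a'.
Proof.
case: H => _ [_ _ _ AE] _ _; rewrite {1}AE => -[i _ [a' Aa' <-]].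
by exists i, a'.
Qed.

Lemma attr_word w a : A a -> A (word_map g w a).
Proof. by move=> Aa; elim: w => //= i w IH; exact: attr_step. Qed.

Lemma attr_code n a : A a -> exists w a', [/\ size w = n, A a' & a = word_map g w a'].
Proof.
elim: n a => [|n IH] a Aa; first by exists [::], a.
have [i [b [Ab ->]]] := attr_split Aa; have [w [a' [sw Aa' ->]]] := IH b Ab.
by exists (i :: w), a'; rewrite /= sw.
Qed.

Lemma attr_bounded : exists2 M : R, 0 < M & forall a, A a -> cabs a <= M.
Proof.
by have [M M0 hM] := ifs_bounded hG; exists M => // a /attr_sub/hM.
Qed.

Lemma attr_uniform (P : C -> R -> Prop) :
  (forall z r s, 0 < s -> s <= r -> P z r -> P z s) ->
  (forall z, A z -> exists r s : R, [/\ 0 < r, 0 < s & forall x, cabs (x - z) < s -> P x r]) ->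
  exists2 r : R, 0 < r & forall z, A z -> P z r.
Proof. exact: compact_uniform attr_compact. Qed.

(** A point of A outside g_i(A) lies in another g_j(A), and finitely many disjoint compact sets have
    positive mutual distance. *)
Lemma attr_sep1 : exists2 e : R, 0 < e & forall i a z, A a -> A z ->
  ~ (g i @` A) z -> e <= cabs (z - g i a).
Proof.
have ci i : compact (g i @` A).
  apply: continuous_compact attr_compact; apply: continuous_in_subspaceT => x.
  rewrite inE => /attr_sub Ox; apply/ccontP; exact: (hol_cont (@ifs_hol _ _ _ _ hG i)).
have [||e e0 he] := @finite_uniform R (L * L)%type (fun p e => p.1 != p.2 ->
    forall a b, A a -> A b -> e <= cabs (g p.2 b - g p.1 a)).
- by move=> p r s _ sr h ne a b Aa Ab; exact: le_trans (h ne a b Aa Ab).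
- move=> [i j] /=; have [->|ij] := eqVneq i j; first by exists 1.
  have [|r r0 hr] := @compact_lebesgue R (g i @` A) (~` (g j @` A)) (ci i)
      (closed_openC (compact_closed (@ci j))).
    move=> _ [x Ax <-] [y Ay E]; have [_ _ _ ssc] := H.
    have := ssc i j Logic.I Logic.I; rewrite /setI /= => h; move/eqP: ij; apply; apply: h.
    by exists (g i x); split; [exists x|exists y].
  exists r => // _ a b Aa Ab; rewrite leNgt; apply/negP => lt.
  by apply: (hr (g i a) _ (g j b) lt); [exists a|exists b].
exists e => // i a z Aa Az nz.
have [j [z' [Az' zE]]] := attr_split Az.
rewrite zE; apply: (he (i, j)) => //=; apply/eqP => ij; apply: nz.
by rewrite zE ij; exists z'.
Qed.

Lemma attr_contraction : exists l : R, [/\ 0 < l, l < 1 & exists h B : R, [/\ 0 < h, 0 < B,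
  (forall w c, A c -> cabs (dword g w c) <= B * l ^+ size w) &
  (forall w c x y, A c -> cabs (x - c) <= h -> cabs (y - c) <= h ->
    cabs (word_map g w x - word_map g w y) <= B * l ^+ size w * cabs (x - y))]].
Proof.
have [l [l0 l1 [M [M0 hM]]]] := word_contraction hG.
have [r r0 hr] := compact_lebesgue attr_compact (ifs_open hG) attr_sub.
exists l; split=> //; exists (r / 7 / 96), (4 * M / (r / 7)).
have h0 : 0 < r / 7 by lra.
have sub c : A c -> disc c (7 * (r / 7)) `<=` Om.
  by move=> Ac x; rewrite /disc /= (_ : 7 * (r / 7) = r); [exact: hr|field].
split; [lra| | |].
- by rewrite !divr_gt0 ?mulr_gt0.
- by move=> w c /sub cO; have [] := hM c (r / 7) w h0 cO.
- by move=> w c x y /sub cO; have [_] := hM c (r / 7) w h0 cO; exact.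
Qed.

Lemma attr_diam : exists l : R, [/\ 0 < l, l < 1 & exists2 B : R, 0 < B &
  forall w x y, A x -> A y -> cabs (word_map g w x - word_map g w y) <= B * l ^+ size w].
Proof.
have [l [l0 l1 hl]] := word_contraction_compact hG.
by exists l; split=> //; exact: hl attr_compact attr_sub.
Qed.

Lemma attr_second : exists r K : R, [/\ 0 < r, 0 < K & forall i c x y, A c ->
  cabs (x - c) <= r -> cabs (y - c) <= r ->
  cabs (g i x - g i y - dmap g i c * (x - y)) <=
    K * (cabs (x - c) + cabs (y - c)) * cabs (x - y)].
Proof.
have [M M0 hM] := ifs_bounded hG.
have [r r0 hr] := compact_lebesgue attr_compact (ifs_open hG) attr_sub.
have h0 : 0 < r / 4 by lra.
exists (r / 4 / 96), (576 * M / (r / 4) ^+ 2); split; [lra| |].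
  by apply: divr_gt0; [lra|exact: exprn_gt0].
move=> i c x y Ac xc yc.
have cO : disc c (4 * (r / 4)) `<=` Om.
  by move=> z; rewrite /disc /= (_ : 4 * (r / 4) = r); [exact: hr|field].
apply: (@second_order2 R (g i) c _ (r / 4) M h0) => //.
- by move=> z /cO Oz; exact: (@ifs_hol _ _ _ _ hG i z Oz).
- by move=> z /cO Oz; apply: hM; exact: (ifs_self hG).
- by apply: (dmapP hG); exact: attr_sub.
Qed.

Lemma attr_deriv_bounds : exists c1 c2 : R, [/\ 0 < c1, 0 < c2 & forall i a, A a ->
  c1 <= cabs (dmap g i a) <= c2].
Proof.
have [l [l0 l1 [h [B [h0 B0 hB _]]]]] := attr_contraction.
have [r [K [r0 K0 hK]]] := attr_second.
have [||c1 c10 hc1] := @finite_uniform R L (fun i r => forall a, A a -> r <= cabs (dmap g i a)).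
- by move=> i s t _ ts h' a Aa; exact: le_trans (h' a Aa).
- move=> i; have [||c c0 hc] := @attr_uniform (fun a r => A a -> r <= cabs (dmap g i a)).
  + by move=> z s t _ ts h' a; exact: le_trans (h' a).
  + move=> z Az.
    have dz0 : 0 < cabs (dmap g i z).
      rewrite cabs_gt0; have := dword_neq0 hG [:: i] (attr_sub Az).
      by rewrite /= mulr1.
    (* By [attr_second] the derivative varies by at most K(2s + s) within s of z, and 3Ks is at most
       half its modulus at z. *)
    pose s := Num.min (r / 2) (cabs (dmap g i z) / (6 * K)).
    have s0 : 0 < s by rewrite /s lt_min !divr_gt0// mulr_gt0.
    have sr : s <= r / 2 by rewrite /s ge_min lexx.
    have sd : s * (6 * K) <= cabs (dmap g i z).
      by rewrite -ler_pdivlMr ?mulr_gt0// /s ge_min lexx orbT.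
    exists (cabs (dmap g i z) / 2), s; split=> //; first by lra.
    move=> x xz Ax.
    have dF := cdiffB (dmapP hG i (attr_sub Ax)) (cdiff_mull (dmap g i z) (@cdiff_id R x)).
    have := @bound_of_lipschitz R _ x _ (3 * K * s) s s0 dF.
    rewrite mulr1 => bl.
    have {}bl : cabs (dmap g i x - dmap g i z) <= 3 * K * s.
      apply: bl => y yx; have yz : cabs (y - z) <= 2 * s by have := cabs_tri x y z; lra.
      have := hK i z y x Az ltac:(lra) ltac:(lra).
      rewrite (_ : g i y - dmap g i z * id y - (g i x - dmap g i z * id x) =
        g i y - g i x - dmap g i z * (y - x)); last by rewrite /=; ring.
      move=> /le_trans; apply; apply: ler_wpM2r; first exact: cabs_ge0.
      by rewrite -mulrA mulrCA; apply: ler_wpM2l; [exact: ltW|lra].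
    have := cabs_tri (dmap g i x) (dmap g i z) 0; rewrite !subr0 cabs_dist; lra.
  by exists c => // a Aa; apply: hc.
exists c1, (B * l); split=> //; first by rewrite mulr_gt0.
by move=> i a Aa; rewrite hc1//=; have := hB [:: i] a Aa; rewrite /= mulr1 expr1.
Qed.

(** Each letter adds a relative error proportional to the current diameter, which decreases like
    l^n; the errors are summable, so the radius r does not depend on the word. *)
Lemma attr_distortion (e : R) : 0 < e -> e < 1 -> exists2 r : R, 0 < r &
  forall w c x y, A c -> cabs (x - c) <= r -> cabs (y - c) <= r ->
  cabs (word_map g w x - word_map g w y - dword g w c * (x - y)) <=
    e * cabs (dword g w c) * cabs (x - y).
Proof.
move=> e0 e1.
have [l [l0 l1 [h [B [h0 B0 _ hB]]]]] := attr_contraction.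
have [r [K [r0 K0 hK]]] := attr_second.
have [c1 [c2 [c10 c20 hc]]] := attr_deriv_bounds.
pose q := 2 * K / c1 * B.
have q0 : 0 < q by rewrite /q !mulr_gt0 ?invr_gt0.
pose s := Num.min h (Num.min (r / B) (e / 2 * (1 - l) / q)).
have l10 : 0 < 1 - l by lra.
have s0 : 0 < s.
  rewrite /s !lt_min h0 divr_gt0//= divr_gt0// mulr_gt0//; lra.
have [sh sr sq] : [/\ s <= h, B * s <= r & q * s <= e / 2 * (1 - l)].
  rewrite (mulrC B) (mulrC q) -!ler_pdivlMr//.
  by rewrite /s !ge_min !lexx !orbT.
exists s => // w c x y Ac xc yc.
(* The sum of the first n one-letter errors q s l^m. Being at most e/2, it yields 1 + E <= 1/(1 -
   e/2), hence E <= e because e < 1. *)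
pose S n := q * s * (1 - l ^+ n) / (1 - l).
have S_le n : S n <= e / 2.
  rewrite /S ler_pdivrMr//; apply: le_trans sq; rewrite -[leRHS]mulr1.
  by apply: ler_wpM2l; [rewrite mulr_ge0// ltW|rewrite gerBl exprn_ge0// ltW].
have S_ge n : 0 <= S n.
  apply: divr_ge0; last exact: ltW.
  apply: mulr_ge0; first by apply: mulr_ge0; exact: ltW.
  by rewrite subr_ge0; apply: exprn_ile1; exact: ltW.
have Ss n : S n.+1 = S n + q * s * l ^+ n.
  by rewrite /S exprS; field; rewrite gt_eqF.
have xy0 := cabs_ge0 (x - y).
(* telescoping form of the product of the factors [1 + q s l ^ n] *)
have main : exists2 E : R, 0 <= E /\ (1 - S (size w)) * (1 + E) <= 1 &
   cabs (word_map g w x - word_map g w y - dword g w c * (x - y)) <=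
   E * cabs (dword g w c) * cabs (x - y).
  elim: w => [|i w [E [E0 SE] IH]] /=.
    exists 0; first by split=> //; rewrite /S expr0 subrr mulr0 mul0r; lra.
    by rewrite mul1r subrr cabs0 !mul0r.
  set x' := word_map g w x; set y' := word_map g w y; set c' := word_map g w c.
  set d := dmap g i c'; set dw := dword g w c.
  have ln0 : 0 <= l ^+ size w by rewrite exprn_ge0// ltW.
  have ln1 : l ^+ size w <= 1 by apply: exprn_ile1; exact: ltW.
  have Ac' : A c' by exact: attr_word.
  have cc : cabs (c - c) <= h by rewrite subrr cabs0 ltW.
  have near z : cabs (z - c) <= s -> cabs (word_map g w z - c') <= B * l ^+ size w * s.
    move=> zs; apply: le_trans (hB w c z c Ac (le_trans zs sh) cc) _.
    by apply: ler_wpM2l => //; rewrite mulr_ge0// ltW.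
  have xc' := near x xc; have yc' := near y yc.
  have Bls : B * l ^+ size w * s <= r.
    apply: le_trans sr; rewrite -mulrA; apply: ler_wpM2l; first exact: ltW.
    by rewrite -[leRHS]mul1r; apply: ler_wpM2r => //; exact: ltW.
  have := hK i c' x' y' Ac' (le_trans xc' Bls) (le_trans yc' Bls).
  rewrite -/d => st; have /andP[d1 d2] := hc i c' Ac'.
  set a := q * s * l ^+ size w.
  have a0 : 0 <= a by apply: mulr_ge0 => //; apply: mulr_ge0; exact: ltW.
  have st2 : cabs (g i x' - g i y' - d * (x' - y')) <= a * cabs d * cabs (x' - y').
    apply: (le_trans st); apply: ler_wpM2r; first exact: cabs_ge0.
    apply: (@le_trans _ _ (K * (2 * (B * l ^+ size w * s)))).
      by apply: ler_wpM2l; [exact: ltW|lra].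
    rewrite (_ : K * (2 * (B * l ^+ size w * s)) = a * c1); last first.
      by rewrite /a /q; field; rewrite gt_eqF.
    exact: ler_wpM2l.
  have st3 : cabs (x' - y') <= (1 + E) * (cabs dw * cabs (x - y)).
    have := cabsD (x' - y' - dw * (x - y)) (dw * (x - y)); rewrite subrK cabsM.
    by move: IH; rewrite -/x' -/y' -/dw; lra.
  exists (E + a * (1 + E)).
    split; first by rewrite addr_ge0// mulr_ge0//; lra.
    rewrite Ss -/a; have Sn0 := S_ge (size w); apply: le_trans SE.
    rewrite (_ : (1 - (S (size w) + a)) * (1 + (E + a * (1 + E))) = (1 - S (size w)) * (1 + E) -
      (S (size w) * a + a * a) * (1 + E)); last by ring.
    rewrite gerBl; apply: mulr_ge0; last by lra.
    by apply: addr_ge0; exact: mulr_ge0.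
  rewrite (_ : g i x' - g i y' - d * dw * (x - y) =
    (g i x' - g i y' - d * (x' - y')) + d * (x' - y' - dw * (x - y))); last by ring.
  apply: le_trans (cabsD _ _) _; rewrite !cabsM.
  have t1 : a * cabs d * cabs (x' - y') <= a * cabs d * ((1 + E) * (cabs dw * cabs (x - y))).
    by apply: ler_wpM2l => //; rewrite mulr_ge0 ?cabs_ge0.
  have t2 : cabs d * cabs (x' - y' - dw * (x - y)) <= cabs d * (E * cabs dw * cabs (x - y)).
    by apply: ler_wpM2l => //; exact: cabs_ge0.
  rewrite [leRHS](_ : _ = a * cabs d * ((1 + E) * (cabs dw * cabs (x - y))) +
    cabs d * (E * cabs dw * cabs (x - y))); last by ring.
  lra.
have [E [E0 SE] hE] := main.
apply: (le_trans hE); apply: ler_wpM2r => //; apply: ler_wpM2r; first exact: cabs_ge0.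
have := S_le (size w); have := S_ge (size w); nra.
Qed.

End Attractor.

(** * Bi-Lipschitz and gap estimates on the attractor, uniform in the word *)

Section AttractorMetric.
Variable R : realType.
Local Notation C := (Cplx R).
Variables (L : finType) (Om : set C) (g : L -> C -> C) (A : set C).
Implicit Types (w u : seq L) (i j : L).
Hypothesis H : separated_ifs Om g A.

Let hG : holomorphic_ifs Om g. Proof. by case: H. Qed.

(** By [open_mapping] the values near g_i(z) are all attained close to z, so by injectivity no
    distant point can take one of them. *)
Lemma attr_far (r : R) : 0 < r -> exists2 m : R, 0 < m & forall i z y, A z -> A y ->
  r <= cabs (y - z) -> m <= cabs (g i y - g i z).
Proof.
move=> r0.
have [||m m0 hm] := @finite_uniform R L (fun i m => forall z y, A z -> A y ->
  r <= cabs (y - z) -> m <= cabs (g i y - g i z)).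
- by move=> i s t _ ts h z y Az Ay yz; exact: le_trans (h z y Az Ay yz).
- move=> i; have [||m m0 hm] := attr_uniform H (P := fun z m => A z -> forall y, A y ->
    r <= cabs (y - z) -> m <= cabs (g i y - g i z)).
  + by move=> z s t _ ts h Az y Ay yz; exact: le_trans (h Az y Ay yz).
  + move=> z Az; have Oz := attr_sub H Az; have r2 : 0 < r / 2 by lra.
    have [e e0 he] := open_mapping (ifs_open hG) (@ifs_hol _ _ _ _ hG i) (@ifs_inj _ _ _ _ hG i) Oz r2.
    have e2 : 0 < e / 2 by lra.
    have [s s0 hs] := hol_cont (@ifs_hol _ _ _ _ hG i) Oz e2.
    exists (e / 2), (Num.min s (r / 2)); split=> //; first by rewrite lt_min s0.
    move=> x; rewrite lt_min => /andP[/hs xs xr] Ax y Ay yx; rewrite leNgt; apply/negP => lt.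
    have [] := he (g i y); first by have := cabs_tri (g i x) (g i y) (g i z); lra.
    move=> x' [x'z Ox' E].
    have x'y : x' = y by apply: (@ifs_inj _ _ _ _ hG i) => //; rewrite inE//; exact: (attr_sub H Ay).
    by move: x'z; rewrite x'y; have := cabs_tri z y x; rewrite (cabs_dist z x); lra.
  by exists m => // z y Az; exact: hm.
by exists m.
Qed.

Lemma attr_bilip1 : exists2 K : R, 1 <= K & forall i y z, A y -> A z ->
  cabs (dmap g i z) * cabs (y - z) <= K * cabs (g i y - g i z) /\
  cabs (g i y - g i z) <= K * cabs (dmap g i z) * cabs (y - z).
Proof.
have [M M0 hM] := attr_bounded H.
have [c1 [c2 [c10 c20 hc]]] := attr_deriv_bounds H.
have [||r r0 hr] := @attr_distortion R L Om g A H 2^-1; [lra|lra|].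
have [m m0 hm] := attr_far r0.
(* The term 2 serves pairs closer than r, by distortion with error 1/2; for distant pairs the other
   two terms serve the upper and the lower bound. *)
exists (2 + 2 * M / (c1 * r) + 2 * M * c2 / m).
  by have := divr_ge0 (_ : 0 <= 2 * M) (ltW (mulr_gt0 c10 r0));
     have := divr_ge0 (_ : 0 <= 2 * M * c2) (ltW m0); nra.
move=> i y z Ay Az.
have k1 : 0 <= 2 * M / (c1 * r) by apply: divr_ge0; [lra|apply: mulr_ge0; lra].
have k2 : 0 <= 2 * M * c2 / m by apply: divr_ge0; [apply: mulr_ge0; lra|lra].
have [K1 K1E] : {x | x = 2 * M / (c1 * r)} by eexists.
have [K2 K2E] : {x | x = 2 * M * c2 / m} by eexists.
rewrite -K1E -K2E in k1 k2 *.
have d0 := cabs_ge0 (dmap g i z); have yz0 := cabs_ge0 (y - z).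
have g0 := cabs_ge0 (g i y - g i z).
have dyz := mulr_ge0 d0 yz0.
have [near|far] := leP (cabs (y - z)) r.
  have zz : cabs (z - z) <= r by rewrite subrr cabs0 ltW.
  have := hr [:: i] z y z Az near zz; rewrite /= mulr1 => est.
  have := cabsD (g i y - g i z - dmap g i z * (y - z)) (dmap g i z * (y - z)).
  rewrite subrK cabsM => up.
  have := cabsB (g i y - g i z) (g i y - g i z - dmap g i z * (y - z)).
  rewrite [X in cabs X <= _](_ : _ = dmap g i z * (y - z)); last by ring.
  rewrite cabsM => lo.
  have a1 := mulr_ge0 k1 g0; have a2 := mulr_ge0 k2 g0.
  have a3 := mulr_ge0 k1 dyz; have a4 := mulr_ge0 k2 dyz.
  by split; lra.
have /andP[d1 d2] := hc i z Az.
have yzM : cabs (y - z) <= 2 * M.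
  by apply: le_trans (cabsB _ _) _; have := hM _ Ay; have := hM _ Az; lra.
have gM : cabs (g i y - g i z) <= 2 * M.
  by apply: le_trans (cabsB _ _) _; have := hM _ (attr_step H i Ay);
    have := hM _ (attr_step H i Az); lra.
have gm := hm i z y Az Ay (ltW far).
split.
  have : cabs (dmap g i z) * cabs (y - z) <= c2 * (2 * M) by apply: ler_pM.
  have : c2 * (2 * M) = K2 * m by rewrite K2E; field; rewrite gt_eqF.
  have : K2 * m <= K2 * cabs (g i y - g i z) by exact: ler_wpM2l.
  by have a1 := mulr_ge0 k1 g0; lra.
have : 2 * M = K1 * (c1 * r) by rewrite K1E; field; rewrite !gt_eqF.
have : K1 * (c1 * r) <= K1 * (cabs (dmap g i z) * cabs (y - z)).
  by apply: ler_wpM2l => //; apply: ler_pM => //; exact: ltW.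
by have a4 := mulr_ge0 k2 dyz; lra.
Qed.

Lemma attr_bilip_size : exists2 K : R, 1 <= K & forall w y z, A y -> A z ->
  cabs (dword g w z) * cabs (y - z) <= K ^+ size w * cabs (word_map g w y - word_map g w z) /\
  cabs (word_map g w y - word_map g w z) <= K ^+ size w * cabs (dword g w z) * cabs (y - z).
Proof.
have [K K1 hK] := attr_bilip1; exists K => // w y z Ay Az.
have K0 : 0 <= K by lra.
elim: w => [|i w [IH1 IH2]]; first by rewrite expr0 -[dword g [::] z]/(1 : C) cabs1 !mul1r.
rewrite /=.
have [h1 h2] := hK i _ _ (attr_word H w Ay) (attr_word H w Az).
have Kn : 0 <= K ^+ size w by exact: exprn_ge0.
rewrite !cabsM exprS; split.
  rewrite -mulrA; apply: le_trans (ler_wpM2l (cabs_ge0 _) IH1) _.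
  by have := ler_wpM2l Kn h1; lra.
apply: (le_trans h2).
have := ler_wpM2l (mulr_ge0 K0 (cabs_ge0 (dmap g i (word_map g w z)))) IH2.
by move=> /le_trans; apply; rewrite le_eqVlt; apply/orP; left; apply/eqP; ring.
Qed.

(** The last n0 letters, applied first, bring A below the distortion radius at the cost K^n0 of
    [attr_bilip_size]; the remaining letters cost only a factor 2. *)
Lemma attr_bilip : exists2 K : R, 1 <= K & forall w y z, A y -> A z ->
  cabs (dword g w z) * cabs (y - z) <= K * cabs (word_map g w y - word_map g w z) /\
  cabs (word_map g w y - word_map g w z) <= K * cabs (dword g w z) * cabs (y - z).
Proof.
have [K K1 hK] := attr_bilip_size.
have [||r r0 hr] := @attr_distortion R L Om g A H 2^-1; [lra|lra|].
have [l [l0 l1 [B B0 hB]]] := attr_diam H.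
have [|n0 hn0] := @geometric_small R l B r _ r0; first by rewrite (ltW l0).
have K0 : 0 <= K by lra.
exists (2 * K ^+ n0); first by have := exprn_ege1 n0 K1; lra.
move=> w y z Ay Az.
pose u := drop (size w - n0) w; pose v := take (size w - n0) w.
have wE : w = v ++ u by rewrite cat_take_drop.
have su : (size u <= n0)%N by rewrite size_drop; lia.
have Ku : K ^+ size u <= K ^+ n0 by exact: ler_weXn2l.
have [u1 u2] := hK u y z Ay Az.
have Kn0 : 0 <= K ^+ n0 by exact: exprn_ge0.
set y' := word_map g u y; set z' := word_map g u z.
have Az' : A z' by exact: (attr_word H).
have key : cabs (dword g v z') * cabs (y' - z') <= 2 * cabs (word_map g v y' - word_map g v z') /\
  cabs (word_map g v y' - word_map g v z') <= 2 * (cabs (dword g v z') * cabs (y' - z')).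
  have d0 := mulr_ge0 (cabs_ge0 (dword g v z')) (cabs_ge0 (y' - z')).
  have [v0|v0] := posnP (size v).
    rewrite (size0nil v0) -[dword g [::] _]/(1 : C) cabs1 !mul1r /=; have := cabs_ge0 (y' - z'); lra.
  have su' : size u = n0.
    have := v0; rewrite /v size_take_min /u size_drop; lia.
  have near : cabs (y' - z') <= r.
    by apply: le_trans (hB u y z Ay Az) _; apply: ltW; apply: hn0; rewrite su'.
  have zz : cabs (z' - z') <= r by rewrite subrr cabs0 ltW.
  have est := hr v z' y' z' Az' near zz.
  have := cabsD (word_map g v y' - word_map g v z' - dword g v z' * (y' - z')) (dword g v z' * (y' - z')).
  rewrite subrK cabsM => up.
  have := cabsB (word_map g v y' - word_map g v z') (word_map g v y' - word_map g v z' - dword g v z' * (y' - z')).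
  rewrite [X in cabs X <= _](_ : _ = dword g v z' * (y' - z')); last by ring.
  rewrite cabsM => lo.
  by split; lra.
have [k1 k2] := key.
rewrite wE !word_map_cat dword_cat cabsM -/y' -/z'.
have v0 := cabs_ge0 (dword g v z').
split.
  have t1 : cabs (dword g v z') * (cabs (dword g u z) * cabs (y - z)) <=
    cabs (dword g v z') * (K ^+ n0 * cabs (y' - z')).
    by apply: ler_wpM2l => //; apply: (le_trans u1); apply: ler_wpM2r => //; exact: cabs_ge0.
  have t2 := ler_wpM2l Kn0 k1.
  rewrite -mulrA; apply: (le_trans t1); lra.
have t1 : cabs (dword g v z') * cabs (y' - z') <=
    cabs (dword g v z') * (K ^+ n0 * cabs (dword g u z) * cabs (y - z)).
  apply: ler_wpM2l => //; apply: (le_trans u2); rewrite -!mulrA; apply: ler_wpM2r => //.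
  by rewrite mulr_ge0// cabs_ge0.
by apply: (le_trans k2); lra.
Qed.

Lemma attr_perfect c (s : R) : A c -> 0 < s -> exists y, [/\ A y, y != c & cabs (y - c) < s].
Proof.
move=> Ac s0; have [l [l0 l1 [B B0 hB]]] := attr_diam H.
have [|n hn] := @geometric_small R l B s _ s0; first by rewrite (ltW l0).
have [w [a [sw Aa cE]]] := attr_code H n Ac.
have [q Aq qa] : exists2 q, A q & q != a.
  have [_ _ [p [q [Ap Aq pq]]] _] := H.
  have [pa|pa] := eqVneq p a; last by exists p.
  by exists q => //; rewrite -pa eq_sym.
exists (word_map g w q); split; first exact: (attr_word H).
  apply: contra_neq qa; rewrite cE => E; apply: (@word_inj _ _ _ _ hG w) => //;
    rewrite inE; exact: (attr_sub H).
rewrite cE; apply: le_lt_trans (hB w q a Aq Aa) _; rewrite sw; exact: hn.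
Qed.

Lemma word_split_off w z : A z -> ~ (word_map g w @` A) z -> exists w1 j w2 z',
  [/\ w = w1 ++ j :: w2, z = word_map g w1 z', A z' & ~ (g j @` A) z'].
Proof.
elim: w z => [|i w IH] z Az nz; first by exfalso; apply: nz; exists z.
have [|ni] := pselect ((g i @` A) z); last by exists [::], i, w, z.
move=> [z' Az' zE].
have [|w1 [j [w2 [z2 [wE z2E Az2 nz2]]]]] := IH z' Az'.
  by move=> [a Aa aE]; apply: nz; exists a => //=; rewrite aE.
by exists (i :: w1), j, w2, z2; rewrite wE /= -z2E.
Qed.

(** Cut w at the letter where the code of z leaves it: there the gap of [attr_sep1] holds, and the
    common prefix rescales it by its derivative, up to the constant of [attr_bilip]. *)
Lemma attr_gap : exists2 e : R, 0 < e & forall w a z, A a -> A z ->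
  ~ (word_map g w @` A) z -> e * cabs (dword g w a) <= cabs (z - word_map g w a).
Proof.
have [e e0 he] := attr_sep1 H; have [K K1 hK] := attr_bilip.
have [l [l0 l1 [h [B [h0 B0 hB _]]]]] := attr_contraction H.
have KB : 0 < K * B by rewrite mulr_gt0//; lra.
exists (e / (K * B)); first by rewrite divr_gt0.
move=> w a z Aa Az nz.
have [w1 [j [w2 [z' [wE zE Az' nz']]]]] := word_split_off Az nz.
have Ab : A (word_map g w2 a) by exact: (attr_word H).
pose b := g j (word_map g w2 a); have Ab' : A b by exact: (attr_step H).
have ez := he j _ z' Ab Az' nz'; rewrite -/b in ez.
have [k1 _] := hK w1 z' b Az' Ab'.
rewrite wE word_map_cat dword_cat zE /= -/b.
have dB : cabs (dword g (j :: w2) a) <= B.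
  apply: le_trans (hB (j :: w2) a Aa) _; rewrite -[leRHS]mulr1; apply: ler_wpM2l; first exact: ltW.
  by apply: exprn_ile1; exact: ltW.
move: dB => /=; rewrite -/b; set d2 := dmap g j _ * dword g w2 a => dB.
rewrite cabsM mulrAC ler_pdivrMr//.
have d10 := cabs_ge0 (dword g w1 b).
have t1 : e * (cabs (dword g w1 b) * cabs d2) <= e * (cabs (dword g w1 b) * B).
  by apply: ler_wpM2l; [exact: ltW|exact: ler_wpM2l].
have t2 : cabs (dword g w1 b) * e <= cabs (dword g w1 b) * cabs (z' - b) by exact: ler_wpM2l.
have t3 : cabs (dword g w1 b) * e * B <= K * cabs (word_map g w1 z' - word_map g w1 b) * B.
  by apply: ler_wpM2r; [exact: ltW|lra].
lra.
Qed.

Lemma attr_deriv_lower : exists c1 : R, [/\ 0 < c1, c1 <= 1 & forall w a, A a ->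
  c1 ^+ size w <= cabs (dword g w a)].
Proof.
have [c1 [c2 [c10 c20 hc]]] := attr_deriv_bounds H.
exists (Num.min c1 1); split; [by rewrite lt_min c10 ltr01|by rewrite ge_min lexx orbT|].
have m0 : 0 <= Num.min c1 1 by rewrite le_min ler01 andbT ltW.
move=> w a Aa; elim: w => [|i w IH]; first by rewrite -[dword g [::] _]/(1 : C) cabs1.
rewrite /=.
rewrite exprS cabsM; apply: ler_pM => //; first exact: exprn_ge0.
have /andP[h _] := hc i _ (attr_word H w Aa).
by apply: le_trans h; rewrite ge_min lexx.
Qed.

End AttractorMetric.

(** * Rigidity of matched pairs *)

Section Buckets.
Variable R : realType.
Local Notation C := (Cplx R).

Lemma finite_buckets (M e : R) : 0 < e -> exists (T : finType) (cl : C -> T),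
  forall x y, cabs x <= M -> cabs y <= M -> cl x = cl y -> cabs (x - y) <= e.
Proof.
move=> e0; have [t t0 t2] : exists2 t : R, 0 < t & 2 * t = e by exists (e / 2); lra.
pose n := Num.truncn (2 * M / t).
pose b (x : R) : 'I_n.+1 := inord (Num.truncn ((x + M) / t)).
have bP (x y : R) : `|x| <= M -> `|y| <= M -> b x = b y -> `|x - y| <= t.
  rewrite !ler_norml => /andP[x1 x2] /andP[y1 y2] /(congr1 val).
  have bnd z : - M <= z -> z <= M -> [/\ 0 <= (z + M) / t,
      (Num.truncn ((z + M) / t) <= n)%N & val (b z) = Num.truncn ((z + M) / t)].
    move=> z1 z2; have h0 : 0 <= (z + M) / t by apply: divr_ge0; lra.
    have h1 : (Num.truncn ((z + M) / t) <= n)%N.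
      by apply: le_truncn; rewrite ler_pM2r ?invr_gt0//; lra.
    by split=> //; rewrite /b /= inordK.
  have [x0 xn ->] := bnd x x1 x2; have [y0 yn ->] := bnd y y1 y2 => E.
  have /andP[] := truncn_itv x0; have /andP[] := truncn_itv y0; rewrite E.
  rewrite !ler_pdivlMr// !ltr_pdivrMr//.
  set m := Num.truncn _; rewrite -(natr1 m) !mulrDl mul1r => *.
  by apply/andP; split; lra.
exists ('I_n.+1 * 'I_n.+1)%type, (fun x => (b (complex.Re x), b (complex.Im x))).
move=> x y xM yM [E1 E2].
have Re_le z : cabs z <= M -> `|complex.Re z| <= M by apply: le_trans; exact: ReE_le.
have Im_le z : cabs z <= M -> `|complex.Im z| <= M by apply: le_trans; exact: ImE_le.
have r1 := bP _ _ (Re_le _ xM) (Re_le _ yM) E1; have r2 := bP _ _ (Im_le _ xM) (Im_le _ yM) E2.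
apply: le_trans (cabs_le_ReIm _) _.
have -> : complex.Re (x - y) = complex.Re x - complex.Re y by case: (x) => ? ?; case: (y).
have -> : complex.Im (x - y) = complex.Im x - complex.Im y by case: (x) => ? ?; case: (y).
by apply: le_trans (lerD r1 r2) _; lra.
Qed.

(** One point of A is chosen in each cell that meets A, so that the net lies in A, where the maps h
    are controlled. *)
Lemma finite_net (A : set C) (M e : R) : A !=set0 -> (forall x, A x -> cabs x <= M) -> 0 < e ->
  exists (T : finType) (net : T -> C), (forall t, A (net t)) /\
  forall x, A x -> exists t, cabs (x - net t) <= e.
Proof.
move=> [x0 Ax0] hM e0; have [T [cl hcl]] := finite_buckets M e0.
have ex t : exists c, A c /\ forall x, A x -> cl x = t -> cl c = t.
  have [[x [Ax xt]]|no] := pselect (exists x, A x /\ cl x = t); first by exists x.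
  by exists x0; split=> // x Ax xt; exfalso; apply: no; exists x.
have [net hnet] := choice ex.
exists T, net; split=> [t|x Ax]; first by have [] := hnet t.
exists (cl x); have [An /(_ x Ax erefl) E] := hnet (cl x).
by apply: hcl => //; exact: hM.
Qed.

(** Iterating the step n times moves phi by n tau up to n|tau|/2, which leaves every bounded set
    unless tau = 0. *)
Lemma no_translation (X : Type) (S : set X) (phi : X -> C) (M : R) (tau : C) :
  S !=set0 -> (forall s, S s -> cabs (phi s) <= M) ->
  (forall s, S s -> exists2 s', S s' & cabs (phi s' - phi s - tau) <= cabs tau / 2) ->
  tau = 0.
Proof.
move=> [s0 Ss0] hM step; apply/eqP; rewrite -cabs_eq0; apply/negPn/negP => t0.
have {}t0 : 0 < cabs tau by rewrite lt_def t0 cabs_ge0.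
have it n : exists2 s, S s & cabs (phi s - phi s0 - n%:R * tau) <= n%:R * (cabs tau / 2).
  elim: n => [|n [s Ss hs]]; first by exists s0 => //; rewrite subrr !mul0r subrr cabs0.
  have [s' Ss' hs'] := step s Ss; exists s' => //.
  rewrite (_ : phi s' - phi s0 - n.+1%:R * tau =
    (phi s' - phi s - tau) + (phi s - phi s0 - n%:R * tau)); last first.
    by rewrite -natr1; ring.
  by apply: le_trans (cabsD _ _) _; rewrite -(natr1 n) mulrDl mul1r; lra.
pose n := Num.truncn (4 * M / cabs tau).
have [s Ss hs] := it n.+1.
have : n.+1%:R * cabs tau <= n.+1%:R * (cabs tau / 2) + 2 * M.
  rewrite -{1}(cabs_nat R n.+1) -cabsM.
  rewrite (_ : n.+1%:R * tau = (phi s - phi s0) - (phi s - phi s0 - n.+1%:R * tau)); last by ring.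
  apply: le_trans (cabsB _ _) _; have := cabsB (phi s) (phi s0).
  have := hM _ Ss; have := hM _ Ss0; lra.
have M0 : 0 <= M by apply: le_trans (hM _ Ss0); exact: cabs_ge0.
have : 4 * M / cabs tau < n.+1%:R.
  by have /andP[] := truncn_itv (divr_ge0 (mulr_ge0 (ler0n _ 4) M0) (ltW t0)).
rewrite ltr_pdivrMr//; lra.
Qed.

End Buckets.

(** * Uniform estimates for the maps f_v^-1 g_w on a common attractor *)

Section CommonAttractor.
Variable R : realType.
Local Notation C := (Cplx R).
Variables (LG LF : finType) (OmG OmF : set C) (g : LG -> C -> C) (f : LF -> C -> C) (A : set C).
Hypothesis HG : separated_ifs OmG g A.
Hypothesis HF : separated_ifs OmF f A.
Implicit Types (w u : seq LG) (v : seq LF) (h : C -> C).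

(* [h] is f_v^-1 \o g_w on [A], with derivative comparable to 1. *)
Definition matched (k : R) w v h := forall a, A a ->
  [/\ A (h a), word_map f v (h a) = word_map g w a,
      cabs (dword g w a) <= k * cabs (dword f v (h a)) &
      cabs (dword f v (h a)) <= k * cabs (dword g w a)].

Let hG : holomorphic_ifs OmG g. Proof. by case: HG. Qed.
Let hF : holomorphic_ifs OmF f. Proof. by case: HF. Qed.

(** The lengths of admissible v are bounded because f_v(A) shrinks with |v| while g_w(p) and g_w(q)
    stay distinct. Each derivative bound compares two points that one of the two words carries far
    enough apart. *)
Lemma match_exists : exists2 k : R, 0 < k & forall w, exists v h, matched k w v h.
Proof.
have [Kg Kg1 hKg] := attr_bilip HG; have [Kf Kf1 hKf] := attr_bilip HF.
have [e e0 he] := attr_sep1 HF; have [M M0 hM] := attr_bounded HG.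
have [_ _ [p [q [Ap Aq pq]]] _] := HG.
have pq0 : 0 < cabs (p - q) by rewrite cabs_gt0 subr_eq0.
pose eta := cabs (p - q) / 2; have eta0 : 0 < eta by rewrite /eta; lra.
have KK : 0 < Kg * Kf * (2 * M) by rewrite !mulr_gt0//; lra.
exists (Kg * Kf * (2 * M) / Num.min e eta); first by rewrite divr_gt0// lt_min e0.
move=> w.
pose P n := `[< exists v, size v = n /\ forall a, A a -> exists b, A b /\
  word_map f v b = word_map g w a >].
have exP : exists n, P n.
  exists 0%N; apply/asboolP; exists [::]; split=> // a Aa.
  by exists (word_map g w a); split=> //; exact: (attr_word HG).
have [l [l0 l1 [B B0 hB]]] := attr_diam HF.
have wpq : 0 < cabs (word_map g w p - word_map g w q).
  rewrite cabs_gt0 subr_eq0; apply: contra_neq pq => E.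
  by apply: (@word_inj _ _ _ _ hG w) => //; rewrite inE; exact: (attr_sub HG).
have [|n0 hn0] := @geometric_small R l B _ _ wpq; first by rewrite (ltW l0).
have ub n : P n -> (n <= n0)%N.
  move=> /asboolP[v [sv hv]]; rewrite leqNgt; apply/negP => nn.
  have [b [Ab bE]] := hv p Ap; have [b' [Ab' bE']] := hv q Aq.
  have := hB v b b' Ab Ab'; rewrite bE bE' sv.
  by have := hn0 n (ltnW nn); lra.
case: (ex_maxnP exP ub) => n /asboolP[v [sv hv]] maxn.
have ex a : exists b, A a -> A b /\ word_map f v b = word_map g w a.
  have [Aa|nA] := pselect (A a); last by exists a.
  by have [b hb] := hv a Aa; exists b.
have [h hh] := choice ex.
exists v, h => a Aa; have [Ah hE] := hh a Aa; split=> //; last first.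
  have [j [b [Ab hb]]] := attr_split HF Ah.
  (* Maximality: otherwise h(A) would lie in f_j(A) and v could be prolonged by j. So h(a') and h(a)
     are at distance at least e, which bounds |f_v'| by |g_w'|. *)
  have [a' Aa' na'] : exists2 a', A a' & ~ (f j @` A) (h a').
    apply: contrapT => no.
    have : P n.+1.
      apply/asboolP; exists (rcons v j); rewrite size_rcons sv; split=> // x Ax.
      have [Ahx hxE] := hh x Ax.
      have [|nj] := pselect ((f j @` A) (h x)); last by exfalso; apply: no; exists x.
      by move=> [y Ay yE]; exists y; split=> //; rewrite word_map_rcons yE.
    by move/maxn; rewrite ltnn.
  have [Ah' hE'] := hh a' Aa'.
  have h1 := he j b (h a') Ab Ah' na'; rewrite -hb in h1.
  have [h2 _] := hKf v (h a') (h a) Ah' Ah.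
  have [_ h3] := hKg w a' a Aa' Aa.
  rewrite hE hE' in h2.
  have m0 : 0 < Num.min e eta by rewrite lt_min e0.
  rewrite mulrAC ler_pdivlMr//.
  have d0 := cabs_ge0 (dword f v (h a)); have d1 := cabs_ge0 (dword g w a).
  have t1 : cabs (dword f v (h a)) * Num.min e eta <= cabs (dword f v (h a)) * cabs (h a' - h a).
    by apply: ler_wpM2l => //; apply: le_trans h1; rewrite ge_min lexx.
  have aa : cabs (a' - a) <= 2 * M.
    by apply: le_trans (cabsB _ _) _; have := hM _ Aa; have := hM _ Aa'; lra.
  have t2 : Kg * cabs (dword g w a) * cabs (a' - a) <= Kg * cabs (dword g w a) * (2 * M).
    by apply: ler_wpM2l => //; apply: mulr_ge0 => //; lra.
  have t3 : Kf * cabs (word_map g w a' - word_map g w a) <= Kf * (Kg * cabs (dword g w a) * (2 * M)).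
    by apply: ler_wpM2l; [lra|exact: le_trans t2].
  lra.
(* One of p, q is at distance at least |p-q|/2 from a, and h stays in the bounded set A; this bounds
   |g_w'| by |f_v'|. *)
have [b Ab ab] : exists2 b, A b & eta <= cabs (b - a).
  have [|lt] := leP eta (cabs (p - a)); first by exists p.
  exists q => //; have := cabs_tri a p q; rewrite (cabs_dist a q); rewrite /eta in lt *; lra.
have [Ahb hbE] := hh b Ab.
have [h2 _] := hKg w b a Ab Aa.
have [_ h3] := hKf v (h b) (h a) Ahb Ah.
rewrite hE hbE in h3.
have m0 : 0 < Num.min e eta by rewrite lt_min e0.
rewrite mulrAC ler_pdivlMr//.
have d0 := cabs_ge0 (dword f v (h a)); have d1 := cabs_ge0 (dword g w a).
have t1 : cabs (dword g w a) * Num.min e eta <= cabs (dword g w a) * cabs (b - a).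
  by apply: ler_wpM2l => //; apply: le_trans ab; rewrite ge_min lexx orbT.
have aa : cabs (h b - h a) <= 2 * M.
  by apply: le_trans (cabsB _ _) _; have := hM _ Ah; have := hM _ Ahb; lra.
have t2 : Kf * cabs (dword f v (h a)) * cabs (h b - h a) <= Kf * cabs (dword f v (h a)) * (2 * M).
  by apply: ler_wpM2l => //; apply: mulr_ge0 => //; lra.
have t3 : Kg * cabs (word_map g w b - word_map g w a) <= Kg * (Kf * cabs (dword f v (h a)) * (2 * M)).
  by apply: ler_wpM2l; [lra|exact: le_trans t2].
lra.
Qed.

(** |g_w'| is at most of order l^|w|, |f_v'| is at least c^|v|, and the two are comparable. This
    provides the lower bounds on |v| demanded by the matching conditions. *)
Lemma match_size (k : R) (N : nat) : 0 < k -> exists m : nat, forall w v h,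
  (m <= size w)%N -> matched k w v h -> (N <= size v)%N.
Proof.
move=> k0; have [c [c0 c1 hc]] := attr_deriv_lower HF.
have [l [l0 l1 [r [B [r0 B0 hB _]]]]] := attr_contraction HG.
have cN : 0 < c ^+ N by exact: exprn_gt0.
have [|m hm] := @geometric_small R l (k * B) _ _ cN; first by rewrite (ltW l0).
exists m => w v h mw hv; rewrite leqNgt; apply/negP => vN.
have [_ _ [p [_ [Ap _ _]]] _] := HG; have [Ah _ _ h2] := hv p Ap.
have h3 := hc v _ Ah; have := hB w p Ap; have := hm _ mw.
have : c ^+ N <= c ^+ size v by apply: ler_wiXn2l => //; [exact: ltW|exact: ltnW].
have := fun x y => @ler_wpM2l R k (ltW k0) x y; move=> mono a1 a2 /mono a3.
lra.
Qed.

Lemma match_lip (k : R) : 0 < k -> exists2 K : R, 0 < K & forall w v h x y,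
  matched k w v h -> A x -> A y -> cabs (h x - h y) <= K * cabs (x - y).
Proof.
move=> k0; have [Kg Kg1 hKg] := attr_bilip HG; have [Kf Kf1 hKf] := attr_bilip HF.
exists (Kf * Kg * k); first by rewrite !mulr_gt0//; lra.
move=> w v h x y hh Ax Ay; have [Ahx hx _ _] := hh x Ax; have [Ahy hy h1 _] := hh y Ay.
have d0 : 0 < cabs (dword f v (h y)) by rewrite cabs_gt0; apply: (dword_neq0 hF); exact: (attr_sub HF).
have [h2 _] := hKf v _ _ Ahx Ahy; have [_ h3] := hKg w _ _ Ax Ay.
rewrite hx hy in h2; rewrite -(ler_pM2l d0).
have xy := cabs_ge0 (x - y).
have t1 : Kf * cabs (word_map g w x - word_map g w y) <= Kf * (Kg * cabs (dword g w y) * cabs (x - y)).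
  by apply: ler_wpM2l => //; lra.
have t2 : Kf * Kg * cabs (x - y) * cabs (dword g w y) <= Kf * Kg * cabs (x - y) * (k * cabs (dword f v (h y))).
  by apply: ler_wpM2l => //; rewrite mulr_ge0// mulr_ge0//; lra.
lra.
Qed.

(** The derivative of f_v^-1 g_w at c by the chain rule; a formula is needed because h is controlled
    on A only. *)
Definition mderiv w v h c : C := dword g w c / dword f v (h c).

(** Distortion is applied to g_w at c and to f_v at h(c); the derivatives being comparable, the
    errors divide out and r is independent of the words. *)
Lemma match_lin (k e : R) : 0 < k -> 0 < e -> exists2 r : R, 0 < r & forall w v h c x y,
  matched k w v h -> A c -> A x -> A y -> cabs (x - c) <= r -> cabs (y - c) <= r ->
  cabs (h x - h y - mderiv w v h c * (x - y)) <= e * cabs (x - y).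
Proof.
move=> k0 e0; have [K K0 hK] := match_lip k0.
pose e' := Num.min 2^-1 (e / (k + K)).
have kK : 0 < k + K by lra.
have e'0 : 0 < e' by rewrite lt_min divr_gt0// andbT; lra.
have e'1 : e' < 1 by apply: (@le_lt_trans _ _ 2^-1); [rewrite ge_min lexx|lra].
have e'2 : e' * (k + K) <= e by rewrite -ler_pdivlMr// ge_min lexx orbT.
have [rg rg0 hrg] := attr_distortion HG e'0 e'1.
have [rf rf0 hrf] := attr_distortion HF e'0 e'1.
exists (Num.min rg (rf / K)); first by rewrite lt_min rg0 divr_gt0.
move=> w v h c x y hh Ac Ax Ay; rewrite !le_min => /andP[xg]; rewrite ler_pdivlMr// => xf.
move=> /andP[yg]; rewrite ler_pdivlMr// => yf.
have [Ahc hc h1 h2] := hh c Ac; have [Ahx hx _ _] := hh x Ax; have [Ahy hy _ _] := hh y Ay.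
have hxc : cabs (h x - h c) <= rf by have := hK _ _ _ _ _ hh Ax Ac; lra.
have hyc : cabs (h y - h c) <= rf by have := hK _ _ _ _ _ hh Ay Ac; lra.
have hxy := hK _ _ _ _ _ hh Ax Ay.
have eg := hrg w c x y Ac xg yg; have ef := hrf v (h c) (h x) (h y) Ahc hxc hyc.
rewrite hx hy in ef.
have df0 : dword f v (h c) != 0 by apply: (dword_neq0 hF); exact: (attr_sub HF).
have d0 : 0 < cabs (dword f v (h c)) by rewrite cabs_gt0.
rewrite -(ler_pM2l d0) -cabsM /mderiv.
set G := word_map g w x - word_map g w y in eg ef *.
rewrite (_ : dword f v (h c) * _ = (G - dword g w c * (x - y)) -
  (G - dword f v (h c) * (h x - h y))); last by field; exact: df0.
apply: le_trans (cabsB _ _) _; have xy := cabs_ge0 (x - y).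
have t1 : e' * cabs (dword f v (h c)) * cabs (h x - h y) <= e' * cabs (dword f v (h c)) * (K * cabs (x - y)).
  by apply: ler_wpM2l => //; apply: mulr_ge0; exact: ltW.
have t2 : e' * cabs (x - y) * cabs (dword g w c) <= e' * cabs (x - y) * (k * cabs (dword f v (h c))).
  by apply: ler_wpM2l => //; apply: mulr_ge0 => //; exact: ltW.
have t3 : cabs (dword f v (h c)) * cabs (x - y) * (e' * (k + K)) <= cabs (dword f v (h c)) * cabs (x - y) * e.
  by apply: ler_wpM2l => //; apply: mulr_ge0 => //; exact: ltW.
lra.
Qed.

(** Push forward by f_v: the point f_v(y) of A lies outside g_{wu}(A), so [attr_gap] applies to
    [w ++ u]; dividing by f_v' leaves g_u'. *)
Lemma match_gap (k : R) : 0 < k -> exists2 e : R, 0 < e & forall w v h u a y,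
  matched k w v h -> A a -> A y -> (forall b, A b -> y <> h (word_map g u b)) ->
  e * cabs (dword g u a) <= cabs (y - h (word_map g u a)).
Proof.
move=> k0; have [e e0 he] := attr_gap HG; have [Kf Kf1 hKf] := attr_bilip HF.
have Kk : 0 < Kf * k by rewrite mulr_gt0//; lra.
exists (e / (Kf * k)); first by rewrite divr_gt0.
move=> w v h u a y hh Aa Ay ny.
set z := word_map g u a; have Az : A z by exact: (attr_word HG).
have [Ahz hz h1 h2] := hh z Az.
have ny' : ~ (word_map g (w ++ u) @` A) (word_map f v y).
  move=> [b Ab]; rewrite word_map_cat => E.
  have Aub : A (word_map g u b) by exact: (attr_word HG).
  have [Ahb hb _ _] := hh _ Aub; rewrite -hb in E.
  by apply: (ny b Ab); apply: (@word_inj _ _ _ _ hF v) => //; rewrite inE; exact: (attr_sub HF).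
have := he (w ++ u) a _ Aa (attr_word HF v Ay) ny'.
rewrite word_map_cat dword_cat cabsM -/z -hz => h3.
have [_ h4] := hKf v y (h z) Ay Ahz.
have dg : 0 < cabs (dword g w z) by rewrite cabs_gt0; apply: (dword_neq0 hG); exact: (attr_sub HG).
rewrite mulrAC ler_pdivrMr// -(ler_pM2l dg).
have t1 : Kf * cabs (y - h z) * cabs (dword f v (h z)) <= Kf * cabs (y - h z) * (k * cabs (dword g w z)).
  by apply: ler_wpM2l => //; apply: mulr_ge0; [lra|exact: cabs_ge0].
lra.
Qed.

End CommonAttractor.

(** * Close matched maps are equal, hence only finitely many occur *)

Section Rigidity.
Variable R : realType.
Local Notation C := (Cplx R).
Variables (LG LF : finType) (OmG OmF : set C) (g : LG -> C -> C) (f : LF -> C -> C) (A : set C).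
Hypothesis HG : separated_ifs OmG g A.
Hypothesis HF : separated_ifs OmF f A.
Implicit Types (w u : seq LG) (v : seq LF) (h : C -> C).

Let hG : holomorphic_ifs OmG g. Proof. by case: HG. Qed.
Let hF : holomorphic_ifs OmF f. Proof. by case: HF. Qed.

(* If [h] and [h'] are close then [h'] maps [g_u(A)] into [h(g_u(A))] for all pieces
   around a given point: at the first failure the displacement [h' - h] would be
   comparable with the diameter of the parent piece while being almost constant on
   it, so that a near-translation would map a bounded set into itself. *)
Lemma rigidity (k : R) : 0 < k -> exists rho e : R, [/\ 0 < rho, 0 < e &
  forall w v h w' v' h', matched g f A k w v h -> matched g f A k w' v' h' ->
  (forall x, A x -> exists c, [/\ A c, cabs (x - c) <= rho, cabs (h c - h' c) <= e &
     cabs (mderiv g f w v h c - mderiv g f w' v' h' c) <= e]) ->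
  forall x, A x -> h x = h' x].
Proof.
move=> k0; have [K K0 hK] := match_lip HG HF k0.
have [c3 c30 hc3] := match_gap HG HF k0.
have [c1 [c2 [c10 c20 hc]]] := attr_deriv_bounds HG.
have [cl [cl0 cl1 hcl]] := attr_deriv_lower HG.
have [Kg Kg1 hKg] := attr_bilip HG; have [M M0 hM] := attr_bounded HG.
have [l [l0 l1 [B B0 hB]]] := attr_diam HG.
have Kg0 : 0 < Kg by lra.
(* Chosen so that h' - h, with Lipschitz constant 3 e1, varies over a piece g_u(A) by at most half
   of the gap c3 c1 |g_u'| forced at a failing child of that piece. *)
pose e1 := c3 * c1 / (12 * (Kg * M)).
have e10 : 0 < e1 by rewrite /e1 divr_gt0// ?mulr_gt0.
have e1E : 3 * e1 * (Kg * (2 * M)) = c3 * c1 / 2.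
  by rewrite /e1; field; rewrite !gt_eqF.
clearbody e1.
have [r r0 hr] := match_lin HG HF k0 e10.
have r2 : 0 < r / 2 by lra.
have [|n1 hn1] := @geometric_small R l B _ _ r2; first by rewrite (ltW l0).
(* A lower bound for the gap of [match_gap] at level n1, where pieces have diameter at most r/2. A
   displacement below eta cannot fail at that level, which starts the induction. *)
pose eta := c3 * cl ^+ n1.
have eta0 : 0 < eta by rewrite /eta mulr_gt0// exprn_gt0.
pose rho := Num.min (r / 2) (eta / (8 * K)); pose e := Num.min e1 (eta / 4).
have rho0 : 0 < rho by rewrite lt_min r2 divr_gt0// mulr_gt0.
have e0 : 0 < e by rewrite lt_min e10 divr_gt0.
have rhor : rho <= r / 2 by rewrite ge_min lexx.
have rhoK : K * rho <= eta / 8.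
  rewrite mulrC -ler_pdivlMr// (_ : eta / 8 / K = eta / (8 * K)); last by field; rewrite gt_eqF.
  by rewrite ge_min lexx orbT.
have ee1 : e <= e1 by rewrite ge_min lexx.
have eeta : e <= eta / 4 by rewrite ge_min lexx orbT.
exists rho, e; split=> // w v h w' v' h' hh hh' close x Ax.
have Ah y : A y -> A (h y) by move=> /hh[].
have Ah' y : A y -> A (h' y) by move=> /hh'[].
pose Psi y := h' y - h y.
have Psi_small y : A y -> cabs (Psi y) < eta.
  move=> Ay; have [c [Ac yc hcc _]] := close y Ay.
  rewrite (_ : Psi y = (h' y - h' c) - (h c - h' c) - (h y - h c)); last by rewrite /Psi; ring.
  have a1 := hK _ _ _ _ _ hh' Ay Ac; have a2 := hK _ _ _ _ _ hh Ay Ac.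
  have a3 : K * cabs (y - c) <= K * rho by apply: ler_wpM2l => //; exact: ltW.
  apply: le_lt_trans (cabsB _ _) _; apply: le_lt_trans (lerD (cabsB _ _) (lexx _)) _; lra.
have [c [Ac xc hcc Dc]] := close x Ax.
have Psi_lip y z : A y -> A z -> cabs (y - c) <= r -> cabs (z - c) <= r ->
    cabs (Psi y - Psi z) <= 3 * e1 * cabs (y - z).
  move=> Ay Az yc zc; have b1 := hr _ _ _ c y z hh Ac Ay Az yc zc.
  have b2 := hr _ _ _ c y z hh' Ac Ay Az yc zc.
  have yz0 := cabs_ge0 (y - z); have b3 := ler_wpM2r yz0 (le_trans Dc ee1).
  rewrite (_ : Psi y - Psi z = (h' y - h' z - mderiv g f w' v' h' c * (y - z)) -
    (h y - h z - mderiv g f w v h c * (y - z)) -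
    (mderiv g f w v h c - mderiv g f w' v' h' c) * (y - z)); last by rewrite /Psi; ring.
  apply: le_trans (cabsB _ _) _; apply: le_trans (lerD (cabsB _ _) (lexx _)) _.
  rewrite cabsM; lra.
(* The pieces g_u(A) around x satisfy that h' maps them into their own images under h. *)
have pres n : exists u a, [/\ size u = (n1 + n)%N, A a, x = word_map g u a &
    forall b, A b -> exists b', A b' /\ h' (word_map g u b) = h (word_map g u b')].
  elim: n => [|n [u [a [su Aa xE hu]]]].
    have [u [a [su Aa xE]]] := attr_code HG n1 Ax.
    exists u, a; split=> //; first by rewrite addn0.
    move=> b Ab; apply: contrapT => no.
    have Aub : A (word_map g u b) by exact: (attr_word HG).
    have gap := hc3 w v h u b (h' (word_map g u b)) hh Ab (Ah' _ Aub)
      (fun b' Ab' E => no (ex_intro _ b' (conj Ab' E))).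
    have := Psi_small _ Aub; have := hcl u b Ab; rewrite su.
    have := fun x y => @ler_wpM2l R c3 (ltW c30) x y; move=> mono /mono.
    by rewrite /Psi -/eta; lra.
  have [j [a' [Aa' aE]]] := attr_split HG Aa.
  exists (rcons u j), a'; rewrite size_rcons su addnS; split=> //.
    by rewrite word_map_rcons -aE.
  move=> b Ab; apply: contrapT => no.
  set z := word_map g (rcons u j) b.
  have Az : A z by exact: (attr_word HG).
  have Ajb : A (g j b) by exact: (attr_step HG).
  have zE : z = word_map g u (g j b) by rewrite /z word_map_rcons.
  have gap := hc3 w v h (rcons u j) b (h' z) hh Ab (Ah' _ Az)
    (fun b' Ab' E => no (ex_intro _ b' (conj Ab' E))).
  have /andP[d1 _] := hc j b Ab.
  have d0 : 0 < cabs (dword g u (g j b)).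
    by rewrite cabs_gt0; apply: (dword_neq0 hG); exact: (attr_sub HG).
  have gap2 : c3 * c1 * cabs (dword g u (g j b)) <= cabs (Psi z).
    apply: le_trans gap; rewrite -cats1 dword_cat /= mulr1 cabsM -mulrA.
    by apply: ler_wpM2l; [exact: ltW|rewrite mulrC; apply: ler_wpM2l => //; exact: ltW].
  have Psiz0 : 0 < cabs (Psi z) by apply: lt_le_trans gap2; rewrite !mulr_gt0.
  have diam y : A y -> cabs (word_map g u y - x) <= r / 2.
    move=> Ay; rewrite xE; apply: le_trans (hB u y a Ay Aa) _; apply/ltW/hn1.
    by rewrite su leq_addr.
  have inr y : A y -> cabs (word_map g u y - c) <= r.
    by move=> /diam yx; have := cabs_tri x (word_map g u y) c; lra.
  (* If the child u j fails at z, the gap makes Psi z large relative to |g_u'|. On the parent, h' =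
     h + Psi with Psi within |Psi z|/2 of Psi z, so b -> b' is a near-translation of h(g_u(A)) into
     itself by Psi z. *)
  have : Psi z = 0.
    apply: (@no_translation R C A (fun b => h (word_map g u b)) M) => //.
    - by exists b.
    - by move=> y Ay; apply: hM; apply: Ah; exact: (attr_word HG).
    move=> y Ay; have [y' [Ay' E]] := hu y Ay; exists y' => //; rewrite -E.
    have Auy : A (word_map g u y) by exact: (attr_word HG).
    apply: le_trans (Psi_lip (word_map g u y) z Auy Az (inr y Ay) _) _; first by rewrite zE; exact: inr.
    have [_ b2] := hKg u y (g j b) Ay Ajb; rewrite -zE in b2.
    have yM : cabs (y - g j b) <= 2 * M.
      by apply: le_trans (cabsB _ _) _; have := hM _ Ay; have := hM _ Ajb; lra.
    have b3 : Kg * cabs (dword g u (g j b)) * cabs (y - g j b) <=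
      Kg * cabs (dword g u (g j b)) * (2 * M).
      by apply: ler_wpM2l => //; rewrite mulr_ge0// ltW.
    have b4 : 3 * e1 * cabs (word_map g u y - z) <= 3 * e1 * (Kg * cabs (dword g u (g j b)) * (2 * M)).
      by apply: ler_wpM2l; [lra|exact: le_trans b3].
    have b5 : 3 * e1 * (Kg * cabs (dword g u (g j b)) * (2 * M)) = c3 * c1 / 2 * cabs (dword g u (g j b)).
      by rewrite -e1E; ring.
    lra.
  by move=> P0; rewrite P0 cabs0 ltxx in Psiz0.
(* h'(x) and h(x) both lie in h(g_u(A)) at every level, and these sets shrink to a point. *)
apply/eqP; rewrite -subr_eq0 -cabs_eq0 eq_le cabs_ge0 andbT.
apply/ler_addgt0Pr => d d0; rewrite add0r.
have [|n hn] := @geometric_small R l (K * B) d _ d0; first by rewrite (ltW l0).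
have [u [a [su Aa xE hu]]] := pres n; have [b [Ab hb]] := hu a Aa.
rewrite -xE in hb; rewrite hb.
have := hK _ _ _ _ _ hh Ax (attr_word HG u Ab).
have := hB u a b Aa Ab; rewrite -xE su => b1.
have := fun x y => @ler_wpM2l R K (ltW K0) x y; move=> mono; have := mono _ _ b1.
by have := hn (n1 + n)%N (leq_addl _ _); lra.
Qed.

(** A matched triple is classified by the cells of its values and derivatives on the net. By
    [rigidity] triples in one class have the same map on A, so one representative per class
    suffices. *)
Lemma finite_match_list : exists (T : finType) (wl : T -> seq LG) (vl : T -> seq LF)
    (hl : T -> C -> C),
  [/\ (0 < #|T|)%N, forall t, is_word (wl t) /\ is_word (vl t),
    forall t a, A a -> A (hl t a) /\ word_map f (vl t) (hl t a) = word_map g (wl t) a &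
    forall N : nat, exists m : nat, forall w, (m <= size w)%N -> exists v t,
      (N <= size v)%N /\ forall a, A a -> word_map f v (hl t a) = word_map g w a].
Proof.
have [k k0 hk] := match_exists HG HF.
have [rho [e [rho0 e0 hrig]]] := rigidity k0.
have [M M0 hM] := attr_bounded HG.
have [_ _ [p [_ [Ap _ _]]] _] := HG.
have A0 : A !=set0 by exists p.
have [T1 [net [Anet hnet]]] := finite_net A0 hM rho0.
have [T2 [cl2 hcl2]] := @finite_buckets R M e e0.
have [T3 [cl3 hcl3]] := @finite_buckets R k e e0.
pose T : finType := {ffun T1 -> T2 * T3}.
pose cl w v h : T := [ffun i => (cl2 (h (net i)), cl3 (mderiv g f w v h (net i)))].
have md w v h c : matched g f A k w v h -> A c -> cabs (mderiv g f w v h c) <= k.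
  move=> hh Ac; have [Ahc _ h1 _] := hh c Ac.
  rewrite /mderiv cabsM cabsV ler_pdivrMr// cabs_gt0.
  by apply: (dword_neq0 hF); exact: (attr_sub HF).
have same w v h w' v' h' : matched g f A k w v h -> matched g f A k w' v' h' ->
    cl w v h = cl w' v' h' -> forall x, A x -> h x = h' x.
  move=> hh hh' E; apply: (hrig w v h w' v' h' hh hh') => y Ay.
  have [i yi] := hnet y Ay; exists (net i).
  have := congr1 (fun F : T => F i) E; rewrite !ffunE => -[E2 E3].
  split=> //.
    by apply: hcl2 => //; apply: hM; [have [] := hh _ (Anet i)|have [] := hh' _ (Anet i)].
  by apply: hcl3 => //; apply: md.
have [m1 hm1] := match_size HG HF 1 k0.
(* Representatives are taken among triples with |w| >= m0, so that both of their words are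
   nonempty. *)
pose m0 := maxn 1 m1.
have [w0 [_ [sw0 _ _]]] := attr_code HG m0 Ap.
have [v0 [h0 hh0]] := hk w0.
(* An empty class receives the default triple (w0, v0, h0), which keeps the list total. *)
have ex (t : T) : exists x : seq LG * seq LF * (C -> C),
    [/\ (m0 <= size x.1.1)%N, matched g f A k x.1.1 x.1.2 x.2 &
     forall w v h, (m0 <= size w)%N -> matched g f A k w v h -> cl w v h = t ->
       cl x.1.1 x.1.2 x.2 = t].
  have [[w [v [h [mw hh ht]]]]|no] := pselect (exists w v h,
      [/\ (m0 <= size w)%N, matched g f A k w v h & cl w v h = t]).
    by exists (w, v, h).
  exists (w0, v0, h0); split=> //=; first by rewrite sw0.
  by move=> w v h mw hh ht; exfalso; apply: no; exists w, v, h.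
have [X hX] := choice ex.
exists T, (fun t => (X t).1.1), (fun t => (X t).1.2), (fun t => (X t).2); split.
- by apply/card_gt0P; exists (cl w0 v0 h0).
- move=> t; have [mw hh _] := hX t; split; first by rewrite /is_word; rewrite /m0 in mw; lia.
  by apply: (hm1 _ _ _ _ hh); rewrite /m0 in mw; lia.
- by move=> t a Aa; have [_ hh _] := hX t; have [] := hh a Aa.
move=> N; have [m hm] := match_size HG HF N k0.
exists (maxn m m0) => w; rewrite geq_max => /andP[mw mw0].
have [v [h hh]] := hk w; exists v, (cl w v h); split; first exact: (hm w v h mw hh).
move=> a Aa; have [_ hX1 hX2] := hX (cl w v h).
have E := hX2 w v h mw0 hh erefl.
rewrite (same _ _ _ _ _ _ hX1 hh E a Aa).
by have [] := hh a Aa.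
Qed.

End Rigidity.

(** * From matching to equality of attractors *)

Section NearAttractor.
Variable R : realType.
Local Notation C := (Cplx R).
Variables (L : finType) (Om : set C) (g : L -> C -> C) (A : set C).
Hypothesis H : separated_ifs Om g A.

Let hG : holomorphic_ifs Om g. Proof. by case: H. Qed.

Lemma closure_image_sub i : closure (g i @` Om) `<=` Om.
Proof. by have [_ _ /(_ i)[]] := hG. Qed.

Lemma closure_image_compact i : compact (closure (g i @` Om)).
Proof. by apply: (closure_compact hG) => _ [x Ox <-]; exact: (ifs_self hG). Qed.

Lemma compact_contraction (l : R) (K : L -> set C) : 0 < l ->
  (forall K, compact K -> K `<=` Om -> exists2 B : R, 0 < B & forall w x y, K x -> K y ->
    cabs (word_map g w x - word_map g w y) <= B * l ^+ size w) ->
  (forall i, compact (K i)) -> (forall i, K i `<=` Om) ->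
  exists2 B : R, 0 < B & forall i w x y, K i x -> K i y ->
    cabs (word_map g w x - word_map g w y) <= B * l ^+ size w.
Proof.
move=> l0 hl cK KO.
have [||r r0 hr] := @finite_uniform R L (fun i r => forall w x y, K i x -> K i y ->
    cabs (word_map g w x - word_map g w y) <= r^-1 * l ^+ size w).
- move=> i r s s0 sr h w x y Kx Ky; apply: le_trans (h w x y Kx Ky) _.
  apply: ler_wpM2r; first by rewrite exprn_ge0// ltW.
  by rewrite lef_pV2// posrE; exact: lt_le_trans sr.
- move=> i; have [B B0 hB] := hl _ (cK i) (KO i); exists B^-1; first by rewrite invr_gt0.
  by move=> w x y Kx Ky; rewrite invrK; exact: hB.
by exists r^-1 => //; rewrite invr_gt0.
Qed.

(** Om itself is not compact, but after one letter its points lie in the compact closures of the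
    g_j(Om), where the contraction is uniform. *)
Lemma word_near_attr : exists l : R, [/\ 0 < l, l < 1 & exists2 B : R, 0 < B &
  forall w j x a, closure (g j @` Om) x -> A a ->
  cabs (word_map g w x - word_map g w a) <= B * l ^+ size w].
Proof.
have [l [l0 l1 hl]] := word_contraction_compact hG.
have [||B B0 hB] := @compact_contraction l (fun j => closure (g j @` Om) `|` A) l0 hl.
- by move=> i; apply: compactU; [exact: closure_image_compact|exact: (attr_compact H)].
- by move=> i x [/closure_image_sub//|/(attr_sub H)].
exists l; split=> //; exists B => // w j x a jx Aa.
by apply: (hB j); [left|right].
Qed.

(** There are only finitely many words shorter than N, all injective. The induction peels off the
    letter applied first. Read backwards, two images very close together reveal a long word. *)
Lemma words_apart (N : nat) p q : Om p -> Om q -> p != q -> exists2 e : R, 0 < e &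
  forall v, (size v < N)%N -> e <= cabs (word_map g v p - word_map g v q).
Proof.
elim: N p q => [|N IH] p q Op Oq pq; first by exists 1.
have [||e e0 he] := @finite_uniform R L (fun j e => forall v, (size v < N)%N ->
    e <= cabs (word_map g v (g j p) - word_map g v (g j q))).
- by move=> j r s _ sr h v vN; exact: le_trans (h v vN).
- move=> j; apply: IH; [exact: (ifs_self hG)|exact: (ifs_self hG)|].
  by apply: contra_neq pq; apply: (@ifs_inj _ _ _ _ hG j); exact: mem_set.
have pq0 : 0 < cabs (p - q) by rewrite cabs_gt0 subr_eq0.
exists (Num.min e (cabs (p - q))); first by rewrite lt_min e0.
move=> v; case/lastP: v => [|v j].
  by move=> _; rewrite ge_min lexx orbT.
rewrite size_rcons ltnS !word_map_rcons => vN.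
by rewrite ge_min he.
Qed.

Lemma word_image_open w (S : set C) : open S -> S `<=` Om -> open (word_map g w @` S).
Proof.
move=> oS SO; apply/open_cabs => _ [x Sx <-].
have [||e e0 he] := @open_mapping R S (word_map g w) x 1 oS _ _ Sx ltr01.
- by move=> z /SO Oz; exact: (@word_hol _ _ _ _ hG w z Oz).
- move=> y z; rewrite !inE => /SO Oy /SO Oz; apply: (@word_inj _ _ _ _ hG w); exact/mem_set.
by exists e => // y /he[z [_ Sz zE]]; exists z.
Qed.

Definition level n (X : set C) : set C := [set z | exists w, size w = n /\ (word_map g w @` X) z].

Lemma compact_finite_union (K : L -> set C) : (forall i, compact (K i)) ->
  compact [set z | exists i, K i z].
Proof.
move=> cK; rewrite (_ : [set z | _] = \big[setU/set0]_(i <- enum L) K i).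
  by apply: bigsetU_compact => i _.
rewrite -bigcup_seq; apply/seteqP; split=> z /=.
  by move=> [i Kz]; exists i => //=; rewrite mem_enum.
by move=> [i _ Kz]; exists i.
Qed.

Lemma level_compact n (X : set C) : compact X -> X `<=` Om -> compact (level n X).
Proof.
move=> cX XO; elim: n => [|n IH].
  rewrite (_ : level 0 X = X)//; apply/seteqP; split=> z.
    by move=> [w [/size0nil-> [x Xx <-]]].
  by move=> Xz; exists [::]; split=> //; exists z.
rewrite (_ : level n.+1 X = [set z | exists i, (g i @` level n X) z]); last first.
  apply/seteqP; split=> z.
    case=> [[|i w]] [] // [sw] [x Xx <-]; exists i, (word_map g w x) => //.
    by exists w; split=> //; exists x.
  move=> [i [y [w [sw [x Xx <-]]] <-]]; exists (i :: w); rewrite /= sw.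
  by split=> //; exists x.
apply: compact_finite_union => i; apply: continuous_compact IH.
apply: continuous_in_subspaceT => y; rewrite inE => -[w [_ [x /XO Ox <-]]].
by apply/ccontP; apply: (hol_cont (@ifs_hol _ _ _ _ hG i)); exact: (word_self hG).
Qed.

(** V is the union of g_w(Om) over |w| = n+1. The closure of g_i(V) lies in g_i of the level-n
    images of the closures of the g_j(Om), within B l^(n+1) of g_i(A); for n large this is less than
    half the gap of [attr_sep1]. *)
Lemma box_exists : exists V, box_like Om g A V.
Proof.
have [e e0 he] := attr_sep1 H.
have [l [l0 l1 [B B0 hB]]] := word_near_attr.
have [|n hn] := @geometric_small R l (2 * B) e _ e0; first by rewrite (ltW l0).
pose V := level n.+1 Om.
pose K := [set z | exists j, closure (g j @` Om) z].
have cK : compact K by apply: compact_finite_union; exact: closure_image_compact.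
have KO : K `<=` Om by move=> z [j /closure_image_sub].
have clV i : closure (g i @` V) `<=` g i @` level n K.
  have cl : closed (g i @` level n K).
    apply: compact_closed; apply: continuous_compact; last exact: level_compact.
    apply: continuous_in_subspaceT => y; rewrite inE => -[w [_ [x /KO Ox <-]]].
    by apply/ccontP; apply: (hol_cont (@ifs_hol _ _ _ _ hG i)); exact: (word_self hG).
  rewrite [X in _ `<=` X](closure_id _).1//; apply: closure_subset.
  move=> _ [y [w [sw [x Ox <-]]] <-]; case/lastP: w sw => // w j.
  rewrite size_rcons => -[sw]; exists (word_map g w (g j x)); last by rewrite word_map_rcons.
  exists w; split=> //; exists (g j x) => //; exists j.
  by apply: subset_closure; exists x.
exists V; split.
- apply/open_cabs => z [w [sw wz]].
  have /open_cabs/(_ z wz)[r r0 hr] := @word_image_open w Om (ifs_open hG) (fun z h => h).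
  by exists r => // y /hr wy; exists w.
- move=> a Aa; have [w [b [sw Ab ->]]] := attr_code H n.+1 Aa.
  by exists w; split=> //; exists b => //; exact: (attr_sub H).
- by move=> z [w [_ [x Ox <-]]]; exact: (word_self hG).
- move=> i j _ _ [z [/clV[_ [w [sw [x [p px] <-]] <-]] /clV[_ [u [su [y [q qy] <-]] E]]]].
  apply/eqP; apply: contraT => ij.
  have [_ _ [a [_ [Aa _ _]]] ssc] := H.
  have h1 := hB (i :: w) p x a px Aa; have h2 := hB (j :: u) q y a qy Aa.
  move: h1 h2; rewrite /= sw su => h1 h2.
  have Awa : A (word_map g w a) by exact: (attr_word H).
  have Aua : A (word_map g u a) by exact: (attr_word H).
  have := he i (word_map g w a) (g j (word_map g u a)) Awa (attr_step H j Aua).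
  have nn : ~ (g i @` A) (g j (word_map g u a)).
    move=> [b Ab bE]; move/eqP: ij; apply; apply: (ssc i j) => //.
    by exists (g j (word_map g u a)); split; [exists b|exists (word_map g u a)].
  move=> /(_ nn) h3; have := hn n.+1 (leqnSn n).
  have := cabs_tri (g j (word_map g u y)) (g j (word_map g u a)) (g i (word_map g w a)).
  rewrite (cabs_dist (g j (word_map g u a)) (g j _)) E; rewrite E in h2; lra.
- move=> i z /clV[_ [w [sw [x Kx <-]] <-]].
  by exists (i :: w); rewrite /= sw; split=> //; exists x => //; exact: KO.
Qed.

End NearAttractor.

(** * Matching implies inclusion of attractors, and extension of matchings from A to a disc *)

Section TwoIFS.
Variable R : realType.
Local Notation C := (Cplx R).
Variables (LG LF : finType) (OmG OmF : set C) (g : LG -> C -> C) (f : LF -> C -> C).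

Lemma transition_id (L : finType) (Om : set C) (k : L -> C -> C) w u x :
  holomorphic_ifs Om k -> Om x ->
  transition Om k w u (word_map k u x) = word_map k w x.
Proof.
move=> hk Ox; rewrite /transition /comp pinvKV//; last exact/mem_set.
exact: (@word_inj _ _ _ _ hk u).
Qed.

Lemma transition_eq (L : finType) (Om : set C) (k : L -> C -> C) w u x z :
  holomorphic_ifs Om k -> Om x -> z = word_map k u x ->
  transition Om k w u z = word_map k w x.
Proof. by move=> hk Ox ->; exact: transition_id. Qed.

Section Sub.
Variables (AG AF : set C).
Hypothesis HG : separated_ifs OmG g AG.
Hypothesis HF : separated_ifs OmF f AF.

Let hG : holomorphic_ifs OmG g. Proof. by case: HG. Qed.
Let hF : holomorphic_ifs OmF f. Proof. by case: HF. Qed.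

Lemma closed_approx a : (forall e : R, 0 < e -> exists2 y, AF y & cabs (y - a) < e) -> AF a.
Proof.
move=> h; have /closure_id -> := compact_closed (@attr_compact _ _ _ _ _ HF).
by apply/closure_cabs.
Qed.

(** A point a of AG is a limit of g_w(x1) = f_v(y), where y is one of finitely many points depending
    on k only, so f_v(y) is near AF once v is long. A second point x2 forces v to be long: g_w(x1)
    and g_w(x2) merge, which [words_apart] forbids for short v. *)
Lemma word_matching_sub (k0 : nat) (w_ : 'I_k0 -> seq LG) (v_ : 'I_k0 -> seq LF) m0 b (r : C) :
  0 < r -> ball b r `<=` OmG -> word_matching OmG OmF g f w_ v_ m0 (ball b r) -> AG `<=` AF.
Proof.
move=> /pos_rc[s s0 ->] bO hm a Aa; apply: closed_approx => e e0.
pose x1 := b; pose x2 := b + rc (s / 2).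
have E12 : cabs (x2 - x1) = s / 2 by rewrite addrC addKr cabs_rc gtr0_norm//; lra.
have Bx1 : ball b (rc s) x1 by apply/ball_cabs; rewrite subrr cabs0.
have Bx2 : ball b (rc s) x2 by apply/ball_cabs; rewrite E12; lra.
have Ox1 := bO _ Bx1; have Ox2 := bO _ Bx2.
have x12 : x1 != x2 by rewrite eq_sym -subr_eq0 -cabs_gt0 E12; lra.
pose y k x := pinv OmF (word_map f (v_ k)) (word_map g (w_ k) x).
have key w : (m0 <= size w)%N -> exists v k,
    [/\ OmF (y k x1), OmF (y k x2), y k x1 != y k x2,
        word_map f v (y k x1) = word_map g w x1 & word_map f v (y k x2) = word_map g w x2].
  move=> mw; have [v [_ [k [S1 S2 S3]]]] := hm (size w) mw w erefl.
  have pt x : ball b (rc s) x -> [/\ OmF (y k x), word_map f (v_ k) (y k x) = word_map g (w_ k) x &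
      word_map f v (y k x) = word_map g w x].
    move=> Bx; have Sx : (word_map g (w_ k) @` ball b (rc s)) (word_map g (w_ k) x) by exists x.
    have [z Oz zE] := S1 _ Sx.
    have yz : y k x = z.
      rewrite /y -zE pinvKV//; last exact/mem_set.
      exact: (@word_inj _ _ _ _ hF (v_ k)).
    have := S3 _ (mem_set Sx).
    rewrite (transition_eq _ hF Oz (esym zE)) (transition_id _ _ hG (bO _ Bx)) => E.
    by rewrite yz.
  have [a1 a2 a3] := pt x1 Bx1; have [b1 b2 b3] := pt x2 Bx2.
  exists v, k; split=> //; apply: contra_neq x12 => E.
  apply: (@word_inj _ _ _ _ hG (w_ k)); rewrite ?inE//.
  by rewrite -a2 -b2 E.
have [_ _ [p [_ [Ap _ _]]] _] := HF.
have [lF [lF0 lF1 hlF]] := word_contraction_compact hF.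
have [B1 B10 hB1] : exists2 B : R, 0 < B & forall k v, OmF (y k x1) ->
    cabs (word_map f v (y k x1) - word_map f v p) <= B * lF ^+ size v.
  have [||q q0 hq] := @finite_uniform R 'I_k0 (fun k q => forall v, OmF (y k x1) ->
    cabs (word_map f v (y k x1) - word_map f v p) <= q^-1 * lF ^+ size v).
  - move=> k t t' t'0 tt h v Oy; apply: le_trans (h v Oy) _.
    apply: ler_wpM2r; first by rewrite exprn_ge0// ltW.
    by rewrite lef_pV2// posrE; exact: lt_le_trans tt.
  - move=> k; have [Oy|nO] := pselect (OmF (y k x1)); last by exists 1.
    have [||B B0 hB] := hlF (AF `|` [set y k x1]).
    + by apply: compactU; [exact: (attr_compact HF)|exact: compact_set1].
    + by move=> z [/(attr_sub HF)//|->].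
    exists B^-1; first by rewrite invr_gt0.
    by move=> v _; rewrite invrK; apply: hB; [right|left].
  by exists q^-1 => //; rewrite invr_gt0.
have [lG [lG0 lG1 hlG]] := word_contraction_compact hG.
have [||BG BG0 hBG] := hlG ((AG `|` [set x1]) `|` [set x2]).
- apply: compactU; last exact: compact_set1.
  by apply: compactU; [exact: (attr_compact HG)|exact: compact_set1].
- by move=> z [[/(attr_sub HG)//|->//]|->].
have e2 : 0 < e / 2 by lra.
have [|N hN] := @geometric_small R lF B1 _ _ e2; first by rewrite (ltW lF0).
have [c c0 hc] : exists2 c : R, 0 < c & forall k v, (size v < N)%N ->
    OmF (y k x1) -> OmF (y k x2) -> y k x1 != y k x2 ->
    c <= cabs (word_map f v (y k x1) - word_map f v (y k x2)).
  apply: (@finite_uniform R 'I_k0 (fun k c => forall v, (size v < N)%N ->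
    OmF (y k x1) -> OmF (y k x2) -> y k x1 != y k x2 ->
    c <= cabs (word_map f v (y k x1) - word_map f v (y k x2)))).
    by move=> k t t' _ tt h v vN o1 o2 ne; exact: le_trans (h v vN o1 o2 ne).
  move=> k; have [o1|] := pselect (OmF (y k x1)); last by exists 1.
  have [o2|] := pselect (OmF (y k x2)); last by exists 1.
  have [->|ne] := eqVneq (y k x1) (y k x2); first by exists 1.
  by have [c c0 hc] := words_apart HF N o1 o2 ne; exists c => // v vN _ _ _; exact: hc.
have ce : 0 < Num.min c (e / 2) by rewrite lt_min c0.
have [|m hm'] := @geometric_small R lG BG _ _ ce; first by rewrite (ltW lG0).
have [w [a' [sw Aa' aE]]] := attr_code HG (maxn m0 m) Aa.
have [|v [k [o1 o2 ne f1 f2]]] := key w; first by rewrite sw leq_maxl.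
have := hm' (size w); rewrite sw leq_maxr lt_min => /(_ isT)/andP[s1 s2].
have Nv : (N <= size v)%N.
  rewrite leqNgt; apply/negP => vN; have := hc k v vN o1 o2 ne.
  rewrite f1 f2 => h1; have := hBG w x1 x2 (or_introl (or_intror erefl)) (or_intror erefl).
  by rewrite sw; lra.
exists (word_map f v p); first exact: (attr_word HF).
have h1 := hB1 k v o1; have h2 := hBG w x1 a' (or_introl (or_intror erefl)) (or_introl (or_introl Aa')).
rewrite sw -aE in h2; rewrite f1 in h1.
have := cabs_tri (word_map g w x1) (word_map f v p) a.
by rewrite (cabs_dist (word_map f v p) (word_map g w x1)); have := hN _ Nv; lra.
Qed.

(** Disjoint first-level closures make the first letter a function of the point; injectivity then
    strips it off. *)
Lemma box_prefix (VF : set C) : box_like OmF f AF VF -> forall u w y z, VF y -> VF z ->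
  (size u <= size w)%N -> word_map f u y = word_map f w z ->
  exists w', w = u ++ w' /\ y = word_map f w' z.
Proof.
move=> [_ _ VO tr cl].
have fV i x : VF x -> VF (f i x).
  by move=> Vx; apply: (cl i); apply: subset_closure; exists x.
have fwV w x : VF x -> VF (word_map f w x).
  by move=> Vx; elim: w => //= i w IH; exact: fV.
elim=> [|i u IH] w y z Vy Vz; first by move=> _ E; exists w.
case: w => // j w; rewrite /= ltnS => uw E.
have ij : i = j.
  apply: tr => //; exists (f i (word_map f u y)); split; apply: subset_closure.
    by exists (word_map f u y) => //; exact: fwV.
  by rewrite E; exists (word_map f w z) => //; exact: fwV.
rewrite -ij in E *.
have [|w' [-> yE]] := IH w y z Vy Vz uw; last by exists w'.
apply: (@ifs_inj _ _ _ _ hF i) => //; apply/mem_set; apply: VO; exact: fwV.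
Qed.

(** Matching gives a = f_v(y) with f_{u_k}(y) again in AG. Applied to that point, it yields
    f_{u_k}(y) = f_u(y') with |u| > |u_k|; by [box_prefix] u_k is a proper prefix of u, so y =
    f_{u'}(y') with u' nonempty and the code of a grows without end. *)
Lemma finite_matching_sub (VG VF : set C) (K : nat) (t_ : 'I_K -> seq LG) (u_ : 'I_K -> seq LF)
  (M Mstar : nat) : box_like OmG g AG VG -> box_like OmF f AF VF ->
  (forall k, (size (u_ k) <= Mstar)%N) ->
  finite_word_matching OmG OmF g f AG VG VF t_ u_ M Mstar -> AG `<=` AF.
Proof.
move=> bG bF sM hm a Aa.
have [_ AVG _ _ _] := bG; have [_ AVF VFO _ _] := bF.
have step b : AG b -> exists u k y, [/\ VF y, (Mstar < size u)%N, b = word_map f u y &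
    AG (word_map f (u_ k) y)].
  move=> Ab; have [t [x [st Ax bE]]] := attr_code HG M Ab.
  have compx : is_component VG (connected_component VG x) by exists x => //; exact: AVG.
  have [u [_ su [k [S1 S2]]]] := hm _ compx t st.
  have Sx : (word_map g (t_ k) @` (connected_component VG x `&` AG)) (word_map g (t_ k) x).
    by exists x => //; split=> //; apply: connected_component_refl; exact: AVG.
  have [y Vy yE] := S1 _ Sx.
  exists u, k, y; split=> //; last by rewrite yE; exact: (attr_word HG).
  have := S2 _ (mem_set Sx).
  rewrite (transition_eq _ hF (VFO _ Vy) (esym yE)).
  by rewrite (transition_id _ _ hG (attr_sub HG Ax)) bE => ->.
have deep n : exists v k y, [/\ VF y, (n <= size v)%N, a = word_map f v y &
    AG (word_map f (u_ k) y)].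
  elim: n => [|n [v [k [y [Vy nv aE Ay]]]]].
    by have [u [k [y [Vy _ aE Ay]]]] := step a Aa; exists u, k, y.
  have [u [k' [y' [Vy' su yE Ay']]]] := step _ Ay.
  have sk : (size (u_ k) < size u)%N by exact: leq_ltn_trans (sM k) su.
  have [u' [uE yE']] := box_prefix bF Vy Vy' (ltnW sk) yE.
  exists (v ++ u'), k', y'; split=> //.
    by move: sk; rewrite uE !size_cat; lia.
  by rewrite word_map_cat -yE'.
have [l [l0 l1 [B B0 hB]]] := word_near_attr HF.
have [_ _ [p [_ [Ap _ _]]] _] := HF.
apply: closed_approx => e e0.
have [|n hn] := @geometric_small R l B _ _ e0; first by rewrite (ltW l0).
have [v [k [y [Vy nv aE _]]]] := deep n.+1.
(* The last letter is spent on moving y into the closure of f_j(Om), as [word_near_attr] requires;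
   hence the depth [n.+1]. *)
case/lastP: v nv aE => // v j; rewrite size_rcons ltnS word_map_rcons => nv aE.
exists (word_map f v p); first exact: (attr_word HF).
rewrite cabs_dist aE; apply: le_lt_trans (hB v j (f j y) p _ Ap) (hn _ nv).
by apply: subset_closure; exists y => //; exact: VFO.
Qed.

End Sub.

(** A continuous local solution of F(phi) = G is first Lipschitz, with constant 2(|d|+1)/|D|,
    because F is nearly linear at phi x; this turns the errors in phi into errors in x. *)
Lemma cdiff_implicit (F G phi : C -> C) x D d : cdiff F (phi x) D -> D != 0 -> cdiff G x d ->
  ccont phi x -> (exists2 r : R, 0 < r & forall y, cabs (y - x) < r -> F (phi y) = G y) ->
  cdiff phi x (d / D).
Proof.
move=> hF D0 hGx cphi [r r0 FG] e e0.
have cD : 0 < cabs D by rewrite cabs_gt0.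
pose L := cabs d + 1; have L0 : 0 < L by rewrite /L; have := cabs_ge0 d; lra.
pose K := 2 * L / cabs D; have K0 : 0 < K by rewrite /K divr_gt0// mulr_gt0.
pose e1 := Num.min (cabs D / 2) (e * cabs D / (2 * K)).
have e10 : 0 < e1.
  by rewrite lt_min; apply/andP; split; apply: divr_gt0 => //; exact: mulr_gt0.
have e1D : e1 <= cabs D / 2 by rewrite ge_min lexx.
have e1e : e1 * (2 * K) <= e * cabs D   by rewrite -ler_pdivlMr; [rewrite ge_min lexx orbT|exact: mulr_gt0].
pose e2 := e * cabs D / 2; have e20 : 0 < e2 by rewrite /e2 divr_gt0// mulr_gt0.
have [r1 r10 h1] := hF _ e10; have [r2 r20 h2] := hGx _ e20.
have [r3 r30 h3] := cdiff_lip hGx; have [r4 r40 h4] := cphi _ r10.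
exists (Num.min (Num.min r r2) (Num.min r3 r4)); first by rewrite !lt_min r0 r20 r30.
move=> y; rewrite !lt_min => /andP[/andP[yr /h2 {}h2] /andP[/h3 {}h3 /h4/h1 {}h1]].
have Fy := FG y yr; have Fx : F (phi x) = G x by apply: FG; rewrite subrr cabs0.
rewrite Fy Fx in h1; rewrite -/L in h3.
have xy0 := cabs_ge0 (y - x); have pp0 := cabs_ge0 (phi y - phi x).
have lip : cabs (phi y - phi x) <= K * cabs (y - x).
  have := cabsB (G y - G x) (G y - G x - D * (phi y - phi x)).
  rewrite [X in cabs X <= _](_ : _ = D * (phi y - phi x)); last by ring.
  rewrite cabsM => t.
  have t2 : e1 * cabs (phi y - phi x) <= cabs D / 2 * cabs (phi y - phi x) by exact: ler_wpM2r.
  have t3 : cabs D * cabs (phi y - phi x) <= 2 * L * cabs (y - x) by lra.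
  by rewrite /K mulrAC ler_pdivlMr// mulrC.
rewrite -(ler_pM2l cD) -cabsM.
rewrite (_ : D * _ = (G y - G x - d * (y - x)) - (G y - G x - D * (phi y - phi x))); last first.
  by field; exact: D0.
apply: le_trans (cabsB _ _) _.
have t1 : e1 * cabs (phi y - phi x) <= e1 * (K * cabs (y - x)) by apply: ler_wpM2l => //; exact: ltW.
have t2 : e1 * (2 * K) * cabs (y - x) <= e * cabs D * cabs (y - x) by exact: ler_wpM2r.
rewrite /e2 in h2; lra.
Qed.

(** * Extension of a matching from the attractor to a disc *)

Section Extend.
Variable A : set C.
Hypothesis HG : separated_ifs OmG g A.
Hypothesis HF : separated_ifs OmF f A.

Let hG : holomorphic_ifs OmG g. Proof. by case: HG. Qed.
Let hF : holomorphic_ifs OmF f. Proof. by case: HF. Qed.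

(** phi = f_{v1}^-1 g_{w1} is holomorphic near c and equals h on A, so f_v(phi) - g_w vanishes on A
    near c, where A has no isolated point; [identity_disc] concludes. The radius depends on c, w1
    and v1, but not on the words w and v. *)
Lemma extend_matching c (w1 : seq LG) (v1 : seq LF) (h : C -> C) : A c ->
  (forall a, A a -> A (h a) /\ word_map f v1 (h a) = word_map g w1 a) ->
  exists2 r : R, 0 < r & forall x, disc c r x ->
    [/\ OmG x, (word_map f v1 @` OmF) (word_map g w1 x) &
     forall w v, (forall a, A a -> word_map f v (h a) = word_map g w a) ->
     word_map f v (pinv OmF (word_map f v1) (word_map g w1 x)) = word_map g w x].
Proof.
move=> Ac hh.
have Oc := attr_sub HG Ac.
have [Ahc hcE] := hh c Ac; have Ohc := attr_sub HF Ahc.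
have oF := ifs_open hF.
have iv := @word_inj _ _ _ _ hF v1; have hv := @word_hol _ _ _ _ hF v1.
have hw := @word_hol _ _ _ _ hG w1.
have [e e0 he] := open_mapping oF hv iv Ohc ltr01.
have [r1 r10 hr1] := open_disc (ifs_open hG) Oc.
have [r2 r20 hr2] := hol_cont hw Oc e0.
pose r := Num.min r1 r2; have r0 : 0 < r by rewrite lt_min r10.
have subG x : disc c r x -> OmG x.
  by move=> xr; apply: hr1; apply: lt_le_trans xr _; rewrite ge_min lexx.
pose phi x := pinv OmF (word_map f v1) (word_map g w1 x).
have phi_eq x z : OmF z -> word_map f v1 z = word_map g w1 x -> phi x = z.
  by move=> Oz zE; rewrite /phi -zE pinvKV//; exact/mem_set.
have phiP x : disc c r x -> OmF (phi x) /\ word_map f v1 (phi x) = word_map g w1 x.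
  move=> xr; have := hr2 x; rewrite -hcE => /(_ _)/he[|z [_ Oz zE]].
    by apply: lt_le_trans xr _; rewrite ge_min lexx orbT.
  by rewrite (phi_eq x z Oz zE).
have hol_phi x : disc c r x -> exists d, cdiff phi x d.
  move=> xr; have [Op pE] := phiP x xr.
  have [s s0 hs] : exists2 s : R, 0 < s & forall y, cabs (y - x) < s -> disc c r y.
    exists (r - cabs (x - c)); first by move: xr; rewrite /disc /=; lra.
    by move=> y yx; rewrite /disc /=; have := cabs_tri x y c; lra.
  exists (dword g w1 x / dword f v1 (phi x)); apply: (@cdiff_implicit (word_map f v1) (word_map g w1)).
  - exact: (dwordP hF).
  - exact: (dword_neq0 hF).
  - by apply: (dwordP hG); exact: subG.
  - move=> d d0; have [e' e'0 he'] := open_mapping oF hv iv Op d0.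
    have [s' s'0 hs'] := hol_cont hw (subG x xr) e'0.
    exists s' => // y ys; have := hs' y ys; rewrite -pE => /he'[z [zx Oz zE]].
    by rewrite (phi_eq y z Oz zE).
  - by exists s => // y /hs/phiP[].
have [MF MF0 hMF] := ifs_bounded hF; have [MG MG0 hMG] := ifs_bounded hG.
have r3 : 0 < r / 3 by lra.
have rE : 3 * (r / 3) = r by field.
exists (r / 3 / 4); first by lra.
move=> x xr; have xr' : disc c r x by move: xr; rewrite /disc /=; lra.
have [Op pE] := phiP x xr'; split; first exact: subG.
  by exists (phi x).
move=> w v hwv; apply/eqP; rewrite -subr_eq0; apply/eqP.
apply: (@identity_disc R (fun y => word_map f v (phi y) - word_map g w y) c (r / 3) (MF + MG) r3);
  rewrite ?rE.
- move=> y yr; have [Opy _] := phiP y yr; have [d hd] := hol_phi y yr.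
  eexists; apply: cdiffB; last by apply: (dwordP hG w); exact: subG.
  exact: (cdiff_comp hd (dwordP hF v Opy)).
- move=> y yr; have [Opy _] := phiP y yr; apply: le_trans (cabsB _ _) _; apply: lerD.
    by apply: hMF; exact: (word_self hF).
  by apply: hMG; apply: (word_self hG); exact: subG.
- move=> d d0; have dr : 0 < Num.min d r by rewrite lt_min d0.
  have [y [Ay yc yd]] := attr_perfect HG Ac dr; exists y.
  move: yd; rewrite lt_min => /andP[yd yr]; split=> //.
  have [Ahy hyE] := hh y Ay.
  by rewrite (phi_eq y (h y) (attr_sub HF Ahy) hyE) hwv// subrr.
- by move: xr; rewrite /disc /=; exact: ltW.
Qed.

End Extend.
End TwoIFS.

(** * From equal attractors to the matching conditions *)

Section Equal.
Variable R : realType.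
Local Notation C := (Cplx R).
Variables (LG LF : finType) (OmG OmF : set C) (g : LG -> C -> C) (f : LF -> C -> C).

Lemma two_points (A : set C) : (`I_2 #<= A)%card -> exists p q, [/\ A p, A q & p != q].
Proof.
move=> /pcard_leP[h]; exists (h 0%N), (h 1%N); split; try exact: 'funS_h.
by apply/eqP => /(@inj _ _ _ h); rewrite !inE => /(_ isT isT).
Qed.

Lemma uniform_extension (T : finType) (P : C -> T -> Prop) c :
  (forall t, exists2 r : R, 0 < r & forall x, disc c r x -> P x t) ->
  exists2 r : R, 0 < r & forall x t, disc c r x -> P x t.
Proof.
move=> h; have [|r r0 hr] := @finite_uniform R T (fun t r => forall x, disc c r x -> P x t) _ h.
  by move=> t r s _ sr hx x xs; apply: hx; exact: lt_le_trans sr.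
by exists r => // x t; exact: hr.
Qed.

Variable A : set C.
Hypothesis HG : separated_ifs OmG g A.
Hypothesis HF : separated_ifs OmF f A.

Let hG : holomorphic_ifs OmG g. Proof. by case: HG. Qed.
Let hF : holomorphic_ifs OmF f. Proof. by case: HF. Qed.

(** Both directions of matching must refer to one list of word pairs: it is the disjoint union of
    the two lists, and [SG], [SF] record which direction a pair serves. *)
Lemma joint_match_list : exists (K : nat) (w_ : 'I_K -> seq LG) (v_ : 'I_K -> seq LF)
    (SG SF : set 'I_K) (h h' : 'I_K -> C -> C),
  [/\ (0 < K)%N, forall k, is_word (w_ k) /\ is_word (v_ k),
    (forall k, SG k -> forall a, A a -> A (h k a) /\ word_map f (v_ k) (h k a) = word_map g (w_ k) a) /\
    (forall k, SF k -> forall a, A a -> A (h' k a) /\ word_map g (w_ k) (h' k a) = word_map f (v_ k) a),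
    forall N : nat, exists m : nat, forall w, (m <= size w)%N -> exists v k,
      [/\ (N <= size v)%N, SG k & forall a, A a -> word_map f v (h k a) = word_map g w a] &
    forall N : nat, exists m : nat, forall v, (m <= size v)%N -> exists w k,
      [/\ (N <= size w)%N, SF k & forall a, A a -> word_map g w (h' k a) = word_map f v a]].
Proof.
have [T1 [w1 [v1 [h1 [T10 ww1 hh1 gr1]]]]] := finite_match_list HG HF.
have [T2 [v2 [w2 [h2 [T20 ww2 hh2 gr2]]]]] := finite_match_list HF HG.
pose T : finType := (T1 + T2)%type.
pose w_ (k : 'I_#|T|) := match enum_val k with inl t => w1 t | inr t => w2 t end.
pose v_ (k : 'I_#|T|) := match enum_val k with inl t => v1 t | inr t => v2 t end.
pose h (k : 'I_#|T|) := match enum_val k with inl t => h1 t | inr t => h2 t end.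
exists #|T|, w_, v_, [set k | is_inl (enum_val k)], [set k | ~~ is_inl (enum_val k)], h, h; split.
- by rewrite card_sum addn_gt0 T10.
- move=> k; rewrite /w_ /v_; case: (enum_val k) => t; first exact: ww1.
  by have [] := ww2 t.
- split=> k; rewrite /w_ /v_ /h /=; case: (enum_val k) => t //= _ a Aa; first exact: hh1.
  exact: hh2.
- move=> N; have [m hm] := gr1 N; exists m => w /hm[v [t [Nv vt]]].
  exists v, (enum_rank (inl t : T)); split=> //=; first by rewrite enum_rankK.
  by move=> a Aa; rewrite /h enum_rankK vt.
- move=> N; have [m hm] := gr2 N; exists m => v /hm[w [t [Nw wt]]].
  exists w, (enum_rank (inr t : T)); split=> //=; first by rewrite enum_rankK.
  by move=> a Aa; rewrite /h enum_rankK wt.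
Qed.

(** The common ball is centred at a point of A; its radius is the least of those provided by
    [extend_matching] for the finitely many pairs and of two discs inside the domains. *)
Lemma matching_of_equal : matching_on_balls_with OmG OmF g f
  (fun BG BF => BG = BF /\ exists2 a, A a & nbhs a BG).
Proof.
have [K [w_ [v_ [SG [SF [h [h' [K0 words [hh hh'] grG grF]]]]]]]] := joint_match_list.
have [_ _ [c [_ [Ac _ _]]] _] := HG.
have [r1 r10 ext1] := @uniform_extension 'I_K (fun x k => SG k ->
    [/\ OmG x, (word_map f (v_ k) @` OmF) (word_map g (w_ k) x) &
     forall w v, (forall a, A a -> word_map f v (h k a) = word_map g w a) ->
     word_map f v (pinv OmF (word_map f (v_ k)) (word_map g (w_ k) x)) = word_map g w x]) c
  (fun k => match pselect (SG k) with
    | left s => let: ex_intro2 r r0 hr := extend_matching HG HF Ac (hh k s) in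
        ex_intro2 _ _ r r0 (fun x xr _ => hr x xr)
    | right n => ex_intro2 _ _ 1 ltr01 (fun x xr s => False_ind _ (n s)) end).
have [r2 r20 ext2] := @uniform_extension 'I_K (fun x k => SF k ->
    [/\ OmF x, (word_map g (w_ k) @` OmG) (word_map f (v_ k) x) &
     forall v w, (forall a, A a -> word_map g w (h' k a) = word_map f v a) ->
     word_map g w (pinv OmG (word_map g (w_ k)) (word_map f (v_ k) x)) = word_map f v x]) c
  (fun k => match pselect (SF k) with
    | left s => let: ex_intro2 r r0 hr := extend_matching HF HG Ac (hh' k s) in
        ex_intro2 _ _ r r0 (fun x xr _ => hr x xr)
    | right n => ex_intro2 _ _ 1 ltr01 (fun x xr s => False_ind _ (n s)) end).
have [r3 r30 subG] := open_disc (ifs_open hG) (attr_sub HG Ac).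
have [r4 r40 subF] := open_disc (ifs_open hF) (attr_sub HF Ac).
pose r := Num.min (Num.min r1 r2) (Num.min r3 r4).
have r0 : 0 < r by rewrite !lt_min r10 r20 r30.
have ballr x : ball c (rc r) x -> [/\ disc c r1 x, disc c r2 x, disc c r3 x & disc c r4 x].
  move=> /ball_cabs; rewrite /r !lt_min => /andP[/andP[a1 a2] /andP[a3 a4]].
  by [].
have [mG hmG] := grG 1%N; have [mF hmF] := grF 1%N.
exists K, w_, v_, (maxn 1 (maxn mG mF)); split=> //; [by rewrite leq_maxl|..].
- by move=> k; have [] := words k.
- by move=> k; have [] := words k.
exists c, (rc r), c, (rc r); split.
- by split; [rewrite rc_lt|move=> x /ballr[_ _ /subG]].
- by split; [rewrite rc_lt|move=> x /ballr[_ _ _ /subF]].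
- move=> m mm w sw; have [|v [k [v1 Sk vk]]] := hmG w; first by rewrite sw; lia.
  exists v; split=> //; exists k; split.
  + by move=> _ [x /ballr[x1 _ _ _] <-]; have [] := ext1 x k x1 Sk.
  + by move=> _ [x /ballr[x1 _ _ _] <-]; have [Ox _ _] := ext1 x k x1 Sk; exists x.
  + move=> z; rewrite inE => -[x /ballr[x1 _ _ _] <-].
    have [Ox _ E] := ext1 x k x1 Sk; rewrite (transition_id _ _ hG Ox).
    exact: E.
- move=> m mm v sv; have [|w [k [w1 Sk wk]]] := hmF v; first by rewrite sv; lia.
  exists w; split=> //; exists k; split.
  + by move=> _ [x /ballr[_ x2 _ _] <-]; have [] := ext2 x k x2 Sk.
  + by move=> _ [x /ballr[_ x2 _ _] <-]; have [Ox _ _] := ext2 x k x2 Sk; exists x.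
  + move=> z; rewrite inE => -[x /ballr[_ x2 _ _] <-].
    have [Ox _ E] := ext2 x k x2 Sk; rewrite (transition_id _ _ hF Ox).
    exact: E.
- split=> //; exists c => //; apply/nbhs_ballP; exists (rc r) => //=.
  by rewrite rc_lt.
Qed.

(** The finite list determines [Ms], and only then M is chosen, large enough for the matching words
    to exceed [Ms]. The identities hold on all of A, hence on every component whatever the boxes
    are. *)
Lemma finite_matching_of_equal : finite_matching OmG OmF g f A A.
Proof.
have [K [w_ [v_ [SG [SF [h [h' [K0 words [hh hh'] grG grF]]]]]]]] := joint_match_list.
have [VG bG] := box_exists HG; have [VF bF] := box_exists HF.
pose Ms := (\max_(k < K) maxn (size (w_ k)) (size (v_ k)))%N.
have [mG hmG] := grG Ms.+1; have [mF hmF] := grF Ms.+1.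
exists VG, VF, K, w_, v_, (maxn Ms.+1 (maxn mG mF)); split=> //.
- by split=> k; have [] := words k.
- exact: leq_maxl.
have [_ AVG _ _ _] := bG; have [_ AVF _ _ _] := bF.
split=> D _ t st.
  have [|u [k [Mu Sk uk]]] := hmG t; first by rewrite st; lia.
  exists u; split=> //; first by rewrite /is_word; lia.
  exists k; split.
    by move=> _ [x [_ Ax] <-]; have [Ahx E] := hh k Sk x Ax; exists (h k x) => //; exact: AVF.
  move=> z; rewrite inE => -[x [_ Ax] <-]; have [Ahx E] := hh k Sk x Ax.
  rewrite (transition_id _ _ hG (attr_sub HG Ax)).
  by rewrite (transition_eq _ hF (attr_sub HF Ahx) (esym E)) uk.
have [|u [k [Mu Sk uk]]] := hmF t; first by rewrite st; lia.
exists u; split=> //; first by rewrite /is_word; lia.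
exists k; split.
  by move=> _ [x [_ Ax] <-]; have [Ahx E] := hh' k Sk x Ax; exists (h' k x) => //; exact: AVG.
move=> z; rewrite inE => -[x [_ Ax] <-]; have [Ahx E] := hh' k Sk x Ax.
rewrite (transition_id _ _ hF (attr_sub HF Ax)).
by rewrite (transition_eq _ hG (attr_sub HG Ahx) (esym E)) uk.
Qed.

End Equal.

Unset Implicit Arguments.

Theorem theorem3p8 (R : realType) (LG LF : finType) (OmG OmF : set (Cplx R))
    (g : LG -> Cplx R -> Cplx R) (f : LF -> Cplx R -> Cplx R)
    (AG AF : set (Cplx R))
    (hG : holomorphic_ifs OmG g) (hF : holomorphic_ifs OmF f)
    (hAG : is_attractor OmG g AG) (hAF : is_attractor OmF f AF)
    (cardAG : (`I_2 #<= AG)%card) (cardAF : (`I_2 #<= AF)%card)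
    (sscG : strong_separation g AG) (sscF : strong_separation f AF) :
  [/\ AG = AF <-> matching_on_balls OmG OmF g f,
      AG = AF <-> finite_matching OmG OmF g f AG AF &
      AG = AF ->
      matching_on_balls_with OmG OmF g f
        (fun BG BF => BG = BF /\ exists2 a, AG a & nbhs a BG)].
Proof.
have HG : separated_ifs OmG g AG by split=> //; exact: two_points.
have HF : separated_ifs OmF f AF by split=> //; exact: two_points.
have I_II : AG = AF -> matching_on_balls_with OmG OmF g f
    (fun BG BF => BG = BF /\ exists2 a, AG a & nbhs a BG).
  by move=> E; apply: matching_of_equal; rewrite // E.
split=> //; split.
- move=> /I_II[k0 [w_ [v_ [m0 [k00 m00 ww wv [bG [rG [bF [rF [h1 h2 h3 h4 _]]]]]]]]]].
  by exists k0, w_, v_, m0; split=> //; exists bG, rG, bF, rF; split.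
- move=> [k0 [w_ [v_ [m0 [_ _ _ _ [bG [rG [bF [rF [[rG0 BG] [rF0 BF] h3 h4 _]]]]]]]]]].
  apply/seteqP; split; first exact: (word_matching_sub HG HF rG0 BG h3).
  exact: (word_matching_sub HF HG rF0 BF h4).
- by move=> E; rewrite -{}E in HF *; exact: finite_matching_of_equal.
move=> [VG [VF [K [t_ [u_ [M]]]]]] [[bG bF] _ _ _ [mG mF]].
have sz k : (maxn (size (t_ k)) (size (u_ k)) <= \max_(k < K) maxn (size (t_ k)) (size (u_ k)))%N.
  exact: (leq_bigmax (F := fun k => maxn (size (t_ k)) (size (u_ k)))).
apply/seteqP; split.
  apply: (finite_matching_sub HG HF bG bF _ mG) => k.
  by apply: leq_trans (sz k); exact: leq_maxr.
apply: (finite_matching_sub HF HG bF bG _ mF) => k.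
by apply: leq_trans (sz k); exact: leq_maxl.
Qed.
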